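(* Let $\varepsilon=1/N$, $x=yN$ and $n=zN$. For $p<z<1$ and $0\ll y<Y^{-}(z)$, as $N\to\infty$, $$K_n(x)\sim\exp\left(\frac{\pi\mathrm{i}y}{\varepsilon}\right)\left[\cos\left(\frac{\pi y}{\varepsilon}\right)K^{+}(y,z)+2\mathrm{i}\sin\left(\frac{\pi y}{\varepsilon}\right)K^{-}(y,z)\right].$$
   Context: Fix real $0<p,q<1$ with $p+q=1$. For integers $n,N\ge 0$ and real $x$, the Krawtchouk polynomial is $$K_n(x)=K_n(x,N,p,q)=\sum_{k=0}^{n}\binom{x}{k}\binom{N-x}{n-k}q^{k}(-p)^{n-k},$$ where $\binom{a}{k}=a(a-1)\cdots(a-k+1)/k!$ for real $a$ and integer $k\geq 0$. The condition $0\ll y$ means that $y$ stays away from $0$. For $0<z<1$ put $$U_0(z)=\sqrt{\frac{pq(1-z)}{z}},\qquad Y^{\pm}(z)=p+(q-p)z\pm 2zU_0(z),$$ $$U^{\pm}(y,z)=-\frac12\left(\frac{p-y}{z}+q-p\right)\pm\frac12\sqrt{\left(\frac{p-y}{z}+q-p\right)^2-4U_0(z)^2},$$ $$\psi^{\pm}(y,z)=(z-1)\ln U^{\pm}+(1-y)\ln(U^{\pm}-p)+y\ln(U^{\pm}+q),$$ $$L^{\pm}(y,z)=\sqrt{\frac{(U^{\pm}-p)(U^{\pm}+q)}{z\left[(U^{\pm})^2-U_0^2\right]}},\qquad K^{\pm}(y,z)=\frac{\varepsilon^{1/2}}{\sqrt{2\pi}}\exp\left[\varepsilon^{-1}\psi^{\pm}(y,z)\right]L^{\pm}(y,z),$$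 with $U^{\pm}=U^{\pm}(y,z)$. Principal branches are used: for negative $t$, $\ln t=\ln|t|+\pi\mathrm{i}$ and $\sqrt t=\mathrm{i}\sqrt{|t|}$.
   Formalization: The sign ~ is read as: each of the two terms (with K⁺ and with K⁻) carries its own factor 1+o(1), uniformly for y and z at fixed distance from the boundary; the literal ratio need not tend to 1, since K_n(x) and the right side have nearby but different zeros near integer x. *)

(* Defs.v *)
From Stdlib Require Export Reals Factorial.
From Coquelicot Require Export Coquelicot.

Open Scope R_scope.

Fixpoint falling (a : R) (k : nat) : R :=
  match k with
  | O => 1
  | S j => falling a j * (a - INR j)
  end.

Definition binom (a : R) (k : nat) : R := falling a k / INR (fact k).

(* [sum_f_R0 f n] has the n + 1 terms f 0, ..., f n. *)
Definition krawtchouk (p q : R) (N n : nat) (x : R) : R :=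
  sum_f_R0
    (fun k => binom x k * binom (INR N - x) (n - k) * q ^ k * (- p) ^ (n - k))
    n.

Definition Cexp (w : C) : C := (exp (Re w) * cos (Im w), exp (Re w) * sin (Im w)).

(* Principal branches at real arguments: ln t = ln |t| + i pi and
   sqrt t = i sqrt |t| for t < 0.  The values at 0 are never used. *)
Definition lnC (t : R) : C := (ln (Rabs t), if Rlt_dec t 0 then PI else 0).

Definition sqrtC (t : R) : C :=
  if Rlt_dec t 0 then (0, sqrt (Rabs t)) else (sqrt t, 0).

Definition U0 (p q z : R) : R := sqrt (p * q * (1 - z) / z).

(* Below, s = 1 and s = -1 select the superscripts + and -. *)

Definition Y (s p q z : R) : R := p + (q - p) * z + s * (2 * z * U0 p q z).

(* For 0 < z and y < Y^-(z) the radicand is positive, so both roots U^+ and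
   U^- are real and the real square root is the principal one. *)
Definition U (s p q y z : R) : R :=
  - (1 / 2) * ((p - y) / z + q - p)
  + s * (1 / 2 * sqrt (((p - y) / z + q - p) ^ 2 - 4 * U0 p q z ^ 2)).

Definition psi (s p q y z : R) : C :=
  (RtoC (z - 1) * lnC (U s p q y z)
   + RtoC (1 - y) * lnC (U s p q y z - p)
   + RtoC y * lnC (U s p q y z + q))%C.

Definition L (s p q y z : R) : C :=
  sqrtC ((U s p q y z - p) * (U s p q y z + q)
         / (z * (U s p q y z ^ 2 - U0 p q z ^ 2))).

Definition K (s p q eps y z : R) : C :=
  (RtoC (sqrt eps / sqrt (2 * PI)) * Cexp (RtoC (/ eps) * psi s p q y z)
   * L s p q y z)%C.

(* The relation f ~ g1 + g2 with relative error tolerance eta.  When g1 and g2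
   are oscillating terms whose sum changes sign, f and g1 + g2 have nearby but
   different zeros, so f / (g1 + g2) cannot tend to 1 uniformly; the meaning is
   f = g1 (1 + o(1)) + g2 (1 + o(1)).  Equivalently
   f - (g1 + g2) = o(|g1| + |g2|), so f / (g1 + g2) does tend to 1 wherever
   |g1| + |g2| = O(|g1 + g2|); in particular where one of the terms vanishes. *)
Definition sim2 (eta : R) (f g1 g2 : C) : Prop :=
  exists a b : C,
    Cmod (a - 1)%C < eta /\ Cmod (b - 1)%C < eta /\
    f = (g1 * a + g2 * b)%C.

(* Main.v *)
Require Import Defs.
From Stdlib Require Import Psatz.

(** The number K_n(x) is the coefficient of w^n in G(w) = (1 + q w)^x (1 - p w)^(N - x), and the
    proof is the method of steepest descent for h(w) = G(w) w^(- n) in the closed upper half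
    plane, carried out with real functions: with w = e^(s + i t) and 0 <= t <= pi, the
    functions [hre] and [him] are the real and imaginary parts of h.

    By the Cauchy-Riemann equations ([h_cauchy_riemann]) the s-derivative of the integral of
    Re h over the half circle of radius e^s is Im h(- e^s) - Im h(e^s) ([green_strip]).  On
    the unit half circle the integral is pi K_n(x) ([coef_integral]); growing the radius to
    e^S gives pi K_n(x) exactly, as an integral over the half circle of radius e^S and
    integrals of Im h along the real axis.  These live on the cuts 1 + q w < 0 and 1 - p w < 0,
    where Im h is plus or minus sin(pi x) |h|.

    The critical points of |h| on the negative axis are w = 1 / U^-, a maximum, and
    w = 1 / U^+, a minimum, which lies farther from the origin.  Take e^S = 1 / |U^+|.
    Along the half circle |h| is then largest at 1 / U^+, because ln |h| is a concave function
    of 1 + cos t ([arc_le]), and Laplace's method yields the term K^+ with the factor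
    cos(pi x), the value of (-1)^n Re h / |h| on the left cut ([arc_asymptotic]).  The segment
    of the left cut up to 1 / U^+ contains the maximum 1 / U^-, and Laplace's method yields the
    term K^- with the factor sin(pi x) ([seg_asymptotic]).

    Everything else (the oscillation of the argument of h on the half circle and the right
    cut) carries the factor sin(pi x) and is at most |h(1 / U^+)| times a constant, hence
    exponentially smaller than the K^- term ([coef_decomposition], [seg_tail]).  So
    K_n(x) = (-1)^n (cos(pi x) T1 - sin(pi x) T2) with T1 and T2 each asymptotic to its saddle
    point value.  This keeps the two relative errors separate, also where the cosine, the sine
    or the whole right-hand side vanishes.  All constants depend on p, q and delta only, which
    gives uniformity ([coef_asymptotic]). *)

(** * Calculus on intervals and rectangles *)

Lemma continuous_2d_fst f s t : continuity_2d_pt f s t -> continuous (fun u => f u t) s.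
Proof.
  intros H. apply continuity_pt_filterlim. intros eps Heps.
  destruct (H (mkposreal eps Heps)) as [d Hd].
  exists d. split; [apply cond_pos|]. intros u [_ Hu].
  apply Hd; [exact Hu|]. rewrite Rminus_diag, Rabs_R0. apply cond_pos.
Qed.

Lemma continuous_2d_snd f s t : continuity_2d_pt f s t -> continuous (fun v => f s v) t.
Proof.
  intros H. apply continuity_pt_filterlim. intros eps Heps.
  destruct (H (mkposreal eps Heps)) as [d Hd].
  exists d. split; [apply cond_pos|]. intros u [_ Hu].
  apply Hd; [|exact Hu]. rewrite Rminus_diag, Rabs_R0. apply cond_pos.
Qed.

Lemma ex_RInt_cont (f : R -> R) a b :
  a <= b -> (forall x, a <= x <= b -> continuous f x) -> ex_RInt f a b.
Proof.
  intros Hab H. apply (ex_RInt_continuous (V := R_CompleteNormedModule)).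
  intros z. rewrite Rmin_left, Rmax_right by lra. apply H.
Qed.

Lemma RInt_split (f : R -> R) a b c :
  a <= b <= c -> ex_RInt f a c -> RInt f a c = RInt f a b + RInt f b c.
Proof.
  intros H Hex. symmetry. apply (RInt_Chasles (V := R_CompleteNormedModule)).
  - now apply ex_RInt_Chasles_1 with c.
  - now apply ex_RInt_Chasles_2 with a.
Qed.

Lemma RInt_sub (f g : R -> R) a b :
  ex_RInt f a b -> ex_RInt g a b ->
  RInt (fun x => f x - g x) a b = RInt f a b - RInt g a b.
Proof. intros; now apply (RInt_minus (V := R_CompleteNormedModule)). Qed.

Lemma RInt_mulc (f : R -> R) a b c :
  ex_RInt f a b -> RInt (fun x => c * f x) a b = c * RInt f a b.
Proof. intros; now apply (RInt_scal (V := R_CompleteNormedModule)). Qed.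

Lemma RInt_ext_R (f g : R -> R) a b :
  a <= b -> (forall x, a < x < b -> f x = g x) -> RInt f a b = RInt g a b.
Proof.
  intros H Hx. apply RInt_ext. rewrite Rmin_left, Rmax_right by lra. exact Hx.
Qed.

(** Derivatives are only available in the open strip; this controls the passage to the closed one. *)
Lemma RInt_trim (f : R -> R) a b M e :
  0 <= e -> 2 * e <= b - a -> (forall x, a <= x <= b -> continuous f x) ->
  (forall x, a <= x <= b -> Rabs (f x) <= M) ->
  Rabs (RInt f a b - RInt f (a + e) (b - e)) <= 2 * e * M.
Proof.
  intros He Hab Hc HM.
  assert (Hex : ex_RInt f a b) by (apply ex_RInt_cont; [lra|auto]).
  rewrite (RInt_split f a (a + e) b) by (auto; lra).
  rewrite (RInt_split f (a + e) (b - e) b);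
    [|lra|apply ex_RInt_cont; [lra|intros; apply Hc; lra]].
  replace (RInt f a (a + e) + (RInt f (a + e) (b - e) + RInt f (b - e) b)
           - RInt f (a + e) (b - e))
    with (RInt f a (a + e) + RInt f (b - e) b) by ring.
  eapply Rle_trans; [apply Rabs_triang|].
  assert (H1 : Rabs (RInt f a (a + e)) <= (a + e - a) * M).
  { apply abs_RInt_le_const; [lra| |intros; apply HM; lra].
    apply ex_RInt_cont; [lra|intros; apply Hc; lra]. }
  assert (H2 : Rabs (RInt f (b - e) b) <= (b - (b - e)) * M).
  { apply abs_RInt_le_const; [lra| |intros; apply HM; lra].
    apply ex_RInt_cont; [lra|intros; apply Hc; lra]. }
  lra.
Qed.

Lemma continuous_bounded (f : R -> R) a b :
  a <= b -> (forall x, a <= x <= b -> continuous f x) ->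
  exists M, 0 <= M /\ forall x, a <= x <= b -> Rabs (f x) <= M.
Proof.
  intros Hab Hc.
  destruct (continuity_ab_maj (fun x => Rabs (f x)) a b Hab) as [m [Hm _]].
  { intros c Hcc. apply continuity_pt_filterlim.
    apply (continuous_comp f Rabs); [now apply Hc|].
    apply continuous_Rabs. }
  exists (Rabs (f m)). split; [apply Rabs_pos|exact Hm].
Qed.

Lemma eq_0_of_Rabs_le_all x : (forall e, 0 < e -> Rabs x <= e) -> x = 0.
Proof.
  intros H. destruct (Req_dec x 0) as [|Hx]; [assumption|].
  pose proof (Rabs_pos_lt x Hx). specialize (H (Rabs x / 2)). lra.
Qed.

Lemma RInt_abs_diff (f g : R -> R) a b e :
  a <= b -> ex_RInt f a b -> ex_RInt g a b ->
  (forall x, a <= x <= b -> Rabs (f x - g x) <= e) ->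
  Rabs (RInt f a b - RInt g a b) <= (b - a) * e.
Proof.
  intros Hab Hf Hg H. rewrite <- RInt_sub by assumption.
  apply abs_RInt_le_const; [lra| |exact H].
  now apply (ex_RInt_minus (V := R_CompleteNormedModule)).
Qed.

Lemma ex_derive_continuity_pt (f : R -> R) x : ex_derive f x -> continuity_pt f x.
Proof. intros H. apply continuity_pt_filterlim. now apply (ex_derive_continuous f). Qed.

Lemma cont_of_ex_derive (f : R -> R) x : ex_derive f x -> continuous f x.
Proof. apply (ex_derive_continuous f). Qed.

Lemma RInt_add (f g : R -> R) a b :
  ex_RInt f a b -> ex_RInt g a b ->
  RInt (fun x => f x + g x) a b = RInt f a b + RInt g a b.
Proof. intros; now apply (RInt_plus (V := R_CompleteNormedModule)). Qed.

(** The fundamental theorem on trimmed intervals, then the limit: f is continuous and df bounded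
    up to the end points. *)
Lemma RInt_derive_open (f df : R -> R) a b :
  a < b -> (forall x, a < x < b -> is_derive f x (df x)) ->
  (forall x, a <= x <= b -> continuous f x) ->
  (forall x, a <= x <= b -> continuous df x) ->
  RInt df a b = f b - f a.
Proof.
  intros Hab Hd Cf Cd.
  destruct (continuous_bounded df a b) as [M [HM BM]]; [lra|assumption|].
  apply Rminus_diag_uniq, eq_0_of_Rabs_le_all. intros e He.
  assert (Ca := Cf a ltac:(lra)). assert (Cb := Cf b ltac:(lra)).
  apply continuity_pt_filterlim in Ca. apply continuity_pt_filterlim in Cb.
  destruct (Ca (e / 4)) as [d1 [Hd1 Ha]]; [lra|].
  destruct (Cb (e / 4)) as [d2 [Hd2 Hb]]; [lra|]. simpl in Ha, Hb.
  set (h := Rmin (Rmin (d1 / 2) (d2 / 2)) (Rmin ((b - a) / 4) (e / (4 * (1 + M))))).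
  assert (Hh : 0 < h).
  { unfold h. repeat apply Rmin_glb_lt; try lra. apply Rdiv_lt_0_compat; lra. }
  assert (h <= d1 / 2) by (eapply Rle_trans; [apply Rmin_l|apply Rmin_l]).
  assert (h <= d2 / 2) by (eapply Rle_trans; [apply Rmin_l|apply Rmin_r]).
  assert (h <= (b - a) / 4) by (eapply Rle_trans; [apply Rmin_r|apply Rmin_l]).
  assert (He' : h <= e / (4 * (1 + M))) by (eapply Rle_trans; [apply Rmin_r|apply Rmin_r]).
  assert (T := RInt_trim df a b M h ltac:(lra) ltac:(lra) Cd BM).
  assert (E : RInt df (a + h) (b - h) = f (b - h) - f (a + h)).
  { apply is_RInt_unique, (is_RInt_derive (V := R_CompleteNormedModule) f df);
      rewrite Rmin_left, Rmax_right by lra; intros; [apply Hd|apply Cd]; lra. }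
  rewrite E in T.
  assert (Y1 : Rabs (f (a + h) - f a) < e / 4).
  { apply Ha. split; [split; [exact I|lra]|]. unfold Rdist.
    rewrite Rabs_right; lra. }
  assert (Y2 : Rabs (f (b - h) - f b) < e / 4).
  { apply Hb. split; [split; [exact I|lra]|]. unfold Rdist. rewrite Rabs_left; lra. }
  apply Rle_div_r in He'; [|lra].
  apply Rabs_lt_between in Y1. apply Rabs_lt_between in Y2.
  apply Rabs_le_between in T. apply Rabs_le. nra.
Qed.

Lemma RInt_reflect (f : R -> R) T :
  0 <= T -> (forall t, 0 <= t <= T -> continuous f t) ->
  RInt f 0 T = RInt (fun t => f (T - t)) 0 T.
Proof.
  intros HT Hf.
  assert (Hc : forall t, 0 <= t <= T -> continuous (fun t => f (T - t)) t).
  { intros t Ht. apply (continuous_comp (fun t => T - t) f); [|apply Hf; lra].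
    apply cont_of_ex_derive. now auto_derive. }
  assert (E1 : - RInt f T 0 = RInt f 0 T).
  { apply (opp_RInt_swap (V := R_CompleteNormedModule)).
    apply ex_RInt_swap; now apply ex_RInt_cont. }
  assert (E2 : RInt (fun y => -1 * f (T - y)) 0 T = RInt f (T - 0) (T - T)).
  { apply (RInt_comp (V := R_CompleteNormedModule) f (fun t => T - t) (fun _ => -1) 0 T).
    - intros t. rewrite Rmin_left, Rmax_right by lra. intros Ht. apply Hf; lra.
    - intros t _. split; [auto_derive; [trivial|ring]|apply continuous_const]. }
  rewrite RInt_mulc in E2 by now apply ex_RInt_cont.
  replace (T - 0) with T in E2 by ring. replace (T - T) with 0 in E2 by ring. lra.
Qed.

Lemma incr_of_derive_nonneg (f df : R -> R) a b :
  a <= b -> (forall s, a <= s <= b -> is_derive f s (df s)) ->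
  (forall s, a <= s <= b -> 0 <= df s) -> f a <= f b.
Proof.
  intros Hab Hd Hp.
  destruct (MVT_gen f a b df) as [c [Hc E]]; rewrite ?Rmin_left, ?Rmax_right by lra.
  - intros; apply Hd; lra.
  - intros; apply ex_derive_continuity_pt. exists (df x). now apply Hd.
  - rewrite Rmin_left, Rmax_right in Hc by lra. specialize (Hp c Hc). nra.
Qed.

Lemma mean_ineq (f df : R -> R) t B :
  0 <= t -> (forall u, 0 <= u <= t -> is_derive f u (df u)) ->
  (forall u, 0 <= u <= t -> Rabs (df u) <= B) -> Rabs (f t - f 0) <= B * t.
Proof.
  intros Ht Hd HB.
  destruct (MVT_gen f 0 t df) as [c [Hc E]]; rewrite ?Rmin_left, ?Rmax_right by lra.
  - intros; apply Hd; lra.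
  - intros; apply ex_derive_continuity_pt. exists (df x). now apply Hd.
  - rewrite Rmin_left, Rmax_right in Hc by lra. rewrite E, Rminus_0_r, Rabs_mult, (Rabs_pos_eq t) by lra.
    apply Rmult_le_compat_r; [lra|]. now apply HB.
Qed.

(** Three applications of the mean value inequality, one for each derivative. *)
Lemma taylor_cubic (f f1 f2 f3 : R -> R) T M t :
  (forall u, 0 <= u <= T -> is_derive f u (f1 u)) ->
  (forall u, 0 <= u <= T -> is_derive f1 u (f2 u)) ->
  (forall u, 0 <= u <= T -> is_derive f2 u (f3 u)) ->
  (forall u, 0 <= u <= T -> Rabs (f3 u) <= M) -> f1 0 = 0 -> 0 <= t <= T ->
  Rabs (f t - f 0 - f2 0 * t ^ 2 / 2) <= M * t ^ 3.
Proof.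
  intros D1 D2 D3 B Z Ht.
  assert (HM : 0 <= M) by (eapply Rle_trans; [apply Rabs_pos|apply (B 0); lra]).
  assert (B2 : forall u, 0 <= u <= t -> Rabs (f2 u - f2 0) <= M * t).
  { intros u Hu. apply Rle_trans with (M * u); [|apply Rmult_le_compat_l; lra].
    apply mean_ineq with f3; [lra|intros; apply D3; lra|intros; apply B; lra]. }
  assert (B1 : forall u, 0 <= u <= t -> Rabs (f1 u - f2 0 * u) <= M * t * t).
  { intros u Hu. apply Rle_trans with (M * t * u);
      [|apply Rmult_le_compat_l; [apply Rmult_le_pos|]; lra].
    replace (f1 u - f2 0 * u) with ((f1 u - f2 0 * u) - (f1 0 - f2 0 * 0)) by (rewrite Z; ring).
    apply (mean_ineq (fun u => f1 u - f2 0 * u) (fun u => f2 u - f2 0)); [lra| |].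
    - intros r Hr. apply (is_derive_minus (K := R_AbsRing) (V := R_NormedModule) f1 (fun u => f2 0 * u)).
      + apply D2; lra.
      + auto_derive; [trivial|ring].
    - intros r Hr. apply B2; lra. }
  replace (M * t ^ 3) with (M * t * t * t) by ring.
  replace (f t - f 0 - f2 0 * t ^ 2 / 2)
    with ((f t - f2 0 * t ^ 2 / 2) - (f 0 - f2 0 * 0 ^ 2 / 2)) by field.
  apply (mean_ineq (fun u => f u - f2 0 * u ^ 2 / 2) (fun u => f1 u - f2 0 * u)); [lra| |].
  - intros r Hr. apply (is_derive_minus (K := R_AbsRing) (V := R_NormedModule) f (fun u => f2 0 * u ^ 2 / 2)).
    + apply D1; lra.
    + auto_derive; [trivial|field].
  - intros r Hr. apply B1; lra.
Qed.

(** Differentiation under the integral sign turns D = dP/ds into the integral of D = dQ/dt,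
    which is a difference of boundary values. *)
Lemma green_interior (P Q D : R -> R -> R) sg s0 s1 A B a b :
  s0 <= s1 < sg -> A < a -> a < b -> b < B ->
  (forall s t, s < sg -> A < t < B -> is_derive (fun u => P u t) s (D s t)) ->
  (forall s t, s < sg -> A < t < B -> is_derive (fun v => Q s v) t (D s t)) ->
  (forall s t, s < sg -> A < t < B -> continuity_2d_pt P s t) ->
  (forall s t, s < sg -> A < t < B -> continuity_2d_pt Q s t) ->
  (forall s t, s < sg -> A < t < B -> continuity_2d_pt D s t) ->
  RInt (P s1) a b - RInt (P s0) a b = RInt (fun s => Q s b - Q s a) s0 s1.
Proof.
  intros Hs HA Hab HB HP HQ CP CQ CD.
  assert (Hloc : forall s, s < sg -> locally s (fun u => u < sg)).
  { intros s Hss. apply (open_lt sg). exact Hss. }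
  (* the derivative of the inner integral *)
  assert (HJ : forall s, s < sg ->
            is_derive (fun u => RInt (P u) a b) s (Q s b - Q s a)).
  { intros s Hss.
    assert (E : RInt (fun t => Derive (fun u => P u t) s) a b = Q s b - Q s a).
    { rewrite (RInt_ext_R _ (D s)); [|lra|].
      - apply is_RInt_unique.
        apply (is_RInt_derive (V := R_CompleteNormedModule) (Q s) (D s));
          rewrite Rmin_left, Rmax_right by lra; intros t Ht.
        + apply HQ; lra.
        + apply continuous_2d_snd, CD; lra.
      - intros t Ht. apply is_derive_unique, HP; lra. }
    rewrite <- E.
    apply (is_derive_RInt_param P a b s).
    - generalize (Hloc s Hss). apply filter_imp. intros u Hu t.
      rewrite Rmin_left, Rmax_right by lra.
      intros Ht. exists (D u t). apply HP; lra.
    - intros t. rewrite Rmin_left, Rmax_right by lra. intros Ht.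
      apply continuity_2d_pt_ext_loc with D; [|apply CD; lra].
      assert (Hd : 0 < Rmin (sg - s) (Rmin (t - A) (B - t))).
      { repeat apply Rmin_glb_lt; lra. }
      exists (mkposreal _ Hd). simpl. intros u v Hu Hv.
      pose proof (Rmin_l (sg - s) (Rmin (t - A) (B - t))).
      pose proof (Rmin_r (sg - s) (Rmin (t - A) (B - t))).
      pose proof (Rmin_l (t - A) (B - t)). pose proof (Rmin_r (t - A) (B - t)).
      apply Rabs_lt_between in Hu. apply Rabs_lt_between in Hv.
      symmetry. apply is_derive_unique, HP; lra.
    - generalize (Hloc s Hss). apply filter_imp. intros u Hu. apply ex_RInt_cont; [lra|].
      intros t Ht. apply continuous_2d_snd, CP; lra. }
  symmetry. apply is_RInt_unique.
  apply (is_RInt_derive (V := R_CompleteNormedModule)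
           (fun u => RInt (P u) a b) (fun s => Q s b - Q s a));
    rewrite Rmin_left, Rmax_right by lra; intros s Hss.
  - apply HJ; lra.
  - apply (continuous_minus (fun s => Q s b) (fun s => Q s a) s);
      apply continuous_2d_fst; apply CQ; lra.
Qed.

(** Uniform continuity lets the interior rectangles grow to the closed one.  The strip of
    [h_cauchy_riemann] needs this form: h is not differentiable at the branch points, which
    lie on the boundary. *)
Lemma green_strip (P Q D : R -> R -> R) sg s0 s1 a b :
  s0 <= s1 < sg -> a < b ->
  (forall s t, s < sg -> a <= t <= b -> continuity_2d_pt P s t) ->
  (forall s t, s < sg -> a <= t <= b -> continuity_2d_pt Q s t) ->
  (forall s t, s < sg -> a < t < b -> is_derive (fun u => P u t) s (D s t)) ->
  (forall s t, s < sg -> a < t < b -> is_derive (fun v => Q s v) t (D s t)) ->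
  (forall s t, s < sg -> a < t < b -> continuity_2d_pt D s t) ->
  RInt (P s1) a b - RInt (P s0) a b = RInt (fun s => Q s b - Q s a) s0 s1.
Proof.
  intros Hs Hab CP CQ HP HQ CD.
  assert (CP' : forall s t, s0 <= s <= s1 -> a <= t <= b -> continuous (P s) t).
  { intros s t H1 H2. apply continuous_2d_snd, CP; lra. }
  assert (CQ' : forall s t, s0 <= s <= s1 -> a <= t <= b ->
            continuous (fun s => Q s t) s).
  { intros s t H1 H2. apply continuous_2d_fst, CQ; lra. }
  destruct (continuous_bounded (P s0) a b) as [M0 [HM0 B0]];
    [lra|intros; apply CP'; lra|].
  destruct (continuous_bounded (P s1) a b) as [M1 [HM1 B1]];
    [lra|intros; apply CP'; lra|].
  apply Rminus_diag_uniq, eq_0_of_Rabs_le_all. intros e He.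
  set (c := e / (2 * (1 + 2 * (s1 - s0)))).
  assert (Hc : 0 < c) by (apply Rdiv_lt_0_compat; lra).
  destruct (uniform_continuity_2d Q s0 s1 a b) with (eps := mkposreal c Hc)
    as [d Hd]; [intros; apply CQ; lra|]. simpl in Hd.
  (* h is small for uniform continuity, for a nonempty rectangle and for the trimmed ends *)
  set (h := Rmin (Rmin (d / 2) ((b - a) / 4)) (e / (4 * (1 + M0 + M1)))).
  assert (Hh : 0 < h).
  { pose proof (cond_pos d).
    apply Rmin_glb_lt; [apply Rmin_glb_lt; lra|apply Rdiv_lt_0_compat; lra]. }
  assert (Hhd : h <= d / 2).
  { eapply Rle_trans; [apply Rmin_l|apply Rmin_l]. }
  assert (Hhab : h <= (b - a) / 4).
  { eapply Rle_trans; [apply Rmin_l|apply Rmin_r]. }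
  assert (Hhe : h <= e / (4 * (1 + M0 + M1))) by apply Rmin_r.
  pose proof (cond_pos d) as Hdpos.
  pose proof (green_interior P Q D sg s0 s1 a b (a + h) (b - h)) as G.
  assert (T0 := RInt_trim (P s0) a b M0 h).
  assert (T1 := RInt_trim (P s1) a b M1 h).
  assert (T2 := RInt_abs_diff (fun s => Q s b - Q s a)
                  (fun s => Q s (b - h) - Q s (a + h)) s0 s1 (2 * c)).
  rewrite <- G in T2; [| lra.. | | | | |]; try (intros; auto; apply CP || apply CQ; lra).
  assert (X0 : Rabs (RInt (P s0) a b - RInt (P s0) (a + h) (b - h)) <= 2 * h * M0).
  { apply T0; try lra; auto. intros; apply CP'; lra. }
  assert (X1 : Rabs (RInt (P s1) a b - RInt (P s1) (a + h) (b - h)) <= 2 * h * M1).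
  { apply T1; try lra; auto. intros; apply CP'; lra. }
  assert (X2 : Rabs (RInt (fun s => Q s b - Q s a) s0 s1 -
     (RInt (P s1) (a + h) (b - h) - RInt (P s0) (a + h) (b - h))) <= (s1 - s0) * (2 * c)).
  { apply T2; [lra| | |].
    - apply ex_RInt_cont; [lra|]. intros s Hss.
      apply (continuous_minus (fun s => Q s b) (fun s => Q s a) s); apply CQ'; lra.
    - apply ex_RInt_cont; [lra|]. intros s Hss.
      apply (continuous_minus (fun s => Q s (b - h)) (fun s => Q s (a + h)) s);
        apply CQ'; lra.
    - intros s Hss.
      assert (Y1 : Rabs (Q s (b - h) - Q s b) < c).
      { apply Hd; try lra. rewrite Rminus_diag, Rabs_R0; lra.
        rewrite Rabs_left; lra. }
      assert (Y2 : Rabs (Q s (a + h) - Q s a) < c).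
      { apply Hd; try lra. rewrite Rminus_diag, Rabs_R0; lra.
        rewrite Rabs_right; lra. }
      apply Rabs_lt_between in Y1. apply Rabs_lt_between in Y2.
      apply Rabs_le. lra. }
  assert (Z1 : (s1 - s0) * (2 * c) <= e / 2).
  { unfold c. replace ((s1 - s0) * (2 * (e / (2 * (1 + 2 * (s1 - s0))))))
      with (e / 2 * (2 * (s1 - s0) / (1 + 2 * (s1 - s0)))) by (field; lra).
    assert (2 * (s1 - s0) / (1 + 2 * (s1 - s0)) <= 1).
    { apply Rle_div_l; lra. }
    nra. }
  assert (Z2 : 2 * h * M0 + 2 * h * M1 <= e / 2).
  { apply Rle_trans with (2 * (h * (1 + M0 + M1))); [nra|].
    apply Rle_div_r in Hhe; [|lra]. lra. }
  apply Rabs_le_between in X0. apply Rabs_le_between in X1.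
  apply Rabs_le_between in X2. apply Rabs_le. lra.
Qed.

(** * Elementary inequalities *)

Lemma Rabs_cos_le t : Rabs (cos t) <= 1.
Proof. apply Rabs_le, COS_bound. Qed.

Lemma Rabs_sin_le t : Rabs (sin t) <= 1.
Proof. apply Rabs_le, SIN_bound. Qed.

Lemma exp_mono x y : x <= y -> exp x <= exp y.
Proof. intros [H| ->]; [left; now apply exp_increasing|lra]. Qed.

Lemma exp_lower u : 1 + u <= exp u.
Proof. destruct (Req_dec u 0) as [->|H]; [rewrite exp_0; lra|left; now apply exp_ineq1]. Qed.

Lemma exp_neg_bound u : 0 < u -> exp (- u) <= / u.
Proof.
  intros H. rewrite exp_Ropp. apply Rinv_le_contravar; [assumption|].
  pose proof (exp_lower u). lra.
Qed.

Lemma exp_diff_le A B c : A <= c -> B <= c -> Rabs (exp A - exp B) <= Rabs (A - B) * exp c.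
Proof.
  assert (W : forall A B, B <= A -> A <= c -> Rabs (exp A - exp B) <= Rabs (A - B) * exp c).
  { clear. intros A B H HA.
    pose proof (exp_mono B A H).
    rewrite !Rabs_pos_eq by lra. pose proof (exp_mono A c HA). pose proof (exp_pos A).
    apply Rle_trans with ((A - B) * exp A); [|apply Rmult_le_compat_l; lra].
    replace B with (A + - (A - B)) at 1 by ring. rewrite exp_plus.
    pose proof (exp_lower (- (A - B))). nra. }
  intros HA HB. destruct (Rle_dec B A).
  - now apply W.
  - rewrite Rabs_minus_sym, (Rabs_minus_sym A). apply W; lra.
Qed.

Lemma one_minus_cos_le d : Rabs (cos d - 1) <= Rabs d.
Proof.
  assert (W : forall d, 0 <= d -> Rabs (cos d - 1) <= d).
  { clear. intros d Hd.
    destruct (MVT_gen cos 0 d (fun t => - sin t)) as [c [_ Hc]].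
    - intros; auto_derive; [trivial|ring].
    - intros; apply continuity_cos.
    - rewrite cos_0 in Hc. rewrite Hc, Rminus_0_r, Rabs_mult, Rabs_Ropp, (Rabs_pos_eq d) by lra.
      pose proof (Rabs_sin_le c). nra. }
  destruct (Rle_dec 0 d).
  - rewrite (Rabs_pos_eq d) by lra. now apply W.
  - rewrite <- cos_neg. rewrite (Rabs_left d) by lra. apply W; lra.
Qed.

Lemma exp_le_1 u : u <= 0 -> exp u <= 1.
Proof. intros H. rewrite <- exp_0. now apply exp_mono. Qed.

Lemma ln_le_sub1 u : 0 < u -> ln u <= u - 1.
Proof.
  intros H. pose proof (exp_lower (ln u)). rewrite exp_ln in H0 by assumption. lra.
Qed.

Lemma ln_quadratic w : Rabs w <= 1 / 2 -> Rabs (ln (1 + w) - w) <= 2 * w ^ 2.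
Proof.
  intros H. apply Rabs_le_between in H.
  pose proof (ln_le_sub1 (1 + w) ltac:(lra)).
  pose proof (ln_le_sub1 (/ (1 + w)) ltac:(apply Rinv_0_lt_compat; lra)) as H1.
  rewrite ln_Rinv in H1 by lra.
  assert (/ (1 + w) - 1 <= - w + 2 * w ^ 2).
  { replace (/ (1 + w) - 1) with (- w + w ^ 2 * / (1 + w)) by (field; lra).
    assert (/ (1 + w) <= 2).
    { replace 2 with (/ (1 / 2)) by field. apply Rinv_le_contravar; lra. }
    pose proof (pow2_ge_0 w). nra. }
  apply Rabs_le. pose proof (pow2_ge_0 w). lra.
Qed.

Lemma sin_sub_le u : 0 <= u -> Rabs (sin u - u) <= u ^ 2.
Proof.
  intros Hu. destruct (MVT_gen (fun u => sin u - u) 0 u (fun u => cos u - 1)) as [c [Hc E]].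
  - intros; auto_derive; [trivial|ring].
  - intros; apply ex_derive_continuity_pt; now auto_derive.
  - rewrite Rmin_left, Rmax_right in Hc by lra.
    rewrite sin_0 in E. replace (sin u - u) with ((cos c - 1) * (u - 0)) by (rewrite <- E; ring).
    rewrite Rabs_mult, Rminus_0_r, (Rabs_pos_eq u) by lra.
    pose proof (one_minus_cos_le c). rewrite (Rabs_pos_eq c) in H by lra.
    pose proof (Rabs_pos (cos c - 1)). nra.
Qed.

Lemma versine_bounds t : 0 <= t ->
  Rabs (1 - cos t - t ^ 2 / 2) <= t ^ 3.
Proof.
  intros Ht. destruct (MVT_gen (fun u => 1 - cos u - u ^ 2 / 2) 0 t (fun u => sin u - u)) as [c [Hc E]].
  - intros; auto_derive; [trivial|field].
  - intros; apply ex_derive_continuity_pt; now auto_derive.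
  - rewrite Rmin_left, Rmax_right in Hc by lra.
    rewrite cos_0 in E. replace (1 - cos t - t ^ 2 / 2) with ((sin c - c) * (t - 0)) by (rewrite <- E; field).
    rewrite Rabs_mult, Rminus_0_r, (Rabs_pos_eq t) by lra.
    pose proof (sin_sub_le c ltac:(lra)).
    assert (c ^ 2 <= t ^ 2) by (apply pow_incr; lra).
    replace (t ^ 3) with (t ^ 2 * t) by ring. apply Rmult_le_compat_r; lra.
Qed.

Lemma exp_small_upper u : 0 <= u < 1 -> exp u <= / (1 - u).
Proof.
  intros H. rewrite <- (Rinv_inv (exp u)), <- exp_Ropp.
  apply Rinv_le_contravar; [lra|]. pose proof (exp_lower (- u)). lra.
Qed.

Lemma ln_neg c : 0 < c < 1 -> ln c < 0.
Proof. intros H. rewrite <- ln_1. apply ln_increasing; lra. Qed.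

Lemma mul_exp_lt_1 c s : 0 < c < 1 -> s < - ln c -> c * exp s < 1.
Proof.
  intros Hc H. rewrite <- (exp_ln c) at 1 by lra. rewrite <- exp_plus, <- exp_0.
  apply exp_increasing. lra.
Qed.

Lemma log_of_mul_exp_gt_1 c S : 0 < c -> 1 < c * exp S -> - ln c < S.
Proof.
  intros Hc H. apply ln_increasing in H; [|lra].
  rewrite ln_1, ln_mult, ln_exp in H by (assumption || apply exp_pos). lra.
Qed.

Lemma mul_exp_le_1 c s : 0 < c -> s <= - ln c -> c * exp s <= 1.
Proof.
  intros Hc H. rewrite <- (exp_ln c) at 1 by lra. rewrite <- exp_plus, <- exp_0.
  apply exp_mono. lra.
Qed.

Lemma mul_exp_ge_1 c s : 0 < c -> - ln c <= s -> 1 <= c * exp s.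
Proof.
  intros Hc H. rewrite <- (exp_ln c) at 1 by lra. rewrite <- exp_plus, <- exp_0.
  apply exp_mono. lra.
Qed.

Lemma sin_INR_PI n : sin (INR n * PI) = 0.
Proof. apply sin_eq_0_1. exists (Z.of_nat n). now rewrite <- INR_IZR_INZ. Qed.

Lemma cos_INR_PI n : cos (INR n * PI) = (-1) ^ n.
Proof.
  induction n as [|n IH]; [simpl; rewrite Rmult_0_l; apply cos_0|].
  rewrite S_INR, Rmult_plus_distr_r, Rmult_1_l, neg_cos, IH. simpl. ring.
Qed.

(** * Real powers on the closed upper half plane *)

(** The principal argument of X + i Y for Y >= 0, equal to pi on the negative axis.  The absolute
    value extends it by reflection, which makes it continuous on the plane without the origin. *)
Definition arg (X Y : R) : R :=
  if Req_EM_T Y 0 then (if Rlt_dec X 0 then PI else 0)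
  else PI / 2 - atan (X / Rabs Y).

(** The modulus of (X + i Y)^x.  The value 0 at the origin is set by hand, since ln 0 = 0 would
    give 1 there. *)
Definition modpow (x X Y : R) : R :=
  if Req_EM_T (X ^ 2 + Y ^ 2) 0 then 0 else exp (x / 2 * ln (X ^ 2 + Y ^ 2)).

Lemma sumsq_pos X Y : X <> 0 \/ Y <> 0 -> 0 < X ^ 2 + Y ^ 2.
Proof. intros [H|H]; [assert (0 < X ^ 2) by (apply pow2_gt_0; auto)|
  assert (0 < Y ^ 2) by (apply pow2_gt_0; auto)]; nra. Qed.

Lemma continuity_2d_abs2 X Y : continuity_2d_pt (fun _ v => Rabs v) X Y.
Proof.
  apply (continuity_1d_2d_pt_comp Rabs (fun _ v => v)).
  - apply Rcontinuity_abs.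
  - apply continuity_2d_pt_id2.
Qed.

Lemma locally_2d_fst (P : R -> Prop) X Y :
  locally X P -> locally_2d (fun u _ => P u) X Y.
Proof. intros [d Hd]. exists d. intros u v Hu _. now apply Hd. Qed.

Lemma locally_2d_snd (P : R -> Prop) X Y :
  locally Y P -> locally_2d (fun _ v => P v) X Y.
Proof. intros [d Hd]. exists d. intros u v _ Hv. now apply Hd. Qed.

Lemma arg_cont X Y : X <> 0 \/ Y <> 0 -> continuity_2d_pt arg X Y.
Proof.
  intros H. destruct (Req_dec Y 0) as [HY|HY].
  - destruct H as [HX|HX]; [|contradiction].
    destruct (Rlt_dec X 0) as [Hn|Hp].
    + apply continuity_2d_pt_ext_loc with (fun u v => PI + atan (Rabs v * / u)).
      * apply (locally_2d_impl (fun u _ => u < 0)).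
        -- apply locally_2d_forall. intros u v Hu. unfold arg.
           destruct (Req_EM_T v 0) as [->|Hv].
           ++ destruct (Rlt_dec u 0); [|contradiction].
              rewrite Rabs_R0, Rmult_0_l, atan_0. ring.
           ++ assert (0 < Rabs v) by now apply Rabs_pos_lt.
              replace (u / Rabs v) with (- / (Rabs v * / - u)) by (field; lra).
              assert (0 < Rabs v * / - u) by (apply Rmult_lt_0_compat; auto; apply Rinv_0_lt_compat; lra).
              rewrite atan_opp, atan_inv by assumption.
              replace (Rabs v * / - u) with (- (Rabs v * / u)) by (field; lra).
              rewrite atan_opp. lra.
        -- apply locally_2d_fst. now apply (open_lt 0).
      * apply continuity_2d_pt_plus; [apply continuity_2d_pt_const|].
        apply (continuity_1d_2d_pt_comp atan (fun u v => Rabs v * / u)).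
        -- apply ex_derive_continuity_pt. eexists; apply is_derive_atan.
        -- apply continuity_2d_pt_mult; [apply continuity_2d_abs2|].
           apply continuity_2d_pt_inv; [apply continuity_2d_pt_id1|assumption].
    + apply continuity_2d_pt_ext_loc with (fun u v => atan (Rabs v * / u)).
      * apply (locally_2d_impl (fun u _ => 0 < u)).
        -- apply locally_2d_forall. intros u v Hu. unfold arg.
           destruct (Req_EM_T v 0) as [->|Hv].
           ++ destruct (Rlt_dec u 0); [lra|].
              rewrite Rabs_R0, Rmult_0_l, atan_0. ring.
           ++ assert (0 < Rabs v) by now apply Rabs_pos_lt.
              replace (Rabs v * / u) with (/ (u / Rabs v)) by (field; lra).
              rewrite atan_inv; [reflexivity|].
              now apply Rdiv_lt_0_compat.
        -- apply locally_2d_fst. apply (open_gt 0). lra.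
      * apply (continuity_1d_2d_pt_comp atan (fun u v => Rabs v * / u)).
        -- apply ex_derive_continuity_pt. eexists; apply is_derive_atan.
        -- apply continuity_2d_pt_mult; [apply continuity_2d_abs2|].
           apply continuity_2d_pt_inv; [apply continuity_2d_pt_id1|assumption].
  - apply continuity_2d_pt_ext_loc with (fun u v => PI / 2 - atan (u * / Rabs v)).
    + apply (locally_2d_impl (fun _ v => v <> 0)).
      * apply locally_2d_forall. intros u v Hv. unfold arg.
        destruct (Req_EM_T v 0) as [->|_]; [contradiction|]. reflexivity.
      * apply locally_2d_snd. now apply (open_neq 0).
    + apply continuity_2d_pt_minus; [apply continuity_2d_pt_const|].
      apply (continuity_1d_2d_pt_comp atan (fun u v => u * / Rabs v)).
      * apply ex_derive_continuity_pt. eexists; apply is_derive_atan.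
      * apply continuity_2d_pt_mult; [apply continuity_2d_pt_id1|].
        apply continuity_2d_pt_inv; [apply continuity_2d_abs2|].
        now apply Rabs_no_R0.
Qed.

Lemma continuity_2d_sumsq X Y : continuity_2d_pt (fun u v => u ^ 2 + v ^ 2) X Y.
Proof.
  apply continuity_2d_pt_ext with (fun u v => u * u + v * v); [intros; ring|].
  apply continuity_2d_pt_plus; apply continuity_2d_pt_mult;
    apply continuity_2d_pt_id1 || apply continuity_2d_pt_id2.
Qed.

Lemma modpow_cont x X Y : X <> 0 \/ Y <> 0 -> continuity_2d_pt (modpow x) X Y.
Proof.
  intros H. pose proof (sumsq_pos X Y H) as Hm.
  apply continuity_2d_pt_ext_loc with (fun u v => exp (x / 2 * ln (u ^ 2 + v ^ 2))).
  - apply (locally_2d_impl (fun u v => u ^ 2 + v ^ 2 <> 0)).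
    + apply locally_2d_forall. intros u v Huv. unfold modpow.
      destruct (Req_EM_T (u ^ 2 + v ^ 2) 0); [contradiction|reflexivity].
    + apply (continuity_2d_pt_neq_0 (fun u v => u ^ 2 + v ^ 2)); [|lra].
      apply continuity_2d_sumsq.
  - apply (continuity_1d_2d_pt_comp (fun m => exp (x / 2 * ln m)) (fun u v => u ^ 2 + v ^ 2)).
    + apply ex_derive_continuity_pt. auto_derive. assumption.
    + apply continuity_2d_sumsq.
Qed.

Lemma modpow_pos x X Y : 0 <= modpow x X Y.
Proof.
  unfold modpow. destruct (Req_EM_T _ 0); [lra|]. left; apply exp_pos.
Qed.

Lemma modpow_small x : 0 < x -> forall e, 0 < e ->
  locally_2d (fun X Y => modpow x X Y < e) 0 0.
Proof.
  intros Hx e He.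
  assert (Hd : 0 < exp (ln e / x)) by apply exp_pos.
  exists (mkposreal _ (Rmult_lt_0_compat (/ 2) _ ltac:(lra) Hd)). simpl.
  intros u v Hu Hv. unfold modpow. destruct (Req_EM_T _ 0) as [_|H]; [assumption|].
  assert (H' : 0 < u ^ 2 + v ^ 2) by (pose proof (pow2_ge_0 u); pose proof (pow2_ge_0 v); lra).
  rewrite <- (exp_ln e) at 1 by assumption. apply exp_increasing.
  assert (Hl : ln (u ^ 2 + v ^ 2) < 2 * (ln e / x)).
  { rewrite <- (ln_exp (2 * (ln e / x))). apply ln_increasing; [assumption|].
    replace (2 * (ln e / x)) with (ln e / x + ln e / x) by ring. rewrite exp_plus.
    rewrite Rminus_0_r in Hu, Hv. apply Rabs_lt_between in Hu. apply Rabs_lt_between in Hv.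
    nra. }
  apply Rmult_lt_compat_l with (r := x / 2) in Hl; [|lra].
  replace (x / 2 * (2 * (ln e / x))) with (ln e) in Hl by (field; lra). exact Hl.
Qed.

(** At the origin the argument has no limit, but the modulus tends to 0 when x > 0. *)
Lemma modpow_mult_cont x (f : R -> R) X Y :
  0 < x \/ (X <> 0 \/ Y <> 0) -> continuity f -> (forall t, Rabs (f t) <= 1) ->
  continuity_2d_pt (fun u v => modpow x u v * f (x * arg u v)) X Y.
Proof.
  intros H Hf Hb.
  assert (D : X <> 0 \/ Y <> 0 -> continuity_2d_pt (fun u v => modpow x u v * f (x * arg u v)) X Y).
  { intros H'. apply continuity_2d_pt_mult; [now apply modpow_cont|].
    apply (continuity_1d_2d_pt_comp f (fun u v => x * arg u v)); [apply Hf|].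
    apply continuity_2d_pt_mult; [apply continuity_2d_pt_const|now apply arg_cont]. }
  destruct (Req_dec X 0) as [HX|HX]; [|apply D; tauto].
  destruct (Req_dec Y 0) as [HY|HY]; [|apply D; tauto].
  destruct H as [Hx|H]; [|tauto]. subst. intros e.
  generalize (modpow_small x Hx e (cond_pos e)). apply locally_2d_impl, locally_2d_forall.
  intros u v Hu. replace (modpow x 0 0) with 0.
  - rewrite Rmult_0_l, Rminus_0_r, Rabs_mult. rewrite (Rabs_pos_eq (modpow _ _ _)) by apply modpow_pos.
    pose proof (Hb (x * arg u v)). pose proof (modpow_pos x u v).
    pose proof (Rabs_pos (f (x * arg u v))). nra.
  - unfold modpow. destruct (Req_EM_T (0 ^ 2 + 0 ^ 2) 0); [reflexivity|]. exfalso. apply n. ring.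
Qed.

(** Together with [Zy]: the real and imaginary parts of 1 + c e^(s + i t). *)
Definition Zx (c s t : R) : R := 1 + c * exp s * cos t.
Definition Zy (c s t : R) : R := c * exp s * sin t.

(** The modulus of (1 + q w)^x (1 - p w)^a w^(- nu) at w = e^(s + i t) with 0 <= t <= pi. *)
Definition hmod (p q x a nu s t : R) : R :=
  exp (- nu * s) * modpow x (Zx q s t) (Zy q s t) * modpow a (Zx (- p) s t) (Zy p s t).
(** The argument of the same function.  The point 1 - p w lies in the lower half plane, so its
    argument is minus that of the conjugate point, whence the sign of a. *)
Definition hang (p q x a nu s t : R) : R :=
  x * arg (Zx q s t) (Zy q s t) - a * arg (Zx (- p) s t) (Zy p s t) - nu * t.
Definition hre p q x a nu s t := hmod p q x a nu s t * cos (hang p q x a nu s t).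
Definition him p q x a nu s t := hmod p q x a nu s t * sin (hang p q x a nu s t).

Lemma Zx_cont c s t : continuity_2d_pt (Zx c) s t.
Proof.
  unfold Zx. apply continuity_2d_pt_plus; [apply continuity_2d_pt_const|].
  apply continuity_2d_pt_mult.
  - apply (continuity_1d_2d_pt_comp (fun s => c * exp s) (fun u _ => u)); [|apply continuity_2d_pt_id1].
    apply ex_derive_continuity_pt. now auto_derive.
  - apply (continuity_1d_2d_pt_comp cos (fun _ v => v)); [apply continuity_cos|apply continuity_2d_pt_id2].
Qed.
Lemma Zy_cont c s t : continuity_2d_pt (Zy c) s t.
Proof.
  unfold Zy.
  apply continuity_2d_pt_mult.
  - apply (continuity_1d_2d_pt_comp (fun s => c * exp s) (fun u _ => u)); [|apply continuity_2d_pt_id1].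
    apply ex_derive_continuity_pt. now auto_derive.
  - apply (continuity_1d_2d_pt_comp sin (fun _ v => v)); [apply continuity_sin|apply continuity_2d_pt_id2].
Qed.

Lemma continuity_2d_pt_comp2 (f X Y : R -> R -> R) s t :
  continuity_2d_pt f (X s t) (Y s t) -> continuity_2d_pt X s t -> continuity_2d_pt Y s t ->
  continuity_2d_pt (fun u v => f (X u v) (Y u v)) s t.
Proof.
  intros Hf HX HY e. destruct (Hf e) as [d Hd].
  apply (locally_2d_impl (fun u v => Rabs (X u v - X s t) < d /\ Rabs (Y u v - Y s t) < d)).
  - apply locally_2d_forall. intros u v [H1 H2]. now apply Hd.
  - apply locally_2d_and; [apply HX|apply HY].
Qed.

Lemma pow_comp_cont x (f : R -> R) (X Y : R -> R -> R) s t :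
  0 < x \/ (X s t <> 0 \/ Y s t <> 0) -> continuity f -> (forall t, Rabs (f t) <= 1) ->
  continuity_2d_pt X s t -> continuity_2d_pt Y s t ->
  continuity_2d_pt (fun u v => modpow x (X u v) (Y u v) * f (x * arg (X u v) (Y u v))) s t.
Proof.
  intros H Hf Hb HX HY.
  now apply (continuity_2d_pt_comp2 (fun u v => modpow x u v * f (x * arg u v)) X Y);
    [apply modpow_mult_cont|..].
Qed.

(** Either the exponent is positive or the base 1 + c e^(s + i t) is not zero; this is what
    continuity of the power requires. *)
Definition regular (c d x s t : R) : Prop := 0 < x \/ (Zx c s t <> 0 \/ Zy d s t <> 0).

Lemma h_cont p q x a nu s t :
  regular q q x s t -> regular (- p) p a s t ->
  continuity_2d_pt (hre p q x a nu) s t /\ continuity_2d_pt (him p q x a nu) s t.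
Proof.
  intros H1 H2.
  assert (C1 := pow_comp_cont x cos (Zx q) (Zy q) s t H1 continuity_cos Rabs_cos_le
                  (Zx_cont q s t) (Zy_cont q s t)).
  assert (S1 := pow_comp_cont x sin (Zx q) (Zy q) s t H1 continuity_sin Rabs_sin_le
                  (Zx_cont q s t) (Zy_cont q s t)).
  assert (C2 := pow_comp_cont a cos (Zx (- p)) (Zy p) s t H2 continuity_cos Rabs_cos_le
                  (Zx_cont (- p) s t) (Zy_cont p s t)).
  assert (S2 := pow_comp_cont a sin (Zx (- p)) (Zy p) s t H2 continuity_sin Rabs_sin_le
                  (Zx_cont (- p) s t) (Zy_cont p s t)).
  assert (E : continuity_2d_pt (fun u _ => exp (- nu * u)) s t).
  { apply (continuity_1d_2d_pt_comp (fun u => exp (- nu * u)) (fun u _ => u));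
      [|apply continuity_2d_pt_id1]. apply ex_derive_continuity_pt. now auto_derive. }
  assert (C : continuity_2d_pt (fun _ v => cos (nu * v)) s t).
  { apply (continuity_1d_2d_pt_comp (fun v => cos (nu * v)) (fun _ v => v));
      [|apply continuity_2d_pt_id2]. apply ex_derive_continuity_pt. now auto_derive. }
  assert (S : continuity_2d_pt (fun _ v => sin (nu * v)) s t).
  { apply (continuity_1d_2d_pt_comp (fun v => sin (nu * v)) (fun _ v => v));
      [|apply continuity_2d_pt_id2]. apply ex_derive_continuity_pt. now auto_derive. }
  assert (Re := continuity_2d_pt_plus _ _ _ _ (continuity_2d_pt_mult _ _ _ _ C1 C2)
                  (continuity_2d_pt_mult _ _ _ _ S1 S2)).
  assert (Im := continuity_2d_pt_minus _ _ _ _ (continuity_2d_pt_mult _ _ _ _ S1 C2)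
                  (continuity_2d_pt_mult _ _ _ _ C1 S2)).
  split.
  - assert (F := continuity_2d_pt_mult _ _ _ _ E
      (continuity_2d_pt_plus _ _ _ _ (continuity_2d_pt_mult _ _ _ _ Re C)
         (continuity_2d_pt_mult _ _ _ _ Im S))).
    revert F. apply continuity_2d_pt_ext. intros u v. unfold hre, hmod, hang.
    rewrite !cos_minus, !sin_minus. ring.
  - assert (F := continuity_2d_pt_mult _ _ _ _ E
      (continuity_2d_pt_minus _ _ _ _ (continuity_2d_pt_mult _ _ _ _ Im C)
         (continuity_2d_pt_mult _ _ _ _ Re S))).
    revert F. apply continuity_2d_pt_ext. intros u v. unfold him, hmod, hang.
    rewrite !sin_minus, !cos_minus. ring.
Qed.

Lemma cos_arg X Y : 0 < Y -> cos (arg X Y) = X / sqrt (X ^ 2 + Y ^ 2).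
Proof.
  intros H. unfold arg. destruct (Req_EM_T Y 0); [lra|].
  rewrite cos_shift, sin_atan, Rabs_pos_eq by lra.
  assert (E : X ^ 2 + Y ^ 2 = (1 + (X / Y)²) * (Y * Y)) by (unfold Rsqr; field; lra).
  assert (0 <= (X / Y)²) by apply Rle_0_sqr.
  rewrite E, sqrt_mult, sqrt_square by nra.
  assert (0 < sqrt (1 + (X / Y)²)) by (apply sqrt_lt_R0; lra). field. split; lra.
Qed.

Lemma sin_arg X Y : 0 < Y -> sin (arg X Y) = Y / sqrt (X ^ 2 + Y ^ 2).
Proof.
  intros H. unfold arg. destruct (Req_EM_T Y 0); [lra|].
  rewrite sin_shift, cos_atan, Rabs_pos_eq by lra.
  assert (E : X ^ 2 + Y ^ 2 = (1 + (X / Y)²) * (Y * Y)) by (unfold Rsqr; field; lra).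
  assert (0 <= (X / Y)²) by apply Rle_0_sqr.
  rewrite E, sqrt_mult, sqrt_square by nra.
  assert (0 < sqrt (1 + (X / Y)²)) by (apply sqrt_lt_R0; lra). field. split; lra.
Qed.

Lemma modpow_eq x X Y : 0 < Y -> modpow x X Y = exp (x / 2 * ln (X ^ 2 + Y ^ 2)).
Proof.
  intros H. unfold modpow. destruct (Req_EM_T _ 0) as [E|]; [|reflexivity].
  pose proof (pow2_ge_0 X). nra.
Qed.

(** With [cos_arg] and [sin_arg] this is division of (X + i Y)^x by X + i Y. *)
Lemma modpow_pred x X Y :
  0 < Y -> modpow (x - 1) X Y = modpow x X Y / sqrt (X ^ 2 + Y ^ 2).
Proof.
  intros H. rewrite !modpow_eq by assumption.
  assert (Hm : 0 < X ^ 2 + Y ^ 2) by (pose proof (pow2_ge_0 X); nra).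
  rewrite <- (Rpower_sqrt _ Hm). unfold Rpower, Rdiv at 2. rewrite <- exp_Ropp, <- exp_plus.
  f_equal. field.
Qed.

Lemma is_derive_modpow x (X Y : R -> R) X' Y' u :
  is_derive X u X' -> is_derive Y u Y' -> 0 < Y u ->
  is_derive (fun u => modpow x (X u) (Y u)) u
    (x * ((X u * X' + Y u * Y') / (X u ^ 2 + Y u ^ 2)) * modpow x (X u) (Y u)).
Proof.
  intros HX HY Hp.
  assert (Hl : locally u (fun v => 0 < Y v)).
  { assert (C : continuous Y u) by (apply (ex_derive_continuous Y); now exists Y').
    apply (C (fun y => 0 < y)). now apply (open_gt 0). }
  assert (Hm : 0 < X u ^ 2 + Y u ^ 2) by (pose proof (pow2_ge_0 (X u)); nra).
  apply is_derive_ext_loc with (fun u => exp (x / 2 * ln (X u ^ 2 + Y u ^ 2))).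
  { revert Hl. apply filter_imp. intros v Hv. now rewrite modpow_eq. }
  rewrite modpow_eq by assumption.
  auto_derive.
  - repeat split; [now exists X'|now exists Y'|simpl in Hm; lra].
  - replace (Derive (fun x0 => X x0) u) with X'
      by (symmetry; exact (is_derive_unique X u X' HX)).
    replace (Derive (fun x0 => Y x0) u) with Y'
      by (symmetry; exact (is_derive_unique Y u Y' HY)).
    replace (X u * (X u * 1) + Y u * (Y u * 1)) with (X u ^ 2 + Y u ^ 2) by ring.
    field. lra.
Qed.

Lemma is_derive_arg (X Y : R -> R) X' Y' u :
  is_derive X u X' -> is_derive Y u Y' -> 0 < Y u ->
  is_derive (fun u => arg (X u) (Y u)) u
    ((X u * Y' - Y u * X') / (X u ^ 2 + Y u ^ 2)).
Proof.
  intros HX HY Hp.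
  assert (Hl : locally u (fun v => 0 < Y v)).
  { assert (C : continuous Y u) by (apply (ex_derive_continuous Y); now exists Y').
    apply (C (fun y => 0 < y)). now apply (open_gt 0). }
  assert (Hm : 0 < X u ^ 2 + Y u ^ 2) by (pose proof (pow2_ge_0 (X u)); nra).
  apply is_derive_ext_loc with (fun u => PI / 2 - atan (X u / Y u)).
  { revert Hl. apply filter_imp. intros v Hv. unfold arg.
    destruct (Req_EM_T (Y v) 0); [lra|]. now rewrite Rabs_pos_eq by lra. }
  auto_derive.
  - repeat split; [now exists X'|now exists Y'|lra].
  - replace (Derive (fun x0 => X x0) u) with X'
      by (symmetry; exact (is_derive_unique X u X' HX)).
    replace (Derive (fun x0 => Y x0) u) with Y'
      by (symmetry; exact (is_derive_unique Y u Y' HY)).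
    field. repeat split; try lra.
Qed.

(** The derivative of a complex function given by its modulus and its argument. *)
Lemma is_derive_polar (e m1 m2 g1 g2 n : R -> R) (x a e' l1 l2 g1' g2' n' u : R) :
  is_derive e u (e' * e u) ->
  is_derive m1 u (l1 * m1 u) -> is_derive m2 u (l2 * m2 u) ->
  is_derive g1 u g1' -> is_derive g2 u g2' -> is_derive n u n' ->
  is_derive (fun u => e u * m1 u * m2 u * cos (x * g1 u - a * g2 u - n u)) u
    (e u * m1 u * m2 u *
       ((e' + l1 + l2) * cos (x * g1 u - a * g2 u - n u)
        - (x * g1' - a * g2' - n') * sin (x * g1 u - a * g2 u - n u))) /\
  is_derive (fun u => e u * m1 u * m2 u * sin (x * g1 u - a * g2 u - n u)) u
    (e u * m1 u * m2 u *
       ((e' + l1 + l2) * sin (x * g1 u - a * g2 u - n u)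
        + (x * g1' - a * g2' - n') * cos (x * g1 u - a * g2 u - n u))).
Proof.
  intros He H1 H2 G1 G2 Hn. split; auto_derive.
  1, 3: repeat split; eexists; eassumption.
  1, 2: replace (Derive (fun x0 => e x0) u) with (e' * e u)
      by (symmetry; exact (is_derive_unique e u _ He));
    replace (Derive (fun x0 => m1 x0) u) with (l1 * m1 u)
      by (symmetry; exact (is_derive_unique m1 u _ H1));
    replace (Derive (fun x0 => m2 x0) u) with (l2 * m2 u)
      by (symmetry; exact (is_derive_unique m2 u _ H2));
    replace (Derive (fun x0 => g1 x0) u) with g1'
      by (symmetry; exact (is_derive_unique g1 u _ G1));
    replace (Derive (fun x0 => g2 x0) u) with g2'
      by (symmetry; exact (is_derive_unique g2 u _ G2));
    replace (Derive (fun x0 => n x0) u) with n'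
      by (symmetry; exact (is_derive_unique n u _ Hn)); unfold Rminus; ring.
Qed.

(** The real part of w h'(w).  The product rule writes it with functions of the same family,
    with exponents lowered by one; this is also the recursion for the coefficients. *)
Definition hder p q x a nu s t : R :=
  q * x * hre p q (x - 1) a (nu - 1) s t
  - p * a * hre p q x (a - 1) (nu - 1) s t
  - nu * hre p q x a nu s t.

(** Both derivatives equal Re(w h'(w)), because w d/dw is d/ds and also -i d/dt. *)
Lemma h_cauchy_riemann p q x a nu s t :
  0 < p -> 0 < q -> 0 < t < PI ->
  is_derive (fun u => hre p q x a nu u t) s (hder p q x a nu s t) /\
  is_derive (fun v => him p q x a nu s v) t (hder p q x a nu s t).
Proof.
  intros Hp Hq Ht.
  assert (Hs : 0 < sin t) by (apply sin_gt_0; lra).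
  assert (HY : forall c, 0 < c -> 0 < Zy c s t).
  { intros c Hc. unfold Zy. pose proof (exp_pos s).
    apply Rmult_lt_0_compat; [apply Rmult_lt_0_compat|]; assumption. }
  pose proof (HY q Hq) as Hq'. pose proof (HY p Hp) as Hp'.
  assert (Xs : forall c, is_derive (fun u => Zx c u t) s (c * exp s * cos t))
    by (intros c; unfold Zx; auto_derive; [trivial|ring]).
  assert (Ys : forall c, is_derive (fun u => Zy c u t) s (c * exp s * sin t))
    by (intros c; unfold Zy; auto_derive; [trivial|ring]).
  assert (Xt : forall c, is_derive (fun v => Zx c s v) t (- (c * exp s * sin t)))
    by (intros c; unfold Zx; auto_derive; [trivial|ring]).
  assert (Yt : forall c, is_derive (fun v => Zy c s v) t (c * exp s * cos t))
    by (intros c; unfold Zy; auto_derive; [trivial|ring]).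
  assert (m1 : 0 < Zx q s t ^ 2 + Zy q s t ^ 2) by (apply sumsq_pos; lra).
  assert (m2 : 0 < Zx (- p) s t ^ 2 + Zy p s t ^ 2) by (apply sumsq_pos; lra).
  set (N1 := Zx q s t ^ 2 + Zy q s t ^ 2) in *.
  set (N2 := Zx (- p) s t ^ 2 + Zy p s t ^ 2) in *.
  set (E := exp s). set (B := hang p q x a nu s t). set (M := hmod p q x a nu s t).
  set (as_ := x * ((Zx q s t * (q * E * cos t) + Zy q s t * (q * E * sin t)) / N1)
              + a * ((Zx (- p) s t * (- p * E * cos t) + Zy p s t * (p * E * sin t)) / N2) - nu).
  set (bs := x * ((Zx q s t * (q * E * sin t) - Zy q s t * (q * E * cos t)) / N1)
             - a * ((Zx (- p) s t * (p * E * sin t) - Zy p s t * (- p * E * cos t)) / N2)).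
  assert (D : hder p q x a nu s t = M * (as_ * cos B - bs * sin B)).
  { assert (Q1 : 0 < sqrt N1) by now apply sqrt_lt_R0.
    assert (Q2 : 0 < sqrt N2) by now apply sqrt_lt_R0.
    assert (R1 : sqrt N1 * sqrt N1 = N1) by (apply sqrt_sqrt; lra).
    assert (R2 : sqrt N2 * sqrt N2 = N2) by (apply sqrt_sqrt; lra).
    unfold hder, hre. fold M B.
    replace (hmod p q (x - 1) a (nu - 1) s t) with (M * E / sqrt N1).
    2:{ unfold M, hmod. rewrite modpow_pred by assumption. fold N1.
        replace (- (nu - 1) * s) with (- nu * s + s) by ring. rewrite exp_plus. fold E.
        field. lra. }
    replace (hmod p q x (a - 1) (nu - 1) s t) with (M * E / sqrt N2).
    2:{ unfold M, hmod. rewrite modpow_pred by assumption. fold N2.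
        replace (- (nu - 1) * s) with (- nu * s + s) by ring. rewrite exp_plus. fold E.
        field. lra. }
    replace (hang p q (x - 1) a (nu - 1) s t) with ((B + t) - arg (Zx q s t) (Zy q s t))
      by (unfold B, hang; ring).
    replace (hang p q x (a - 1) (nu - 1) s t) with ((B + t) + arg (Zx (- p) s t) (Zy p s t))
      by (unfold B, hang; ring).
    rewrite cos_minus, (cos_plus (B + t) (arg _ _)), !cos_arg, !sin_arg by assumption.
    fold N1 N2. rewrite cos_plus, sin_plus. unfold as_, bs.
    remember (sqrt N1) as r1. remember (sqrt N2) as r2.
    rewrite <- R1, <- R2. field. split; lra. }
  rewrite D.
  split.
  - assert (d1 := is_derive_modpow x _ _ _ _ _ (Xs q) (Ys q) Hq').
    assert (d2 := is_derive_modpow a _ _ _ _ _ (Xs (- p)) (Ys p) Hp').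
    assert (g1 := is_derive_arg _ _ _ _ _ (Xs q) (Ys q) Hq').
    assert (g2 := is_derive_arg _ _ _ _ _ (Xs (- p)) (Ys p) Hp').
    assert (e1 : is_derive (fun u => exp (- nu * u)) s (- nu * exp (- nu * s)))
      by (auto_derive; [trivial|ring]).
    assert (n1 : is_derive (fun _ : R => nu * t) s 0) by (auto_derive; [trivial|ring]).
    assert (G := proj1 (is_derive_polar _ _ _ _ _ _ x a _ _ _ _ _ _ _ e1 d1 d2 g1 g2 n1)).
    cbv beta in G. fold N1 N2 E in G. unfold hre, hmod, hang.
    replace (M * (as_ * cos B - bs * sin B)) with
      (M * ((- nu + x * ((Zx q s t * (q * E * cos t) + Zy q s t * (q * E * sin t)) / N1)
       + a * ((Zx (- p) s t * (- p * E * cos t) + Zy p s t * (p * E * sin t)) / N2)) * cos B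
       - (x * ((Zx q s t * (q * E * sin t) - Zy q s t * (q * E * cos t)) / N1)
          - a * ((Zx (- p) s t * (p * E * sin t) - Zy p s t * (- p * E * cos t)) / N2) - 0) * sin B))
      by (unfold as_, bs; ring).
    exact G.
  - assert (d1 := is_derive_modpow x _ _ _ _ _ (Xt q) (Yt q) Hq').
    assert (d2 := is_derive_modpow a _ _ _ _ _ (Xt (- p)) (Yt p) Hp').
    assert (g1 := is_derive_arg _ _ _ _ _ (Xt q) (Yt q) Hq').
    assert (g2 := is_derive_arg _ _ _ _ _ (Xt (- p)) (Yt p) Hp').
    assert (e1 : is_derive (fun _ : R => exp (- nu * s)) t (0 * exp (- nu * s)))
      by (auto_derive; [trivial|ring]).
    assert (n1 : is_derive (fun v : R => nu * v) t nu) by (auto_derive; [trivial|ring]).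
    assert (G := proj2 (is_derive_polar _ _ _ _ _ _ x a _ _ _ _ _ _ _ e1 d1 d2 g1 g2 n1)).
    cbv beta in G. fold N1 N2 E in G. unfold him, hmod, hang.
    replace (M * (as_ * cos B - bs * sin B)) with
      (M * ((0 + x * ((Zx q s t * - (q * E * sin t) + Zy q s t * (q * E * cos t)) / N1)
       + a * ((Zx (- p) s t * - (- p * E * sin t) + Zy p s t * (p * E * cos t)) / N2)) * sin B
       + (x * ((Zx q s t * (q * E * cos t) - Zy q s t * - (q * E * sin t)) / N1)
          - a * ((Zx (- p) s t * (p * E * cos t) - Zy p s t * - (- p * E * sin t)) / N2) - nu) * cos B)).
    + exact G.
    + unfold as_, bs. field. lra.
Qed.

(** * Krawtchouk coefficients as integrals over a half circle *)

(** The coefficient of w^n in (1 + q w)^x (1 - p w)^a; for a = N - x it is K_n(x). *)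
Definition coef (p q x a : R) (n : nat) : R :=
  sum_f_R0 (fun k => binom x k * binom a (n - k) * q ^ k * (- p) ^ (n - k)) n.

Lemma falling_S x k : falling x (S k) = x * falling (x - 1) k.
Proof.
  induction k as [|k IH]; [simpl; ring|].
  change (falling x (S (S k))) with (falling x (S k) * (x - INR (S k))).
  change (falling (x - 1) (S k)) with (falling (x - 1) k * (x - 1 - INR k)).
  rewrite IH, S_INR. ring.
Qed.

Lemma binom_S x k : INR (S k) * binom x (S k) = x * binom (x - 1) k.
Proof.
  unfold binom. rewrite falling_S, fact_simpl, mult_INR.
  pose proof (INR_fact_neq_0 k). pose proof (not_0_INR (S k) ltac:(lia)). field. auto.
Qed.

(** Comparison of coefficients in w G'(w), that is n = k + (n - k) applied to each term. *)
Lemma coef_rec p q x a m :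
  INR (S m) * coef p q x a (S m)
  = q * x * coef p q (x - 1) a m - p * a * coef p q x (a - 1) m.
Proof.
  unfold coef. set (T := fun k => binom x k * binom a (S m - k) * q ^ k * (- p) ^ (S m - k)).
  assert (E : INR (S m) * sum_f_R0 T (S m)
     = sum_f_R0 (fun k => INR k * T k) (S m) + sum_f_R0 (fun k => INR (S m - k) * T k) (S m)).
  { rewrite <- plus_sum, scal_sum. apply sum_eq. intros i Hi.
    rewrite minus_INR by lia. ring. }
  rewrite E, (decomp_sum (fun k => INR k * T k)) by lia. rewrite (tech5 _ m).
  rewrite Nat.sub_diag. change (INR 0) with 0. rewrite !Rmult_0_l, Rplus_0_l, Rplus_0_r.
  change (pred (S m)) with m. unfold Rminus at 1. f_equal.
  - rewrite scal_sum. apply sum_eq. intros i Hi. unfold T.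
    replace (S m - S i)%nat with (m - i)%nat by lia.
    replace (INR (S i) * (binom x (S i) * binom a (m - i) * q ^ S i * (- p) ^ (m - i)))
      with (INR (S i) * binom x (S i) * (binom a (m - i) * q ^ S i * (- p) ^ (m - i))) by ring.
    rewrite binom_S. simpl (q ^ S i). ring.
  - replace (- (p * a * sum_f_R0 (fun k => binom x k * binom (a - 1) (m - k) * q ^ k * (- p) ^ (m - k)) m))
      with ((- p * a) * sum_f_R0 (fun k => binom x k * binom (a - 1) (m - k) * q ^ k * (- p) ^ (m - k)) m) by ring.
    rewrite scal_sum. apply sum_eq. intros i Hi. unfold T.
    replace (S m - i)%nat with (S (m - i)) by lia.
    replace (INR (S (m - i)) * (binom x i * binom a (S (m - i)) * q ^ i * (- p) ^ S (m - i)))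
      with (INR (S (m - i)) * binom a (S (m - i)) * (binom x i * q ^ i * (- p) ^ S (m - i))) by ring.
    rewrite binom_S. simpl ((- p) ^ S (m - i)). ring.
Qed.

Lemma arg_pos X : 0 <= X -> arg X 0 = 0.
Proof.
  intros H. unfold arg. destruct (Req_EM_T 0 0); [|lra]. destruct (Rlt_dec X 0); lra.
Qed.
Lemma arg_neg X : X < 0 -> arg X 0 = PI.
Proof.
  intros H. unfold arg. destruct (Req_EM_T 0 0); [|lra]. destruct (Rlt_dec X 0); lra.
Qed.

Lemma Zx_0 c s : Zx c s 0 = 1 + c * exp s.
Proof. unfold Zx. rewrite cos_0. ring. Qed.
Lemma Zy_0 c s : Zy c s 0 = 0.
Proof. unfold Zy. rewrite sin_0. ring. Qed.
Lemma Zx_PI c s : Zx c s PI = 1 - c * exp s.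
Proof. unfold Zx. rewrite cos_PI. ring. Qed.
Lemma Zy_PI c s : Zy c s PI = 0.
Proof. unfold Zy. rewrite sin_PI. ring. Qed.

Lemma Zx_pos c s t : Rabs c * exp s < 1 -> 0 < Zx c s t.
Proof.
  intros H. unfold Zx. assert (Rabs (c * exp s * cos t) <= Rabs c * exp s).
  { rewrite !Rabs_mult, (Rabs_pos_eq (exp s)) by (left; apply exp_pos).
    pose proof (Rabs_cos_le t). pose proof (Rabs_pos c). pose proof (exp_pos s).
    pose proof (Rmult_le_pos _ _ H1 (Rlt_le _ _ H2)). nra. }
  apply Rabs_le_between in H0. lra.
Qed.

(** Before the branch points -1/q and 1/p the function h is real on the real axis. *)
Lemma him_real_axis p q x a n s :
  0 < p -> 0 < q -> p * exp s <= 1 -> q * exp s <= 1 ->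
  him p q x a (INR n) s PI = 0 /\ him p q x a (INR n) s 0 = 0.
Proof.
  intros Hp Hq Hps Hqs. pose proof (exp_pos s) as He.
  assert (0 < p * exp s) by now apply Rmult_lt_0_compat.
  assert (0 < q * exp s) by now apply Rmult_lt_0_compat.
  unfold him, hang. rewrite !Zx_0, !Zy_0, !Zx_PI, !Zy_PI, !arg_pos by lra.
  split.
  - replace (x * 0 - a * 0 - INR n * PI) with (- (INR n * PI)) by ring.
    rewrite sin_neg, sin_INR_PI. ring.
  - replace (x * 0 - a * 0 - INR n * 0) with 0 by ring. rewrite sin_0. ring.
Qed.

Lemma h_cont_small p q x a nu s t :
  0 < p < 1 -> 0 < q < 1 -> s < Rmin (- ln p) (- ln q) ->
  continuity_2d_pt (hre p q x a nu) s t /\ continuity_2d_pt (him p q x a nu) s t.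
Proof.
  intros Hp Hq Hs.
  pose proof (Rmin_l (- ln p) (- ln q)). pose proof (Rmin_r (- ln p) (- ln q)).
  apply h_cont; right; left; apply Rgt_not_eq, Zx_pos.
  - rewrite Rabs_pos_eq by lra. apply mul_exp_lt_1; lra.
  - rewrite Rabs_Ropp, Rabs_pos_eq by lra. apply mul_exp_lt_1; lra.
Qed.

Lemma h_cont_interior p q x a nu s t :
  0 < p -> 0 < q -> 0 < t < PI ->
  continuity_2d_pt (hre p q x a nu) s t /\ continuity_2d_pt (him p q x a nu) s t.
Proof.
  intros Hp Hq Ht. assert (Hs : 0 < sin t) by (apply sin_gt_0; lra).
  pose proof (exp_pos s).
  apply h_cont; right; right; apply Rgt_not_eq; unfold Zy; repeat apply Rmult_lt_0_compat; lra.
Qed.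

Lemma hder_cont p q x a nu s t :
  (forall x a nu, continuity_2d_pt (hre p q x a nu) s t) ->
  continuity_2d_pt (hder p q x a nu) s t.
Proof.
  intros H. unfold hder.
  repeat first [apply H | apply continuity_2d_pt_const
    | apply continuity_2d_pt_minus | apply continuity_2d_pt_mult].
Qed.

Lemma green_h p q x a n sg s0 s1 :
  0 < p -> 0 < q -> s0 <= s1 < sg ->
  (forall s t, s < sg -> 0 <= t <= PI ->
     continuity_2d_pt (hre p q x a (INR n)) s t /\ continuity_2d_pt (him p q x a (INR n)) s t) ->
  RInt (hre p q x a (INR n) s1) 0 PI - RInt (hre p q x a (INR n) s0) 0 PI
  = RInt (fun s => him p q x a (INR n) s PI - him p q x a (INR n) s 0) s0 s1.
Proof.
  intros Hp Hq Hs C. pose proof PI_RGT_0.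
  apply green_strip with (D := hder p q x a (INR n)) (sg := sg); try assumption.
  - intros; now apply C.
  - intros; now apply C.
  - intros; now apply h_cauchy_riemann.
  - intros; now apply h_cauchy_riemann.
  - intros. apply hder_cont. intros. now apply h_cont_interior.
Qed.

(** For n = 0 the integral does not depend on the radius, and the integrand tends to 1 as
    the radius tends to 0. *)
Lemma coef_integral_0 p q x a :
  0 < p < 1 -> 0 < q < 1 -> RInt (hre p q x a 0 0) 0 PI = PI.
Proof.
  intros Hp Hq. pose proof PI_RGT_0 as HPI.
  pose proof (ln_neg p Hp). pose proof (ln_neg q Hq).
  set (sg := Rmin (- ln p) (- ln q)).
  assert (Hsg : 0 < sg) by (apply Rmin_glb_lt; lra).
  assert (Hst : forall s, s <= 0 -> RInt (hre p q x a 0 s) 0 PI = RInt (hre p q x a 0 0) 0 PI).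
  { intros s Hs. symmetry. apply Rminus_diag_uniq.
    assert (Gr := green_h p q x a 0 sg s 0). change (INR 0) with 0 in Gr. rewrite Gr; try lra.
    - rewrite (RInt_ext_R _ (fun _ => 0)); [|lra|].
      + rewrite RInt_const. apply Rmult_0_r.
      + intros u Hu.
        assert (exp u <= 1) by (rewrite <- exp_0; apply exp_mono; lra).
        pose proof (exp_pos u).
        destruct (him_real_axis p q x a 0 u) as [R1 R2]; try lra; try nra.
        change (INR 0) with 0 in R1, R2. lra.
    - intros u t Hu Ht. apply h_cont_small; assumption. }
  apply Rminus_diag_uniq, eq_0_of_Rabs_le_all. intros e He.
  (* the integrand in the coordinate r = e^s, which extends continuously to r = 0 *)
  set (G := fun r t => modpow x (1 + q * r * cos t) (q * r * sin t)
       * modpow a (1 + - p * r * cos t) (p * r * sin t)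
       * cos (x * arg (1 + q * r * cos t) (q * r * sin t) -
              a * arg (1 + - p * r * cos t) (p * r * sin t))).
  assert (CX : forall c t, continuity_2d_pt (fun r t => 1 + c * r * cos t) 0 t).
  { intros c t. apply continuity_2d_pt_plus; [apply continuity_2d_pt_const|].
    apply continuity_2d_pt_mult.
    - apply continuity_2d_pt_mult; [apply continuity_2d_pt_const|apply continuity_2d_pt_id1].
    - apply (continuity_1d_2d_pt_comp cos (fun _ v => v)); [apply continuity_cos|apply continuity_2d_pt_id2]. }
  assert (CY : forall c t, continuity_2d_pt (fun r t => c * r * sin t) 0 t).
  { intros c t. apply continuity_2d_pt_mult.
    - apply continuity_2d_pt_mult; [apply continuity_2d_pt_const|apply continuity_2d_pt_id1].
    - apply (continuity_1d_2d_pt_comp sin (fun _ v => v)); [apply continuity_sin|apply continuity_2d_pt_id2]. }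
  assert (CG : forall t, continuity_2d_pt G 0 t).
  { intros t.
    assert (N : forall c, 1 + c * 0 * cos t <> 0).
    { intros c. rewrite Rmult_0_r, Rmult_0_l. lra. }
    assert (C1 := pow_comp_cont x cos (fun r t => 1 + q * r * cos t) (fun r t => q * r * sin t) 0 t
      (or_intror (or_introl (N q))) continuity_cos Rabs_cos_le (CX q t) (CY q t)).
    assert (S1 := pow_comp_cont x sin (fun r t => 1 + q * r * cos t) (fun r t => q * r * sin t) 0 t
      (or_intror (or_introl (N q))) continuity_sin Rabs_sin_le (CX q t) (CY q t)).
    assert (C2 := pow_comp_cont a cos (fun r t => 1 + - p * r * cos t) (fun r t => p * r * sin t) 0 t
      (or_intror (or_introl (N (- p)))) continuity_cos Rabs_cos_le (CX (- p) t) (CY p t)).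
    assert (S2 := pow_comp_cont a sin (fun r t => 1 + - p * r * cos t) (fun r t => p * r * sin t) 0 t
      (or_intror (or_introl (N (- p)))) continuity_sin Rabs_sin_le (CX (- p) t) (CY p t)).
    assert (F := continuity_2d_pt_plus _ _ _ _ (continuity_2d_pt_mult _ _ _ _ C1 C2)
                  (continuity_2d_pt_mult _ _ _ _ S1 S2)).
    revert F. apply continuity_2d_pt_ext. intros u v. unfold G. rewrite cos_minus. ring. }
  assert (G0 : forall t, G 0 t = 1).
  { intros t. unfold G. rewrite !Rmult_0_r, !Rmult_0_l, Rplus_0_r, !arg_pos by lra.
    rewrite !Rmult_0_r, Rminus_0_r, cos_0. unfold modpow.
    destruct (Req_EM_T _ 0); [lra|]. replace (1 ^ 2 + 0 ^ 2) with 1 by ring.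
    rewrite ln_1, !Rmult_0_r, exp_0. ring. }
  destruct (uniform_continuity_2d_1d' G 0 PI 0) with (eps := mkposreal (e / PI) (Rdiv_lt_0_compat _ _ He HPI))
    as [d Hd]; [intros; apply CG|]. simpl in Hd. pose proof (cond_pos d) as Hdp.
  set (s := Rmin 0 (ln d)).
  assert (Hs0 : s <= 0) by apply Rmin_l.
  assert (Hsd : exp s <= d).
  { rewrite <- (exp_ln d) at 1 by assumption. apply exp_mono, Rmin_r. }
  rewrite <- (Hst s Hs0).
  replace PI with (RInt (fun _ => 1) 0 PI) at 2
    by (rewrite RInt_const; unfold scal; simpl; unfold mult; simpl; ring).
  replace e with ((PI - 0) * (e / PI)) by (field; lra).
  apply RInt_abs_diff; [lra| | |].
  - apply ex_RInt_cont; [lra|]. intros t Ht. apply continuous_2d_snd.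
    apply h_cont_small; try assumption. fold sg. lra.
  - apply ex_RInt_const.
  - intros t Ht. rewrite <- (G0 t).
    replace (hre p q x a 0 s t) with (G (exp s) t).
    + left. apply Hd; try lra.
      * pose proof (exp_pos s). lra.
      * rewrite Rminus_diag, Rabs_R0. lra.
    + unfold hre, hmod, hang, G, Zx, Zy.
      rewrite Ropp_0, !Rmult_0_l, Rminus_0_r, exp_0, Rmult_1_l. reflexivity.
Qed.

(** Integrating dQ/dt over the half circle gives 0, since Im h vanishes at both ends.
    By the formula for [hder] this is the recursion [coef_rec], so induction on n applies, for
    all real exponents at once. *)
Lemma coef_integral p q x a n :
  0 < p < 1 -> 0 < q < 1 ->
  RInt (hre p q x a (INR n) 0) 0 PI = PI * coef p q x a n.
Proof.
  intros Hp Hq. pose proof PI_RGT_0 as HPI. revert x a.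
  pose proof (ln_neg p Hp). pose proof (ln_neg q Hq).
  assert (Hsg : 0 < Rmin (- ln p) (- ln q)) by (apply Rmin_glb_lt; lra).
  induction n as [|m IH]; intros x a.
  - simpl INR. rewrite coef_integral_0 by assumption. unfold coef, binom. simpl. field.
  - assert (E : RInt (hder p q x a (INR (S m)) 0) 0 PI = 0).
    { rewrite (RInt_derive_open (him p q x a (INR (S m)) 0)); [|lra|..].
      - destruct (him_real_axis p q x a (S m) 0) as [-> ->]; rewrite ?exp_0; lra.
      - intros t Ht. now apply h_cauchy_riemann.
      - intros t Ht. now apply continuous_2d_snd, h_cont_small.
      - intros t Ht. apply continuous_2d_snd, hder_cont. intros. now apply h_cont_small. }
    assert (EX : forall x a nu, ex_RInt (hre p q x a nu 0) 0 PI).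
    { intros. apply ex_RInt_cont; [lra|]. intros t Ht. now apply continuous_2d_snd, h_cont_small. }
    assert (EM : forall c x a nu, ex_RInt (fun t => c * hre p q x a nu 0 t) 0 PI).
    { intros. now apply (ex_RInt_scal (V := R_NormedModule)). }
    unfold hder in E. rewrite RInt_sub in E; [|apply (ex_RInt_minus (V := R_NormedModule)); apply EM|apply EM].
    rewrite RInt_sub in E by apply EM. rewrite !RInt_mulc in E by apply EX.
    replace (INR (S m) - 1) with (INR m) in E by (rewrite S_INR; ring).
    rewrite !IH in E. pose proof (coef_rec p q x a m).
    pose proof (not_0_INR (S m) ltac:(lia)).
    apply Rmult_eq_reg_l with (INR (S m)); [|assumption]. nra.
Qed.

(** * Laplace's method with an explicit error *)

Definition gauss (X : R) : R := RInt (fun t => exp (- t ^ 2)) 0 X.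

Lemma gauss_derive X : is_derive gauss X (exp (- X ^ 2)).
Proof.
  apply (is_derive_RInt (V := R_NormedModule) (fun t => exp (- t ^ 2)) gauss 0 X).
  - apply filter_forall. intros b. apply (RInt_correct (V := R_CompleteNormedModule)).
    apply (ex_RInt_continuous (V := R_CompleteNormedModule)). intros z _.
    apply cont_of_ex_derive. now auto_derive.
  - apply cont_of_ex_derive. now auto_derive.
Qed.

Lemma gauss_scaled c X : RInt (fun t => c * exp (- (c * t) ^ 2)) 0 X = gauss (c * X).
Proof.
  unfold gauss. replace 0 with (c * 0) at 2 by ring.
  apply (RInt_comp (V := R_CompleteNormedModule) (fun t => exp (- t ^ 2)) (fun t => c * t) (fun _ => c)).
  - intros x _. apply cont_of_ex_derive. now auto_derive.
  - intros x _. split; [auto_derive; [trivial|ring]|apply continuous_const].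
Qed.

(** The auxiliary integrand of the classical evaluation of the Gaussian integral: the square
    of the integral over [0, X] plus the integral of this kernel over [0, 1] is constant in X. *)
Definition gauss_kernel (x t : R) : R := exp (- x ^ 2 * (1 + t ^ 2)) / (1 + t ^ 2).

Lemma gauss_kernel_derive x t :
  is_derive (fun x => gauss_kernel x t) x (- 2 * x * exp (- x ^ 2 * (1 + t ^ 2))).
Proof.
  unfold gauss_kernel. auto_derive.
  - nra.
  - replace (- (x * (x * 1)) * (1 + t * (t * 1))) with (- x ^ 2 * (1 + t ^ 2)) by ring.
    field. nra.
Qed.

Lemma gauss_kernel_Derive x t :
  Derive (fun u : R => gauss_kernel u t) x = - 2 * x * exp (- x ^ 2 * (1 + t ^ 2)).
Proof. apply is_derive_unique, gauss_kernel_derive. Qed.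

Lemma gauss_kernel_cont x t : continuous (gauss_kernel x) t.
Proof. apply cont_of_ex_derive. unfold gauss_kernel. auto_derive. nra. Qed.

Lemma gauss_polar_derive x :
  is_derive (fun x => RInt (gauss_kernel x) 0 1) x (- 2 * exp (- x ^ 2) * gauss x).
Proof.
  assert (E : RInt (fun t => Derive (fun u => gauss_kernel u t) x) 0 1
     = - 2 * exp (- x ^ 2) * gauss x).
  { replace (gauss x) with (gauss (x * 1)) by (f_equal; ring). rewrite <- gauss_scaled.
    rewrite <- RInt_mulc.
    - apply RInt_ext_R; [lra|]. intros t _.
      rewrite gauss_kernel_Derive.
      replace (- x ^ 2 * (1 + t ^ 2)) with (- x ^ 2 + - (x * t) ^ 2) by ring.
      rewrite exp_plus. ring.
    - apply ex_RInt_cont; [lra|]. intros t _. apply cont_of_ex_derive. now auto_derive. }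
  rewrite <- E. apply (is_derive_RInt_param gauss_kernel 0 1 x).
  - apply filter_forall. intros u t _. eexists. apply gauss_kernel_derive.
  - intros t _.
    apply continuity_2d_pt_ext with (fun u v => - 2 * u * exp (- u * u * (1 + v * v))).
    + intros u v. rewrite gauss_kernel_Derive.
      do 2 f_equal. ring.
    + apply continuity_2d_pt_mult.
      * apply continuity_2d_pt_mult; [apply continuity_2d_pt_const|apply continuity_2d_pt_id1].
      * apply (continuity_1d_2d_pt_comp exp (fun u v => - u * u * (1 + v * v))).
        { apply ex_derive_continuity_pt. now auto_derive. }
        repeat first [apply continuity_2d_pt_id1 | apply continuity_2d_pt_id2
          | apply continuity_2d_pt_const | apply continuity_2d_pt_opp
          | apply continuity_2d_pt_plus | apply continuity_2d_pt_mult].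
  - apply filter_forall. intros u. apply ex_RInt_cont; [lra|]. intros; apply gauss_kernel_cont.
Qed.

Lemma gauss_sq X : gauss X ^ 2 + RInt (gauss_kernel X) 0 1 = PI / 4.
Proof.
  set (H := fun x => gauss x ^ 2 + RInt (gauss_kernel x) 0 1).
  assert (D : forall x, is_derive H x 0).
  { intros x. unfold H. pose proof (gauss_derive x) as D1. pose proof (gauss_polar_derive x) as D2.
    apply (is_derive_ext (fun x => plus (gauss x * gauss x) (RInt (gauss_kernel x) 0 1))).
    { intros t. unfold plus; simpl. ring. }
    set (F := fun x => RInt (gauss_kernel x) 0 1).
    change (is_derive (fun x => plus (gauss x * gauss x) (F x)) x 0).
    replace 0 with (plus (exp (- x ^ 2) * gauss x + gauss x * exp (- x ^ 2))
       (- 2 * exp (- x ^ 2) * gauss x)) by (unfold plus; simpl; ring).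
    apply (is_derive_plus (K := R_AbsRing) (V := R_NormedModule)); [|exact D2].
    apply (is_derive_mult gauss gauss x); auto. intros; apply Rmult_comm. }
  destruct (MVT_gen H 0 X (fun _ => 0)) as [c [_ Hc]].
  - intros; apply D.
  - intros x _. apply ex_derive_continuity_pt. exists 0. apply D.
  - fold (H X). replace (H X) with (H 0) by lra. unfold H.
    replace (gauss 0) with 0 by (unfold gauss; symmetry; apply (RInt_point (V := R_CompleteNormedModule))).
    replace (RInt (gauss_kernel 0) 0 1) with (atan 1 - atan 0).
    + rewrite atan_1, atan_0. ring.
    + symmetry. apply is_RInt_unique.
      apply (is_RInt_derive (V := R_CompleteNormedModule) atan (gauss_kernel 0)).
      * intros x _. replace (gauss_kernel 0 x) with (/ (1 + x²)).
        -- apply is_derive_atan.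
        -- unfold gauss_kernel, Rsqr. replace (- 0 ^ 2 * (1 + x ^ 2)) with 0 by ring.
           rewrite exp_0. field. nra.
      * intros x _. apply gauss_kernel_cont.
Qed.

(** From [gauss_sq], since the kernel integral lies between 0 and exp(- X^2). *)
Lemma gauss_tail X : 0 <= X -> Rabs (gauss X - sqrt PI / 2) <= 2 * exp (- X ^ 2).
Proof.
  intros HX. pose proof (gauss_sq X) as E. pose proof PI_RGT_0.
  assert (Hk : 0 <= RInt (gauss_kernel X) 0 1 <= exp (- X ^ 2)).
  { assert (Ex : ex_RInt (gauss_kernel X) 0 1)
      by (apply ex_RInt_cont; [lra|]; intros; apply gauss_kernel_cont).
    split.
    - apply RInt_ge_0; [lra|assumption|]. intros x _. unfold gauss_kernel.
      left. apply Rdiv_lt_0_compat; [apply exp_pos|nra].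
    - replace (exp (- X ^ 2)) with (RInt (fun _ => exp (- X ^ 2)) 0 1)
        by (rewrite RInt_const; unfold scal; simpl; unfold mult; simpl; ring).
      apply RInt_le; [lra|assumption|apply ex_RInt_const|].
      intros x _. unfold gauss_kernel. apply Rle_div_l; [nra|].
      apply Rle_trans with (exp (- X ^ 2) * 1).
      + rewrite Rmult_1_r. apply exp_mono. nra.
      + apply Rmult_le_compat_l; [left; apply exp_pos|nra]. }
  assert (Hg : 0 <= gauss X).
  { apply RInt_ge_0; [lra| |intros; left; apply exp_pos].
    apply ex_RInt_cont; [lra|]. intros; apply cont_of_ex_derive; now auto_derive. }
  assert (Hs : 1 <= sqrt PI).
  { rewrite <- sqrt_1. apply sqrt_le_1_alt. pose proof PI2_1. lra. }
  assert (Hss : sqrt PI * sqrt PI = PI) by (apply sqrt_sqrt; lra).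
  assert (Hle : gauss X <= sqrt PI / 2) by nra.
  rewrite Rabs_minus_sym, Rabs_pos_eq by lra. nra.
Qed.

Lemma gauss_int k T : 0 < k -> 0 < T ->
  Rabs (RInt (fun t => exp (- k * t ^ 2)) 0 T - / 2 * sqrt (PI / k)) <= 2 / (sqrt k * k * T ^ 2).
Proof.
  intros Hk HT. assert (Hs : 0 < sqrt k) by now apply sqrt_lt_R0.
  assert (Hss : sqrt k * sqrt k = k) by (apply sqrt_sqrt; lra).
  assert (E : RInt (fun t => exp (- k * t ^ 2)) 0 T = / sqrt k * gauss (sqrt k * T)).
  { rewrite <- gauss_scaled, <- RInt_mulc.
    - apply RInt_ext_R; [lra|]. intros t _.
      replace (- (sqrt k * t) ^ 2) with (- (sqrt k * sqrt k) * t ^ 2) by ring. rewrite Hss.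
      field. lra.
    - apply ex_RInt_cont; [lra|]. intros; apply cont_of_ex_derive; now auto_derive. }
  rewrite E, sqrt_div by (pose proof PI_RGT_0; lra).
  replace (/ sqrt k * gauss (sqrt k * T) - / 2 * (sqrt PI / sqrt k))
    with (/ sqrt k * (gauss (sqrt k * T) - sqrt PI / 2)) by (field; lra).
  rewrite Rabs_mult, (Rabs_pos_eq (/ sqrt k)) by (left; now apply Rinv_0_lt_compat).
  assert (G := gauss_tail (sqrt k * T) ltac:(nra)).
  replace (- (sqrt k * T) ^ 2) with (- (sqrt k * sqrt k * T ^ 2)) in G by ring. rewrite Hss in G.
  assert (HkT : 0 < k * T ^ 2) by (apply Rmult_lt_0_compat; nra).
  pose proof (exp_neg_bound _ HkT).
  replace (2 / (sqrt k * k * T ^ 2)) with (/ sqrt k * (2 * / (k * T ^ 2))) by (field; nra).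
  apply Rmult_le_compat_l; [left; now apply Rinv_0_lt_compat|lra].
Qed.

Lemma cubic_gauss_int k T : 0 < k -> 0 < T ->
  RInt (fun t => t ^ 3 * exp (- k * t ^ 2)) 0 T <= / (2 * k ^ 2).
Proof.
  intros Hk HT.
  (* an antiderivative *)
  set (F := fun t => - (t ^ 2 / (2 * k) + / (2 * k ^ 2)) * exp (- k * t ^ 2)).
  assert (E : RInt (fun t => t ^ 3 * exp (- k * t ^ 2)) 0 T = F T - F 0).
  { apply is_RInt_unique, (is_RInt_derive (V := R_CompleteNormedModule) F).
    - intros t _. unfold F. auto_derive; [lra|].
      replace (- k * (t * (t * 1))) with (- k * t ^ 2) by ring. field. lra.
    - intros t _. apply cont_of_ex_derive. now auto_derive. }
  rewrite E. unfold F. replace (- k * 0 ^ 2) with 0 by ring. rewrite exp_0.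
  pose proof (exp_pos (- k * T ^ 2)).
  assert (0 < / (2 * k ^ 2)) by (apply Rinv_0_lt_compat; nra).
  assert (0 <= T ^ 2 / (2 * k)) by (apply Rmult_le_pos; [nra|left; apply Rinv_0_lt_compat; lra]).
  nra.
Qed.

(** One-sided Laplace method, with every constant explicit so that the estimate is uniform in
    f, g, d and kappa.  On [0, T0] the integrand differs from exp(- N kappa t^2 / 2) by at most
    2 N M t^3 exp(- N c t^2), whose integral is of order 1 / N; the rest is exponentially small.
    The phase d covers the oscillating integrand on the half circle. *)
Lemma laplace_half N kappa M c T0 T Tmax f g d :
  1 <= N -> 0 < kappa -> 0 < c -> c <= kappa / 2 -> 0 <= M -> 0 < T0 <= T -> T <= Tmax ->
  (forall t, 0 <= t <= T -> continuous f t) ->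
  (forall t, 0 <= t <= T0 -> f t = exp (N * g t) * cos (N * d t)) ->
  (forall t, 0 <= t <= T0 -> Rabs (g t + kappa * t ^ 2 / 2) <= M * t ^ 3) ->
  (forall t, 0 <= t <= T0 -> g t <= - c * t ^ 2) ->
  (forall t, 0 <= t <= T0 -> Rabs (d t) <= M * t ^ 3) ->
  (forall t, T0 <= t <= T -> Rabs (f t) <= exp (- N * (c * T0 ^ 2))) ->
  Rabs (RInt f 0 T - / 2 * sqrt (2 * PI / (N * kappa)))
  <= (M / c ^ 2 + Tmax / (c * T0 ^ 2) + 2 / (sqrt c * c * T0 ^ 2)) / N.
Proof.
  intros HN Hk Hc Hck HM HT HTm Cf Ef Eg Ec Ed Et.
  assert (HT0 : 0 < T0 ^ 2) by nra.
  rewrite (RInt_split f 0 T0 T); [|lra|apply ex_RInt_cont; [lra|assumption]].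
  assert (EX1 : ex_RInt f 0 T0) by (apply ex_RInt_cont; [lra|intros; apply Cf; lra]).
  assert (EX2 : ex_RInt f T0 T) by (apply ex_RInt_cont; [lra|intros; apply Cf; lra]).
  assert (CG : forall k t, continuous (fun t => exp (- k * t ^ 2)) t)
    by (intros; apply cont_of_ex_derive; now auto_derive).
  assert (C3 : forall k t, continuous (fun t => t ^ 3 * exp (- k * t ^ 2)) t)
    by (intros; apply cont_of_ex_derive; now auto_derive).
  assert (B1 : Rabs (RInt f T0 T) <= Tmax / (c * T0 ^ 2) / N).
  { eapply Rle_trans; [apply abs_RInt_le_const with (M := exp (- N * (c * T0 ^ 2))); auto; lra|].
    assert (HcT : 0 < N * (c * T0 ^ 2)) by (apply Rmult_lt_0_compat; [lra|nra]).
    pose proof (exp_neg_bound _ HcT) as Hb.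
    replace (Tmax / (c * T0 ^ 2) / N) with (Tmax * / (N * (c * T0 ^ 2))) by (field; lra).
    replace (- N * (c * T0 ^ 2)) with (- (N * (c * T0 ^ 2))) by ring.
    pose proof (exp_pos (- (N * (c * T0 ^ 2)))). nra. }
  assert (B2 : Rabs (RInt f 0 T0 - RInt (fun t => exp (- (N * kappa / 2) * t ^ 2)) 0 T0) <= M / c ^ 2 / N).
  { assert (EG : ex_RInt (fun t => exp (- (N * kappa / 2) * t ^ 2)) 0 T0)
      by (apply ex_RInt_cont; [lra|intros; apply CG]).
    rewrite <- RInt_sub by assumption.
    assert (EM : ex_RInt (fun t => f t - exp (- (N * kappa / 2) * t ^ 2)) 0 T0)
      by now apply (ex_RInt_minus (V := R_NormedModule)).
    eapply Rle_trans; [apply abs_RInt_le; [lra|exact EM]|].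
    apply Rle_trans with (RInt (fun t => (2 * N * M) * (t ^ 3 * exp (- (N * c) * t ^ 2))) 0 T0).
    - apply RInt_le; [lra| | |].
      + exact (ex_RInt_norm _ _ _ EM).
      + apply (ex_RInt_scal (V := R_NormedModule)). apply ex_RInt_cont; [lra|intros; apply C3].
      + intros t Ht. rewrite Ef by lra.
        assert (Ht' : 0 <= t <= T0) by lra.
        specialize (Eg t Ht'). specialize (Ec t Ht'). specialize (Ed t Ht').
        set (gN := exp (N * g t)). set (e := exp (- (N * c) * t ^ 2)).
        assert (Hge : gN <= e) by (apply exp_mono; nra).
        assert (Hg0 : 0 < gN) by apply exp_pos.
        assert (Ht3 : 0 <= M * t ^ 3).
        { apply Rmult_le_pos; [assumption|]. apply pow_le; lra. }
        replace (gN * cos (N * d t) - exp (- (N * kappa / 2) * t ^ 2))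
          with (gN * (cos (N * d t) - 1) + (gN - exp (- (N * kappa / 2) * t ^ 2))) by ring.
        eapply Rle_trans; [apply Rabs_triang|].
        assert (P1 : Rabs (gN * (cos (N * d t) - 1)) <= N * (M * t ^ 3) * e).
        { rewrite Rabs_mult, (Rabs_pos_eq gN) by lra.
          pose proof (one_minus_cos_le (N * d t)) as H1. rewrite Rabs_mult, (Rabs_pos_eq N) in H1 by lra.
          assert (Rabs (cos (N * d t) - 1) <= N * (M * t ^ 3)) by nra.
          rewrite (Rmult_comm _ e). apply Rmult_le_compat; try lra. apply Rabs_pos. }
        assert (P2 : Rabs (gN - exp (- (N * kappa / 2) * t ^ 2)) <= N * (M * t ^ 3) * e).
        { eapply Rle_trans; [apply exp_diff_le with (c := - (N * c) * t ^ 2)|].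
          - nra.
          - assert (0 <= t ^ 2) by nra. assert (N * c <= N * kappa / 2) by nra. nra.
          - apply Rmult_le_compat_r; [left; apply exp_pos|].
            replace (N * g t - - (N * kappa / 2) * t ^ 2) with (N * (g t + kappa * t ^ 2 / 2)) by field.
            rewrite Rabs_mult, (Rabs_pos_eq N) by lra. nra. }
        lra.
    - rewrite RInt_mulc by (apply ex_RInt_cont; [lra|intros; apply C3]).
      assert (HNc : 0 < N * c) by nra.
      pose proof (cubic_gauss_int (N * c) T0 HNc ltac:(lra)) as Q.
      apply Rle_trans with (2 * N * M * / (2 * (N * c) ^ 2)).
      + apply Rmult_le_compat_l; [nra|exact Q].
      + right. field. lra. }
  assert (B3 : Rabs (RInt (fun t => exp (- (N * kappa / 2) * t ^ 2)) 0 T0 - / 2 * sqrt (2 * PI / (N * kappa)))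
       <= 2 / (sqrt c * c * T0 ^ 2) / N).
  { assert (HNk : 0 < N * kappa / 2) by nra.
    pose proof (gauss_int (N * kappa / 2) T0 HNk ltac:(lra)) as Q.
    replace (PI / (N * kappa / 2)) with (2 * PI / (N * kappa)) in Q by (field; lra).
    eapply Rle_trans; [exact Q|].
    assert (Hsc : 0 < sqrt c) by now apply sqrt_lt_R0.
    replace (2 / (sqrt c * c * T0 ^ 2) / N) with (2 * / (sqrt c * (N * c) * T0 ^ 2)) by (field; lra).
    apply Rmult_le_compat_l; [lra|].
    apply Rinv_le_contravar.
    - repeat apply Rmult_lt_0_compat; nra.
    - apply Rmult_le_compat_r; [lra|]. apply Rmult_le_compat; try nra.
      apply sqrt_le_1_alt. nra. }
  apply Rabs_le_between in B1. apply Rabs_le_between in B2. apply Rabs_le_between in B3.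
  apply Rabs_le. unfold Rdiv in *. rewrite !Rmult_plus_distr_r. lra.
Qed.

(** * Deforming the half circle: the exact decomposition *)

Lemma h_cont_pos p q x a nu s t : 0 < x -> 0 < a ->
  continuity_2d_pt (hre p q x a nu) s t /\ continuity_2d_pt (him p q x a nu) s t.
Proof. intros Hx Ha. apply h_cont; left; assumption. Qed.

Lemma hmod_cont p q x a nu s t : 0 < x -> 0 < a ->
  continuity_2d_pt (hmod p q x a nu) s t.
Proof.
  intros Hx Ha. unfold hmod.
  assert (B1 : forall t : R, Rabs 1 <= 1) by (intros; rewrite Rabs_R1; lra).
  assert (K1 : continuity (fun _ => 1)) by (apply continuity_const; intros ? ?; reflexivity).
  assert (C1 := pow_comp_cont x (fun _ => 1) (Zx q) (Zy q) s t (or_introl Hx) K1 B1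
     (Zx_cont q s t) (Zy_cont q s t)).
  assert (C2 := pow_comp_cont a (fun _ => 1) (Zx (- p)) (Zy p) s t (or_introl Ha) K1 B1
     (Zx_cont (- p) s t) (Zy_cont p s t)).
  assert (E : continuity_2d_pt (fun u _ => exp (- nu * u)) s t).
  { apply (continuity_1d_2d_pt_comp (fun u => exp (- nu * u)) (fun u _ => u));
      [|apply continuity_2d_pt_id1]. apply ex_derive_continuity_pt. now auto_derive. }
  assert (F := continuity_2d_pt_mult _ _ _ _ (continuity_2d_pt_mult _ _ _ _ E C1) C2).
  revert F. apply continuity_2d_pt_ext. intros u v. ring.
Qed.

Lemma hmod_ge0 p q x a nu s t : 0 <= hmod p q x a nu s t.
Proof.
  unfold hmod. apply Rmult_le_pos; [apply Rmult_le_pos|]; try apply modpow_pos.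
  left; apply exp_pos.
Qed.

(** On the left cut the argument of 1 + q w is pi. *)
Lemma him_left_cut p q x a n s :
  0 < p -> 0 < q -> 0 < x -> - ln q <= s ->
  him p q x a (INR n) s PI = (-1) ^ n * sin (PI * x) * hmod p q x a (INR n) s PI.
Proof.
  intros Hp Hq Hx Hs. pose proof (mul_exp_ge_1 q s Hq Hs) as [H|H].
  - unfold him, hang. pose proof (exp_pos s).
    rewrite !Zx_PI, !Zy_PI, arg_neg, arg_pos by nra.
    replace (x * PI - a * 0 - INR n * PI) with (PI * x - INR n * PI) by ring.
    rewrite sin_minus, sin_INR_PI, cos_INR_PI. ring.
  - replace (hmod p q x a (INR n) s PI) with 0.
    + unfold him. replace (hmod p q x a (INR n) s PI) with 0; [ring|].
      unfold hmod, modpow. rewrite Zx_PI, Zy_PI, <- H.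
      destruct (Req_EM_T ((1 - 1) ^ 2 + 0 ^ 2) 0); [ring|]. exfalso; apply n0; ring.
    + unfold hmod, modpow. rewrite Zx_PI, Zy_PI, <- H.
      destruct (Req_EM_T ((1 - 1) ^ 2 + 0 ^ 2) 0); [ring|]. exfalso; apply n0; ring.
Qed.

(** On the right cut the argument of 1 - p w is - pi, and sin(- pi a) = (-1)^N sin(pi x)
    because x + a = N is an integer. *)
Lemma him_right_cut p q x a n N s :
  0 < p -> 0 < q -> x + a = INR N ->
  Rabs (him p q x a (INR n) s 0)
  <= Rabs (sin (PI * x)) * (if Rlt_dec 1 (p * exp s) then hmod p q x a (INR n) s 0 else 0).
Proof.
  intros Hp Hq HN. unfold him, hang. pose proof (exp_pos s).
  rewrite !Zx_0, !Zy_0, (arg_pos (1 + q * exp s)) by nra.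
  rewrite Rabs_mult, (Rabs_pos_eq (hmod _ _ _ _ _ _ _)) by apply hmod_ge0.
  destruct (Rlt_dec 1 (p * exp s)) as [H1|H1].
  - rewrite arg_neg by nra.
    replace (x * 0 - a * PI - INR n * 0) with (PI * x - INR N * PI) by (rewrite <- HN; ring).
    rewrite sin_minus, sin_INR_PI, cos_INR_PI.
    replace (sin (PI * x) * (-1) ^ N - cos (PI * x) * 0) with (sin (PI * x) * (-1) ^ N) by ring.
    rewrite Rabs_mult, pow_1_abs. lra.
  - rewrite arg_pos by nra.
    replace (x * 0 - a * 0 - INR n * 0) with 0 by ring.
    rewrite sin_0, Rabs_R0. lra.
Qed.

(** On the half circle the argument of h is split as its value pi x - pi n at the left end
    plus a rest, so that the addition theorems separate cos(pi x) and sin(pi x).  The right cut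
    enters as the number r; dividing by sin(pi x) is legitimate since it bounds that integral. *)
Lemma coef_decomposition p q x a n N S B :
  0 < p < 1 -> 0 < q < 1 -> 0 < x -> 0 < a -> x + a = INR N ->
  1 < q * exp S ->
  (forall s, s <= S -> 1 < p * exp s -> hmod p q x a (INR n) s 0 <= B) -> 0 <= B ->
  exists r, Rabs r <= S * B /\
  PI * coef p q x a n =
  (-1) ^ n *
  (cos (PI * x) * RInt (fun t => hmod p q x a (INR n) S t
        * cos (hang p q x a (INR n) S t - hang p q x a (INR n) S PI)) 0 PI
   - sin (PI * x) * (RInt (fun s => hmod p q x a (INR n) s PI) (- ln q) S
       + RInt (fun t => hmod p q x a (INR n) S t
        * sin (hang p q x a (INR n) S t - hang p q x a (INR n) S PI)) 0 PI + r)).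
Proof.
  intros Hp Hq Hx Ha HN HS HB HB0. pose proof PI_RGT_0 as HPI.
  pose proof (ln_neg p Hp). pose proof (ln_neg q Hq).
  pose proof (log_of_mul_exp_gt_1 q S ltac:(lra) HS) as HSq.
  assert (Ch : forall s t, continuity_2d_pt (hre p q x a (INR n)) s t /\
      continuity_2d_pt (him p q x a (INR n)) s t) by (intros; now apply h_cont_pos).
  assert (G := green_h p q x a n (S + 1) 0 S ltac:(lra) ltac:(lra) ltac:(lra)
     ltac:(intros; apply Ch)).
  rewrite coef_integral in G by assumption.
  assert (EI : forall t u v, u <= v -> ex_RInt (fun s => him p q x a (INR n) s t) u v).
  { intros t u v Huv. apply ex_RInt_cont; [lra|]. intros. apply continuous_2d_fst, Ch. }
  rewrite RInt_sub in G by (apply EI; lra).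
  assert (EL : RInt (fun s => him p q x a (INR n) s PI) 0 S
    = (-1) ^ n * sin (PI * x) * RInt (fun s => hmod p q x a (INR n) s PI) (- ln q) S).
  { rewrite (RInt_split _ 0 (- ln q) S) by (try apply EI; lra).
    rewrite (RInt_ext_R _ (fun _ => 0) 0 (- ln q)); [|lra|].
    - rewrite RInt_const. change (scal (- ln q - 0) 0) with ((- ln q - 0) * 0).
      rewrite Rmult_0_r, Rplus_0_l, <- RInt_mulc.
      + apply RInt_ext_R; [lra|]. intros s Hs. apply him_left_cut; lra.
      + apply ex_RInt_cont; [lra|]. intros s _.
        apply (continuous_2d_fst (hmod p q x a (INR n))). now apply hmod_cont.
    - intros s Hs. pose proof (mul_exp_le_1 q s ltac:(lra) ltac:(lra)).
      unfold him, hang. rewrite !Zx_PI, !Zy_PI, !arg_pos by (pose proof (exp_pos s); nra).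
      replace (x * 0 - a * 0 - INR n * PI) with (- (INR n * PI)) by ring.
      rewrite sin_neg, sin_INR_PI. ring. }
  set (h2 := RInt (fun s => him p q x a (INR n) s 0) 0 S) in *.
  assert (ER : exists r, Rabs r <= S * B /\ - (-1) ^ n * sin (PI * x) * r = h2).
  { assert (Hb : Rabs h2 <= S * (Rabs (sin (PI * x)) * B)).
    { replace (S * (Rabs (sin (PI * x)) * B)) with ((S - 0) * (Rabs (sin (PI * x)) * B)) by ring.
      apply abs_RInt_le_const; [lra|apply EI; lra|]. intros s Hs.
      eapply Rle_trans; [apply (him_right_cut p q x a n N); lra|].
      apply Rmult_le_compat_l; [apply Rabs_pos|].
      destruct (Rlt_dec 1 (p * exp s)); [|assumption]. apply HB; lra. }
    assert (H1 : (-1) ^ n * (-1) ^ n = 1).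
    { rewrite <- Rpow_mult_distr. replace (-1 * -1) with 1 by ring. apply pow1. }
    destruct (Req_dec (sin (PI * x)) 0) as [E0|E0].
    - exists 0. rewrite Rabs_R0. split; [apply Rmult_le_pos; lra|].
      rewrite E0, Rabs_R0 in Hb. replace (S * (0 * B)) with 0 in Hb by ring.
      rewrite Rmult_0_r. destruct (Req_dec h2 0) as [|N0]; [now symmetry|].
      pose proof (Rabs_pos_lt h2 N0). lra.
    - exists (- (-1) ^ n * (h2 / sin (PI * x))). split.
      + rewrite Rabs_mult, Rabs_Ropp, pow_1_abs, Rmult_1_l, Rabs_div by assumption.
        apply Rle_div_l; [now apply Rabs_pos_lt|]. lra.
      + replace (- (-1) ^ n * sin (PI * x) * (- (-1) ^ n * (h2 / sin (PI * x))))
          with ((-1) ^ n * (-1) ^ n * h2) by (now field). rewrite H1. ring. }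
  destruct ER as [r [Hr Er]]. exists r. split; [exact Hr|].
  (* the argument at the left end, pi x - pi n *)
  set (c := hang p q x a (INR n) S PI).
  assert (Ec : c = PI * x - INR n * PI).
  { unfold c, hang. rewrite !Zx_PI, !Zy_PI. rewrite arg_neg, arg_pos.
    - ring.
    - pose proof (exp_pos S). nra.
    - lra. }
  assert (Cc : cos c = (-1) ^ n * cos (PI * x)).
  { rewrite Ec, cos_minus, sin_INR_PI, cos_INR_PI. ring. }
  assert (Sc : sin c = (-1) ^ n * sin (PI * x)).
  { rewrite Ec, sin_minus, sin_INR_PI, cos_INR_PI. ring. }
  assert (CR : forall t, continuous (hre p q x a (INR n) S) t)
    by (intros; apply continuous_2d_snd, Ch).
  assert (CI : forall t, continuous (him p q x a (INR n) S) t)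
    by (intros; apply continuous_2d_snd, Ch).
  assert (XR : ex_RInt (hre p q x a (INR n) S) 0 PI) by (apply ex_RInt_cont; [lra|auto]).
  assert (XI : ex_RInt (him p q x a (INR n) S) 0 PI) by (apply ex_RInt_cont; [lra|auto]).
  assert (Ac : RInt (fun t => hmod p q x a (INR n) S t * cos (hang p q x a (INR n) S t - c)) 0 PI
     = cos c * RInt (hre p q x a (INR n) S) 0 PI + sin c * RInt (him p q x a (INR n) S) 0 PI).
  { rewrite <- !RInt_mulc by assumption.
    rewrite <- RInt_add.
    - apply RInt_ext_R; [lra|]. intros t _. rewrite cos_minus. unfold hre, him. ring.
    - now apply (ex_RInt_scal (V := R_NormedModule)).
    - now apply (ex_RInt_scal (V := R_NormedModule)). }
  assert (As : RInt (fun t => hmod p q x a (INR n) S t * sin (hang p q x a (INR n) S t - c)) 0 PI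
     = cos c * RInt (him p q x a (INR n) S) 0 PI - sin c * RInt (hre p q x a (INR n) S) 0 PI).
  { rewrite <- !RInt_mulc by assumption. rewrite <- RInt_sub.
    - apply RInt_ext_R; [lra|]. intros t _. rewrite sin_minus. unfold hre, him. ring.
    - now apply (ex_RInt_scal (V := R_NormedModule)).
    - now apply (ex_RInt_scal (V := R_NormedModule)). }
  rewrite Ac, As. rewrite EL, <- Er in G.
  set (J := RInt (fun s => hmod p q x a (INR n) s PI) (- ln q) S) in *.
  set (RR := RInt (hre p q x a (INR n) S) 0 PI) in *.
  set (II := RInt (him p q x a (INR n) S) 0 PI) in *.
  assert (Hsc : cos c * cos c + sin c * sin c = 1) by (pose proof (sin2_cos2 c); unfold Rsqr in *; lra).
  assert (cos c * (cos c * RR + sin c * II) - sin c * (cos c * II - sin c * RR) = RR).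
  { replace (cos c * (cos c * RR + sin c * II) - sin c * (cos c * II - sin c * RR))
      with ((cos c * cos c + sin c * sin c) * RR) by ring. rewrite Hsc. ring. }
  rewrite Cc, Sc in *. lra.
Qed.

(** * The two saddle points *)

(** The saddle points in the coordinate u = - 1 / w on the negative axis: v = - U^+ and
    w = - U^- are the roots of z u^2 - (p - y + (q - p) z) u + p q (1 - z), and the two equations are
    the values of this quadratic at u = q and u = - p.  The bounds keep v and w away from 0,
    from each other and from the branch point q. *)
Definition roots (p q d y z v w : R) : Prop :=
  (0 < p < 1 /\ 0 < q < 1 /\ p + q = 1) /\ 0 < d < 1 /\ p <= z < 1 /\ d <= y < 1 /\
  y * q = z * (q - v) * (q - w) /\ (1 - y) * p = z * (p + v) * (p + w) /\
  p * q * d <= v /\ v + d <= w /\ w <= q - d.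

(** The second derivative of s -> ln |h(- e^s)| / N at the critical point s = - ln v.  Exchanging
    v and w gives the second derivative at the other critical point, which is negative. *)
Definition curv (p q z v w : R) : R := z * v * (w - v) / ((q - v) * (p + v)).

(** The saddle point equations and two expressions for the curvatures, all by
    eliminating y with the two defining equations. *)
Lemma roots_facts p q d y z v w : roots p q d y z v w ->
  0 < p * q * d /\ 0 < v /\ 0 < w /\ d <= q - v /\ d <= q - w /\ v < 1 /\ w < 1 /\
  y * q / (q - v) + (1 - y) * p / (p + v) = z /\
  y * q / (q - w) + (1 - y) * p / (p + w) = z /\
  curv p q z v w = (1 - y) * p * v / (p + v) ^ 2 - y * q * v / (q - v) ^ 2 /\
  - curv p q z w v = y * q * w / (q - w) ^ 2 - (1 - y) * p * w / (p + w) ^ 2.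
Proof.
  intros ((Hp & Hq & Hpq) & Hd & Hz & Hy & E1 & E2 & Hv & Hvw & Hw).
  assert (0 < p * q * d) by (apply Rmult_lt_0_compat; nra).
  assert (q = 1 - p) by lra. unfold curv.
  repeat split; try lra.
  - rewrite E1, E2. subst q. field. lra.
  - rewrite E1, E2. subst q. field. lra.
  - rewrite E1, E2. subst q. field. lra.
  - rewrite E1, E2. subst q. field. lra.
Qed.

Lemma curv_bounds p q d y z v w : roots p q d y z v w ->
  p * (p * q * d) * d <= curv p q z v w <= / d.
Proof.
  intros H. destruct (roots_facts _ _ _ _ _ _ _ H) as (F0 & F1 & F2 & F3 & F4 & F5 & F6 & _).
  destruct H as ((Hp & Hq & Hpq) & Hd & Hz & Hy & E1 & E2 & Hv & Hvw & Hw).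
  unfold curv.
  assert (D : 0 < (q - v) * (p + v)) by (apply Rmult_lt_0_compat; lra).
  split.
  - apply (proj1 (Rle_div_r _ _ _ D)).
    assert (L : p * (p * q * d) * d <= z * v * (w - v)).
    { apply Rmult_le_compat; [|lra| |lra].
      - apply Rmult_le_pos; lra.
      - apply Rmult_le_compat; lra. }
    assert ((q - v) * (p + v) <= 1) by nra.
    assert (0 <= p * (p * q * d) * d) by (repeat apply Rmult_le_pos; lra).
    nra.
  - apply (proj2 (Rle_div_l _ _ _ D)).
    apply Rmult_le_reg_l with d; [lra|].
    replace (d * (/ d * ((q - v) * (p + v)))) with ((q - v) * (p + v)) by (field; lra).
    assert (z * v * (w - v) <= v).
    { assert (z * v <= v) by nra. assert (0 <= z * v) by (apply Rmult_le_pos; lra). nra. }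
    nra.
Qed.

Lemma curv_bounds_second p q d y z v w : roots p q d y z v w ->
  p * (p * q * d) * d <= - curv p q z w v <= / d.
Proof.
  intros H. destruct (roots_facts _ _ _ _ _ _ _ H) as (F0 & F1 & F2 & F3 & F4 & F5 & F6 & _).
  destruct H as ((Hp & Hq & Hpq) & Hd & Hz & Hy & E1 & E2 & Hv & Hvw & Hw).
  unfold curv.
  assert (D : 0 < (q - w) * (p + w)) by (apply Rmult_lt_0_compat; lra).
  replace (- (z * w * (v - w) / ((q - w) * (p + w)))) with (z * w * (w - v) / ((q - w) * (p + w)))
    by (field; lra).
  split.
  - apply (proj1 (Rle_div_r _ _ _ D)).
    assert (L : p * (p * q * d) * d <= z * w * (w - v)).
    { apply Rmult_le_compat; [|lra| |lra].
      - apply Rmult_le_pos; lra.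
      - apply Rmult_le_compat; lra. }
    assert ((q - w) * (p + w) <= 1) by nra.
    assert (0 <= p * (p * q * d) * d) by (repeat apply Rmult_le_pos; lra).
    nra.
  - apply (proj2 (Rle_div_l _ _ _ D)).
    apply Rmult_le_reg_l with d; [lra|].
    replace (d * (/ d * ((q - w) * (p + w)))) with ((q - w) * (p + w)) by (field; lra).
    assert (z * w * (w - v) <= w).
    { assert (z * w <= w) by nra. assert (0 <= z * w) by (apply Rmult_le_pos; lra). nra. }
    nra.
Qed.

(** * The half circle through the first saddle point *)

Lemma modpow_ratio x X Y X0 Y0 rho :
  0 < X0 ^ 2 + Y0 ^ 2 -> 0 < rho -> X ^ 2 + Y ^ 2 = (X0 ^ 2 + Y0 ^ 2) * rho ->
  modpow x X Y = modpow x X0 Y0 * exp (x / 2 * ln rho).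
Proof.
  intros H0 Hr E. unfold modpow.
  destruct (Req_EM_T (X ^ 2 + Y ^ 2) 0); [nra|].
  destruct (Req_EM_T (X0 ^ 2 + Y0 ^ 2) 0); [lra|].
  rewrite E, ln_mult, Rmult_plus_distr_l, exp_plus by assumption. reflexivity.
Qed.

Lemma modpow_zero x X Y : X ^ 2 + Y ^ 2 = 0 -> modpow x X Y = 0.
Proof. intros E. unfold modpow. destruct (Req_EM_T _ 0); [reflexivity|contradiction]. Qed.

(** The value of ln |h| / N on the half circle of radius 1 / v relative to its left end, as a
    function of k = 1 + cos of the polar angle.  It is concave in k. *)
Definition arcexp (p q y v k : R) : R :=
  y / 2 * ln (1 + 2 * q * v / (q - v) ^ 2 * k) + (1 - y) / 2 * ln (1 - 2 * p * v / (p + v) ^ 2 * k).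

Lemma arc_rate_bounds p q d v : 0 < p < 1 -> 0 < q < 1 -> 0 < d -> 0 < v < 1 -> d <= q - v ->
  0 <= 2 * q * v / (q - v) ^ 2 <= 2 / d ^ 2 /\ 0 <= 2 * p * v / (p + v) ^ 2 <= 1 / 2.
Proof.
  intros Hp Hq Hd Hv Hqv.
  assert (0 < (q - v) ^ 2) by (apply pow_lt; lra).
  assert (0 < d ^ 2) by (apply pow_lt; lra).
  assert (0 < (p + v) ^ 2) by (apply pow_lt; lra).
  assert (0 < q * v) by (apply Rmult_lt_0_compat; lra).
  assert (0 < p * v) by (apply Rmult_lt_0_compat; lra).
  repeat split.
  - apply Rmult_le_pos; [lra|]. left; now apply Rinv_0_lt_compat.
  - unfold Rdiv. apply Rmult_le_compat; [lra|left; now apply Rinv_0_lt_compat|nra|].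
    apply Rinv_le_contravar; [assumption|]. apply pow_incr. lra.
  - apply Rmult_le_pos; [lra|]. left; now apply Rinv_0_lt_compat.
  - apply Rle_div_l; [assumption|]. pose proof (pow2_ge_0 (p - v)). nra.
Qed.

(** The first case occurs only at t = pi, when the half circle ends at the branch point 1 / p. *)
Lemma arc_modulus p q d y z v w N nu t :
  roots p q d y z v w ->
  let S := - ln v in
  let h := hmod p q (y * N) ((1 - y) * N) nu S in
  (1 - 2 * p * v / (p + v) ^ 2 * (1 - cos t) = 0 /\ h (PI - t) = 0) \/
  (0 < 1 - 2 * p * v / (p + v) ^ 2 * (1 - cos t) /\
   h (PI - t) = h PI * exp (N * arcexp p q y v (1 - cos t))).
Proof.
  intros H S h. destruct (roots_facts _ _ _ _ _ _ _ H) as (F0 & F1 & F2 & F3 & F4 & F5 & F6 & _).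
  destruct H as ((Hp & Hq & Hpq) & Hd & Hz & Hy & E1 & E2 & Hv & Hvw & Hw).
  destruct (arc_rate_bounds p q d v Hp Hq ltac:(lra) ltac:(lra) F3) as [HA HB].
  assert (HE : exp S = / v) by (unfold S; rewrite exp_Ropp, exp_ln by assumption; reflexivity).
  pose proof (COS_bound t) as Hc. pose proof (sin2_cos2 t) as Hsc. unfold Rsqr in Hsc.
  assert (M1 : Zx q S (PI - t) ^ 2 + Zy q S (PI - t) ^ 2
     = (Zx q S PI ^ 2 + Zy q S PI ^ 2) * (1 + 2 * q * v / (q - v) ^ 2 * (1 - cos t))).
  { rewrite Zx_PI, Zy_PI. unfold Zx, Zy. rewrite HE, Rtrigo_facts.cos_pi_minus, sin_PI_x.
    replace ((1 + q * / v * - cos t) ^ 2 + (q * / v * sin t) ^ 2)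
      with (1 - 2 * (q * / v * cos t) + (q * / v) ^ 2 * (sin t * sin t + cos t * cos t)) by ring.
    rewrite Hsc. field. lra. }
  assert (M2 : Zx (- p) S (PI - t) ^ 2 + Zy p S (PI - t) ^ 2
     = (Zx (- p) S PI ^ 2 + Zy p S PI ^ 2) * (1 - 2 * p * v / (p + v) ^ 2 * (1 - cos t))).
  { rewrite Zx_PI, Zy_PI. unfold Zx, Zy. rewrite HE, Rtrigo_facts.cos_pi_minus, sin_PI_x.
    replace ((1 + - p * / v * - cos t) ^ 2 + (p * / v * sin t) ^ 2)
      with (1 + 2 * (p * / v * cos t) + (p * / v) ^ 2 * (sin t * sin t + cos t * cos t)) by ring.
    rewrite Hsc. field. lra. }
  assert (P1 : 0 < Zx q S PI ^ 2 + Zy q S PI ^ 2).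
  { apply sumsq_pos. left. rewrite Zx_PI, HE.
    replace (1 - q * / v) with (- ((q - v) / v)) by (field; lra).
    assert (0 < (q - v) / v) by (apply Rdiv_lt_0_compat; lra). lra. }
  assert (P2 : 0 < Zx (- p) S PI ^ 2 + Zy p S PI ^ 2).
  { apply sumsq_pos. left. rewrite Zx_PI, HE. pose proof (Rinv_0_lt_compat v F1). nra. }
  assert (R1 : 0 < 1 + 2 * q * v / (q - v) ^ 2 * (1 - cos t)) by nra.
  assert (R2 : 0 <= 1 - 2 * p * v / (p + v) ^ 2 * (1 - cos t)) by nra.
  destruct R2 as [R2|R2].
  - right. split; [assumption|]. unfold h, hmod.
    rewrite (modpow_ratio _ _ _ _ _ _ P1 R1 M1), (modpow_ratio _ _ _ _ _ _ P2 R2 M2).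
    unfold arcexp. rewrite Rmult_plus_distr_l, exp_plus.
    replace (y * N / 2 * ln (1 + 2 * q * v / (q - v) ^ 2 * (1 - cos t)))
      with (N * (y / 2 * ln (1 + 2 * q * v / (q - v) ^ 2 * (1 - cos t)))) by field.
    replace ((1 - y) * N / 2 * ln (1 - 2 * p * v / (p + v) ^ 2 * (1 - cos t)))
      with (N * ((1 - y) / 2 * ln (1 - 2 * p * v / (p + v) ^ 2 * (1 - cos t)))) by field.
    ring.
  - left. split; [now symmetry|]. unfold h, hmod. rewrite <- R2, Rmult_0_r in M2.
    rewrite (modpow_zero ((1 - y) * N) _ _ M2). ring.
Qed.

(** A concave function lies below its tangent; here this is ln u <= u - 1 in each term. *)
Lemma arcexp_le p q d y z v w k :
  roots p q d y z v w -> 0 <= k -> 0 < 1 - 2 * p * v / (p + v) ^ 2 * k ->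
  arcexp p q y v k <= - curv p q z v w * k.
Proof.
  intros H Hk H2. destruct (roots_facts _ _ _ _ _ _ _ H) as (F0 & F1 & F2 & F3 & F4 & F5 & F6 & _ & _ & EK & _).
  destruct H as ((Hp & Hq & Hpq) & Hd & Hz & Hy & E1 & E2 & Hv & Hvw & Hw).
  destruct (arc_rate_bounds p q d v Hp Hq ltac:(lra) ltac:(lra) F3) as [HA HB].
  assert (R1 : 0 < 1 + 2 * q * v / (q - v) ^ 2 * k) by nra.
  pose proof (ln_le_sub1 _ R1). pose proof (ln_le_sub1 _ H2).
  rewrite EK. unfold arcexp.
  apply Rle_trans with (y / 2 * (1 + 2 * q * v / (q - v) ^ 2 * k - 1)
     + (1 - y) / 2 * (1 - 2 * p * v / (p + v) ^ 2 * k - 1)).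
  - apply Rplus_le_compat; apply Rmult_le_compat_l; lra.
  - right. field. lra.
Qed.

Lemma arcexp_quadratic p q d y z v w k :
  roots p q d y z v w -> 0 <= k -> 2 / d ^ 2 * k <= 1 / 2 -> k <= 1 ->
  Rabs (arcexp p q y v k + curv p q z v w * k) <= (4 / d ^ 4 + 1) * k ^ 2.
Proof.
  intros H Hk HdK Hk1. destruct (roots_facts _ _ _ _ _ _ _ H) as (F0 & F1 & F2 & F3 & F4 & F5 & F6 & _ & _ & EK & _).
  destruct H as ((Hp & Hq & Hpq) & Hd & Hz & Hy & E1 & E2 & Hv & Hvw & Hw).
  destruct (arc_rate_bounds p q d v Hp Hq ltac:(lra) ltac:(lra) F3) as [HA HB].
  rewrite EK. unfold arcexp.
  replace ((1 - y) * p * v / (p + v) ^ 2 - y * q * v / (q - v) ^ 2) with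
    ((1 - y) / 2 * (2 * p * v / (p + v) ^ 2) - y / 2 * (2 * q * v / (q - v) ^ 2)) by (field; lra).
  replace (4 / d ^ 4) with ((2 / d ^ 2) ^ 2) by (field; lra).
  set (A := 2 * q * v / (q - v) ^ 2) in *. set (B := 2 * p * v / (p + v) ^ 2) in *.
  set (A0 := 2 / d ^ 2) in *.
  assert (Q1 : Rabs (ln (1 + A * k) - A * k) <= 2 * (A * k) ^ 2).
  { apply ln_quadratic. rewrite Rabs_pos_eq; nra. }
  assert (Q2 : Rabs (ln (1 - B * k) - - (B * k)) <= 2 * (B * k) ^ 2).
  { replace (2 * (B * k) ^ 2) with (2 * (- (B * k)) ^ 2) by ring.
    unfold Rminus at 2. apply ln_quadratic. rewrite Rabs_Ropp, Rabs_pos_eq; nra. }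
  assert (S1 : (A * k) ^ 2 <= A0 ^ 2 * k ^ 2).
  { rewrite <- Rpow_mult_distr. apply pow_incr. nra. }
  assert (S2 : (B * k) ^ 2 <= 1 * k ^ 2).
  { rewrite Rmult_1_l. apply pow_incr. nra. }
  replace (y / 2 * ln (1 + A * k) + (1 - y) / 2 * ln (1 - B * k) + ((1 - y) / 2 * B - y / 2 * A) * k)
    with (y / 2 * (ln (1 + A * k) - A * k) + (1 - y) / 2 * (ln (1 - B * k) - - (B * k))) by field.
  apply Rabs_le_between in Q1. apply Rabs_le_between in Q2. apply Rabs_le.
  set (L1 := ln (1 + A * k) - A * k) in *. set (L2 := ln (1 - B * k) - - (B * k)) in *.
  assert (0 <= A0 ^ 2 * k ^ 2) by (apply Rmult_le_pos; apply pow2_ge_0).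
  assert (0 <= k ^ 2) by apply pow2_ge_0.
  assert (- (A0 ^ 2 * k ^ 2) <= y / 2 * L1 <= A0 ^ 2 * k ^ 2) by (split; nra).
  assert (- (k ^ 2) <= (1 - y) / 2 * L2 <= k ^ 2) by (split; nra).
  lra.
Qed.

(** The derivative of the argument along the circle is a rational function of
    k = 1 - cos t.  It vanishes at k = 0 because 1 / U^+ is a critical point, so it is at most a
    constant times k, which is quadratic in t. *)
Lemma arc_phase p q d y z v w N t :
  roots p q d y z v w -> 0 < N -> 0 <= t <= 1 / 4 ->
  let a := hang p q (y * N) ((1 - y) * N) (z * N) (- ln v) in
  Rabs (a (PI - t) - a PI) <= N * ((2 / d ^ 3 + 1) * t ^ 3).
Proof.
  intros H HN Ht a. pose proof PI2_1 as HPI1.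
  destruct (roots_facts _ _ _ _ _ _ _ H) as (F0 & F1 & F2 & F3 & F4 & F5 & F6 & ES & _).
  destruct H as ((Hp & Hq & Hpq) & Hd & Hz & Hy & E1 & E2 & Hv & Hvw & Hw).
  unfold a. set (S := - ln v).
  assert (HE : exp S = / v) by (unfold S; rewrite exp_Ropp, exp_ln by assumption; reflexivity).
  set (f := fun u => hang p q (y * N) ((1 - y) * N) (z * N) S (PI - u)).
  set (X1 := fun u => Zx q S (PI - u)). set (Y1 := fun u => Zy q S (PI - u)).
  set (X2 := fun u => Zx (- p) S (PI - u)). set (Y2 := fun u => Zy p S (PI - u)).
  set (df := fun u => y * N * ((X1 u * (q / v * cos u) - Y1 u * (q / v * sin u)) / (X1 u ^ 2 + Y1 u ^ 2))
     - (1 - y) * N * ((X2 u * (p / v * cos u) - Y2 u * (- p / v * sin u)) / (X2 u ^ 2 + Y2 u ^ 2)) + z * N).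
  assert (Dx : forall c u, is_derive (fun u => Zx c S (PI - u)) u (c / v * sin u)).
  { intros c u. unfold Zx. rewrite HE. auto_derive; [trivial|].
    fold (PI - u). rewrite sin_PI_x. field. lra. }
  assert (Dy : forall c u, is_derive (fun u => Zy c S (PI - u)) u (c / v * cos u)).
  { intros c u. unfold Zy. rewrite HE. auto_derive; [trivial|].
    fold (PI - u). rewrite Rtrigo_facts.cos_pi_minus. field. lra. }
  assert (Py : forall c u, 0 < c -> 0 < u < t -> 0 < Zy c S (PI - u)).
  { intros c u Hc Hu. unfold Zy. rewrite sin_PI_x.
    assert (0 < sin u) by (apply sin_gt_0; lra). pose proof (exp_pos S).
    repeat apply Rmult_lt_0_compat; assumption. }
  destruct (MVT_gen f 0 t df) as [c [Hc E]].
  - rewrite Rmin_left, Rmax_right by lra. intros u Hu.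
    assert (g1 := is_derive_arg _ _ _ _ _ (Dx q u) (Dy q u) (Py q u ltac:(lra) Hu)).
    assert (g2 := is_derive_arg _ _ _ _ _ (Dx (- p) u) (Dy p u) (Py p u ltac:(lra) Hu)).
    cbv beta in g1, g2.
    set (A1 := fun u => arg (Zx q S (PI - u)) (Zy q S (PI - u))) in *.
    set (A2 := fun u => arg (Zx (- p) S (PI - u)) (Zy p S (PI - u))) in *.
    change (is_derive (fun u => y * N * A1 u - (1 - y) * N * A2 u - z * N * (PI - u)) u (df u)).
    auto_derive.
    + repeat split; eexists; eassumption.
    + replace (Derive (fun x => A1 x) u) with
        ((Zx q S (PI - u) * (q / v * cos u) - Zy q S (PI - u) * (q / v * sin u)) /
           (Zx q S (PI - u) ^ 2 + Zy q S (PI - u) ^ 2))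
        by (symmetry; exact (is_derive_unique A1 u _ g1)).
      replace (Derive (fun x => A2 x) u) with
        ((Zx (- p) S (PI - u) * (p / v * cos u) - Zy p S (PI - u) * (- p / v * sin u)) /
           (Zx (- p) S (PI - u) ^ 2 + Zy p S (PI - u) ^ 2))
        by (symmetry; exact (is_derive_unique A2 u _ g2)).
      unfold df, X1, Y1, X2, Y2. ring.
  - rewrite Rmin_left, Rmax_right by lra. intros u Hu.
    assert (CA : forall c d, 0 < d -> (u = 0 -> Zx c S (PI - u) <> 0) ->
       continuity_pt (fun u => arg (Zx c S (PI - u)) (Zy d S (PI - u))) u).
    { intros c0 d0 Hd0 H0. apply continuity_pt_filterlim.
      apply (continuous_comp (fun u => PI - u) (fun v => arg (Zx c0 S v) (Zy d0 S v))).
      - apply cont_of_ex_derive. now auto_derive.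
      - apply (continuous_2d_snd (fun s v => arg (Zx c0 s v) (Zy d0 s v)) S).
        apply continuity_2d_pt_comp2; [|apply Zx_cont|apply Zy_cont].
        apply arg_cont. destruct (Req_dec u 0) as [Hu0|Hu0]; [left; auto|right].
        apply Rgt_not_eq. unfold Zy. rewrite sin_PI_x.
        assert (0 < sin u) by (apply sin_gt_0; lra). pose proof (exp_pos S).
        repeat apply Rmult_lt_0_compat; assumption. }
    unfold f, hang.
    apply continuity_pt_minus; [apply continuity_pt_minus|].
    + apply (continuity_pt_scal (fun u => arg (Zx q S (PI - u)) (Zy q S (PI - u))) (y * N)).
      apply CA; [lra|]. intros ->. rewrite Rminus_0_r, Zx_PI, HE.
      apply Rlt_not_eq. apply Rlt_minus, (Rmult_lt_reg_r v); [assumption|].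
      rewrite Rmult_assoc, Rinv_l; lra.
    + apply (continuity_pt_scal (fun u => arg (Zx (- p) S (PI - u)) (Zy p S (PI - u))) ((1 - y) * N)).
      apply CA; [lra|]. intros ->. rewrite Rminus_0_r, Zx_PI, HE.
      pose proof (Rinv_0_lt_compat v F1). nra.
    + apply ex_derive_continuity_pt. now auto_derive.
  - rewrite Rmin_left, Rmax_right in Hc by lra.
    unfold f in E. rewrite Rminus_0_r in E. rewrite E, Rminus_0_r.
    set (k := 1 - cos c).
    pose proof (versine_bounds c ltac:(lra)) as HV. apply Rabs_le_between in HV.
    fold k in HV.
    assert (Hc2 : 0 <= c ^ 2 <= 1 / 4 * c) by nra.
    assert (Hc3 : 0 <= c ^ 3 <= 1 / 4 * c ^ 2) by (split; [apply pow_le; lra|nra]).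
    assert (Hk : 0 <= k <= c ^ 2).
    { pose proof (COS_bound c). unfold k in *. split; lra. }
    assert (Hk1 : k <= 1 / 2) by nra.
    assert (Hsc := sin2_cos2 c). unfold Rsqr in Hsc.
    assert (W1 : 0 < (q - v) ^ 2 + 2 * q * v * k).
    { assert (0 < (q - v) ^ 2) by (apply pow_lt; lra).
      assert (0 <= 2 * q * v * k) by (repeat apply Rmult_le_pos; lra). lra. }
    assert (Wpv : 0 < p * v) by (apply Rmult_lt_0_compat; lra).
    assert (W2 : (p + v) ^ 2 / 2 <= (p + v) ^ 2 - 2 * p * v * k).
    { pose proof (pow2_ge_0 (p - v)). nra. }
    assert (Wp : 0 < (p + v) ^ 2) by (apply pow_lt; lra).
    assert (Edf : df c = N * (y * (q * v * k * (q + v) / ((q - v) * ((q - v) ^ 2 + 2 * q * v * k)))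
        - (1 - y) * (p * v * k * (p - v) / ((p + v) * ((p + v) ^ 2 - 2 * p * v * k))))).
    { assert (T1 : (X1 c * (q / v * cos c) - Y1 c * (q / v * sin c)) / (X1 c ^ 2 + Y1 c ^ 2)
        = q * v * k * (q + v) / ((q - v) * ((q - v) ^ 2 + 2 * q * v * k)) - q / (q - v)).
      { unfold X1, Y1, Zx, Zy. rewrite HE, sin_PI_x, Rtrigo_facts.cos_pi_minus.
        replace (((1 + q * / v * - cos c) * (q / v * cos c) - q * / v * sin c * (q / v * sin c)))
          with (q / v * cos c - (q / v) ^ 2 * (sin c * sin c + cos c * cos c)) by (field; lra).
        replace ((1 + q * / v * - cos c) ^ 2 + (q * / v * sin c) ^ 2)
          with (1 - 2 * (q / v) * cos c + (q / v) ^ 2 * (sin c * sin c + cos c * cos c)) by (field; lra).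
        rewrite Hsc. replace (cos c) with (1 - k) by (unfold k; ring).
        replace (1 - 2 * (q / v) * (1 - k) + (q / v) ^ 2 * 1) with (((q - v) ^ 2 + 2 * q * v * k) / v ^ 2)
          by (field; lra).
        field. repeat split; lra. }
      assert (T2 : (X2 c * (p / v * cos c) - Y2 c * (- p / v * sin c)) / (X2 c ^ 2 + Y2 c ^ 2)
        = p * v * k * (p - v) / ((p + v) * ((p + v) ^ 2 - 2 * p * v * k)) + p / (p + v)).
      { unfold X2, Y2, Zx, Zy. rewrite HE, sin_PI_x, Rtrigo_facts.cos_pi_minus.
        replace (((1 + - p * / v * - cos c) * (p / v * cos c) - p * / v * sin c * (- p / v * sin c)))
          with (p / v * cos c + (p / v) ^ 2 * (sin c * sin c + cos c * cos c)) by (field; lra).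
        replace ((1 + - p * / v * - cos c) ^ 2 + (p * / v * sin c) ^ 2)
          with (1 + 2 * (p / v) * cos c + (p / v) ^ 2 * (sin c * sin c + cos c * cos c)) by (field; lra).
        rewrite Hsc. replace (cos c) with (1 - k) by (unfold k; ring).
        replace (1 + 2 * (p / v) * (1 - k) + (p / v) ^ 2 * 1) with (((p + v) ^ 2 - 2 * p * v * k) / v ^ 2)
          by (field; lra).
        field. repeat split; lra. }
      unfold df. rewrite T1, T2. rewrite <- ES at 1. field. repeat split; lra. }
    assert (B1 : 0 <= q * v * k * (q + v) / ((q - v) * ((q - v) ^ 2 + 2 * q * v * k)) <= 2 / d ^ 3 * k).
    { assert (Hd3 : 0 < d ^ 3) by (apply pow_lt; lra).
      assert (HD : d ^ 3 <= (q - v) * ((q - v) ^ 2 + 2 * q * v * k)).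
      { replace (d ^ 3) with (d * d ^ 2) by ring.
        assert (d ^ 2 <= (q - v) ^ 2) by (apply pow_incr; lra).
        assert (0 <= 2 * q * v * k) by (repeat apply Rmult_le_pos; lra).
        apply Rmult_le_compat; try lra. apply pow2_ge_0. }
      assert (HNum : 0 <= q * v * k * (q + v) <= 2 * k).
      { assert (0 <= q * v <= 1) by nra. assert (0 <= q * v * k <= k) by nra.
        split; [apply Rmult_le_pos; lra|]. rewrite (Rmult_comm 2).
        apply Rmult_le_compat; lra. }
      split.
      - apply Rmult_le_pos; [lra|]. left; apply Rinv_0_lt_compat; lra.
      - replace (2 / d ^ 3 * k) with (2 * k * / d ^ 3) by (field; lra). unfold Rdiv.
        apply Rmult_le_compat; [lra| |lra|].
        + left; apply Rinv_0_lt_compat; lra.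
        + apply Rinv_le_contravar; lra. }
    assert (B2 : Rabs (p * v * k * (p - v) / ((p + v) * ((p + v) ^ 2 - 2 * p * v * k))) <= k).
    { assert (HD : 0 < (p + v) * ((p + v) ^ 2 - 2 * p * v * k)) by (apply Rmult_lt_0_compat; lra).
      rewrite Rabs_div by lra. rewrite (Rabs_pos_eq ((p + v) * _)) by lra.
      apply (proj2 (Rle_div_l _ _ _ HD)).
      rewrite Rabs_mult, (Rabs_pos_eq (p * v * k)) by (apply Rmult_le_pos; lra).
      assert (Rabs (p - v) <= p + v) by (apply Rabs_le; lra).
      assert (p * v <= (p + v) ^ 2 / 4) by (pose proof (pow2_ge_0 (p - v)); nra).
      apply Rle_trans with (k * (p * v) * (p + v)).
      - replace (p * v * k) with (k * (p * v)) by ring. apply Rmult_le_compat_l; [apply Rmult_le_pos; lra|assumption].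
      - rewrite Rmult_assoc. apply Rmult_le_compat_l; [lra|]. rewrite Rmult_comm.
        apply Rmult_le_compat_l; lra. }
    set (G1 := q * v * k * (q + v) / ((q - v) * ((q - v) ^ 2 + 2 * q * v * k))) in *.
    set (G2 := p * v * k * (p - v) / ((p + v) * ((p + v) ^ 2 - 2 * p * v * k))) in *.
    assert (B3 : Rabs (y * G1 - (1 - y) * G2) <= (2 / d ^ 3 + 1) * c ^ 2).
    { apply Rabs_le_between in B2.
      assert (0 <= 2 / d ^ 3) by (left; apply Rdiv_lt_0_compat; [lra|apply pow_lt; lra]).
      assert (- k <= (1 - y) * G2 <= k).
      { assert (0 <= y * k) by (apply Rmult_le_pos; lra). split.
        - apply Rle_trans with ((1 - y) * - k); [lra|apply Rmult_le_compat_l; lra].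
        - apply Rle_trans with ((1 - y) * k); [apply Rmult_le_compat_l; lra|lra]. }
      assert (0 <= y * G1 <= 2 / d ^ 3 * k).
      { split; [apply Rmult_le_pos; lra|].
        apply Rle_trans with (1 * G1); [apply Rmult_le_compat_r; lra|lra]. }
      assert (2 / d ^ 3 * k <= 2 / d ^ 3 * c ^ 2) by (apply Rmult_le_compat_l; lra).
      assert (0 <= 2 / d ^ 3 * c ^ 2) by (apply Rmult_le_pos; lra).
      apply Rabs_le. lra. }
    rewrite Edf, !Rabs_mult, (Rabs_pos_eq N), (Rabs_pos_eq t), Rmult_assoc by lra.
    apply Rmult_le_compat_l; [lra|].
    assert (0 < 2 / d ^ 3) by (apply Rdiv_lt_0_compat; [lra|apply pow_lt; lra]).
    assert (c ^ 2 <= t ^ 2) by (apply pow_incr; lra).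
    replace (t ^ 3) with (t ^ 2 * t) by ring. rewrite <- Rmult_assoc.
    apply Rmult_le_compat_r; [lra|]. nra.
Qed.

Lemma arc_le p q d y z v w N nu t :
  roots p q d y z v w -> 0 < N ->
  let h := hmod p q (y * N) ((1 - y) * N) nu (- ln v) in
  h (PI - t) <= h PI * exp (- N * (curv p q z v w * (1 - cos t))).
Proof.
  intros H HN h. pose proof (curv_bounds _ _ _ _ _ _ _ H) as HK.
  destruct (roots_facts _ _ _ _ _ _ _ H) as (F0 & _). pose proof (COS_bound t).
  assert (Hh : 0 <= h PI) by apply hmod_ge0.
  destruct (arc_modulus _ _ _ _ _ _ _ N nu t H) as [[_ E]|[E1 E2]].
  - fold h in E. rewrite E. apply Rmult_le_pos; [assumption|left; apply exp_pos].
  - fold h in E2. rewrite E2. apply Rmult_le_compat_l; [assumption|]. apply exp_mono.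
    pose proof (arcexp_le _ _ _ _ _ _ _ (1 - cos t) H ltac:(lra) E1).
    replace (- N * (curv p q z v w * (1 - cos t))) with (N * (- curv p q z v w * (1 - cos t))) by ring.
    apply Rmult_le_compat_l; lra.
Qed.

Lemma hmod_real_pos p q d y z v w N nu :
  roots p q d y z v w -> 0 < hmod p q (y * N) ((1 - y) * N) nu (- ln v) PI.
Proof.
  intros H. destruct (roots_facts _ _ _ _ _ _ _ H) as (F0 & F1 & F2 & F3 & _).
  destruct H as ((Hp & Hq & Hpq) & Hd & _).
  assert (HE : exp (- ln v) = / v) by (rewrite exp_Ropp, exp_ln by assumption; reflexivity).
  unfold hmod. rewrite !Zx_PI, !Zy_PI, HE.
  assert (M : forall x X, X <> 0 -> 0 < modpow x X 0).
  { intros x X HX. unfold modpow. destruct (Req_EM_T (X ^ 2 + 0 ^ 2) 0) as [E|E].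
    - assert (0 < X ^ 2) by (apply pow2_gt_0; assumption). nra.
    - apply exp_pos. }
  repeat apply Rmult_lt_0_compat; [apply exp_pos| |]; apply M.
  - replace (1 - q * / v) with (- ((q - v) / v)) by (field; lra).
    assert (0 < (q - v) / v) by (apply Rdiv_lt_0_compat; lra). apply Rlt_not_eq; lra.
  - pose proof (Rinv_0_lt_compat v F1). apply Rgt_not_eq; nra.
Qed.

(** Only half of the Gaussian is integrated, whence the factor 1/2: the saddle point is an end
    point of the half circle. *)
Lemma arc_asymptotic p q d :
  exists C, forall N y z v w, 1 <= N -> roots p q d y z v w ->
  let h := hmod p q (y * N) ((1 - y) * N) (z * N) (- ln v) in
  let a := hang p q (y * N) ((1 - y) * N) (z * N) (- ln v) in
  Rabs (RInt (fun t => h t * cos (a t - a PI)) 0 PI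
        - h PI * (/ 2 * sqrt (2 * PI / (N * curv p q z v w)))) <= h PI * (C / N).
Proof.
  (* c is a quarter of the lower bound of the curvature; on [0, d / 4] the logarithms in arcexp
     have arguments within 1/2 of 1; M adds the errors of arcexp, of 1 - cos t and of the phase *)
  set (c := p * (p * q * d) * d / 4). set (T0 := d / 4).
  set (M := (4 / d ^ 4 + 1) + / d + (2 / d ^ 3 + 1)).
  exists (M / c ^ 2 + PI / (c * T0 ^ 2) + 2 / (sqrt c * c * T0 ^ 2)).
  intros N y z v w HN H h a.
  pose proof PI2_1 as HPI.
  pose proof (curv_bounds _ _ _ _ _ _ _ H) as HK.
  destruct (roots_facts _ _ _ _ _ _ _ H) as (F0 & F1 & F2 & F3 & F4 & F5 & F6 & _).
  pose proof H as HR.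
  destruct HR as ((Hp & Hq & Hpq) & Hd & Hz & Hy & E1 & E2 & Hv & Hvw & Hw).
  assert (Hc : 0 < c) by (unfold c; repeat apply Rmult_lt_0_compat; lra).
  set (k := curv p q z v w) in *.
  assert (Hk4 : 4 * c <= k) by (unfold c; lra).
  assert (HT0 : 0 < T0 <= 1 / 4) by (unfold T0; lra).
  assert (HhP : 0 < h PI) by (apply (hmod_real_pos _ _ _ _ _ _ _ _ _ H)).
  assert (D3 : 0 < 2 / d ^ 3) by (apply Rdiv_lt_0_compat; [lra|apply pow_lt; lra]).
  assert (D4 : 0 < 4 / d ^ 4) by (apply Rdiv_lt_0_compat; [lra|apply pow_lt; lra]).
  assert (D1 : 0 < / d) by (apply Rinv_0_lt_compat; lra).
  assert (Hx : 0 < y * N) by (apply Rmult_lt_0_compat; lra).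
  assert (Ha : 0 < (1 - y) * N) by (apply Rmult_lt_0_compat; lra).
  set (f := fun t => / h PI * (h (PI - t) * cos (a (PI - t) - a PI))).
  assert (CF0 : forall t, continuous (fun t => h t * cos (a t - a PI)) t).
  { intros t. destruct (h_cont_pos p q (y * N) ((1 - y) * N) (z * N) (- ln v) t Hx Ha) as [CR CI].
    apply (continuous_ext (fun t => plus (cos (a PI) * hre p q (y * N) ((1 - y) * N) (z * N) (- ln v) t)
       (sin (a PI) * him p q (y * N) ((1 - y) * N) (z * N) (- ln v) t))).
    - intros u. unfold plus; simpl. rewrite cos_minus. unfold hre, him, h, a. ring.
    - apply (continuous_plus (V := R_NormedModule)).
      + apply (continuous_scal_r (K := R_AbsRing) (V := R_NormedModule)). apply continuous_2d_snd, CR.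
      + apply (continuous_scal_r (K := R_AbsRing) (V := R_NormedModule)). apply continuous_2d_snd, CI. }
  assert (CF : forall t, continuous (fun t => h (PI - t) * cos (a (PI - t) - a PI)) t).
  { intros t. apply (continuous_comp (fun t => PI - t) (fun t => h t * cos (a t - a PI))); [|apply CF0].
    apply cont_of_ex_derive. now auto_derive. }
  rewrite RInt_reflect by (intros; apply CF0 || lra).
  assert (EI : RInt (fun t => h (PI - t) * cos (a (PI - t) - a PI)) 0 PI = h PI * RInt f 0 PI).
  { unfold f. rewrite RInt_mulc; [now rewrite <- Rmult_assoc, Rinv_r, Rmult_1_l by lra|].
    apply ex_RInt_cont; [lra|]. intros; apply CF. }
  rewrite EI, <- Rmult_minus_distr_l, Rabs_mult, (Rabs_pos_eq (h PI)) by lra.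
  apply Rmult_le_compat_l; [lra|].
  assert (VB : forall t, 0 <= t <= T0 -> Rabs (1 - cos t - t ^ 2 / 2) <= t ^ 3 /\
     t ^ 2 / 4 <= 1 - cos t <= t ^ 2 /\ 0 <= t ^ 2 /\ t ^ 2 <= d / 4 * (1 / 4) /\ 0 <= t ^ 3 /\ (1 - cos t) ^ 2 <= t ^ 3).
  { intros t Ht. pose proof (versine_bounds t ltac:(lra)) as HV. split; [exact HV|].
    apply Rabs_le_between in HV.
    assert (0 <= t ^ 2) by apply pow2_ge_0.
    assert (t ^ 3 <= 1 / 4 * t ^ 2) by nra.
    assert (0 <= t ^ 3) by (apply pow_le; lra).
    assert (t ^ 2 <= d / 4 * (1 / 4)) by (unfold T0 in *; nra).
    repeat split; try lra.
    apply Rle_trans with ((t ^ 2) ^ 2); [apply pow_incr; lra|].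
    replace ((t ^ 2) ^ 2) with (t * t ^ 3) by ring. nra. }
  apply (laplace_half N k M c T0 PI PI f (fun t => arcexp p q y v (1 - cos t))
            (fun t => (a (PI - t) - a PI) / N)); try lra.
  - unfold M. lra.
  - intros t _. apply (continuous_scal_r (K := R_AbsRing) (V := R_NormedModule)
      (/ h PI) (fun t => h (PI - t) * cos (a (PI - t) - a PI))), CF.
  - intros t Ht. destruct (VB t Ht) as (V1 & V2 & V3 & V4 & V5 & _).
    destruct (arc_rate_bounds p q d v Hp Hq ltac:(lra) ltac:(lra) F3) as [HA HB].
    destruct (arc_modulus _ _ _ _ _ _ _ N (z * N) t H) as [[E _]|[_ E]]; [exfalso; nra|].
    fold h in E. unfold f. rewrite E.
    replace (N * ((a (PI - t) - a PI) / N)) with (a (PI - t) - a PI) by (field; lra).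
    rewrite <- !Rmult_assoc, Rinv_l, Rmult_1_l by lra. reflexivity.
  - intros t Ht. destruct (VB t Ht) as (V1 & V2 & V3 & V4 & V5 & V6).
    assert (HQ : Rabs (arcexp p q y v (1 - cos t) + k * (1 - cos t)) <= (4 / d ^ 4 + 1) * (1 - cos t) ^ 2).
    { apply (arcexp_quadratic _ _ _ _ _ _ _ _ H); try lra.
      apply Rle_trans with (2 / d ^ 2 * t ^ 2).
      - apply Rmult_le_compat_l; [|lra]. left; apply Rdiv_lt_0_compat; [lra|apply pow_lt; lra].
      - apply Rle_trans with (2 / d ^ 2 * (d / 4) ^ 2).
        + apply Rmult_le_compat_l; [left; apply Rdiv_lt_0_compat; [lra|apply pow_lt; lra]|].
          apply pow_incr. unfold T0 in Ht. lra.
        + replace (2 / d ^ 2 * (d / 4) ^ 2) with (1 / 8) by (field; lra). lra. }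
    assert (HQ2 : (4 / d ^ 4 + 1) * (1 - cos t) ^ 2 <= (4 / d ^ 4 + 1) * t ^ 3)
      by (apply Rmult_le_compat_l; lra).
    assert (HQ3 : Rabs (k * (t ^ 2 / 2 - (1 - cos t))) <= / d * t ^ 3).
    { rewrite Rabs_mult, (Rabs_pos_eq k), Rabs_minus_sym by lra.
      apply Rmult_le_compat; try lra. apply Rabs_pos. }
    replace (arcexp p q y v (1 - cos t) + k * t ^ 2 / 2) with
      (arcexp p q y v (1 - cos t) + k * (1 - cos t) + k * (t ^ 2 / 2 - (1 - cos t))) by field.
    eapply Rle_trans; [apply Rabs_triang|]. unfold M.
    rewrite !Rmult_plus_distr_r. rewrite !Rmult_plus_distr_r in HQ2.
    assert (0 <= 2 / d ^ 3 * t ^ 3) by (apply Rmult_le_pos; lra). lra.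
  - intros t Ht. destruct (VB t Ht) as (V1 & V2 & V3 & V4 & V5 & V6).
    destruct (arc_rate_bounds p q d v Hp Hq ltac:(lra) ltac:(lra) F3) as [HA HB].
    assert (Hpos : 0 < 1 - 2 * p * v / (p + v) ^ 2 * (1 - cos t)) by nra.
    pose proof (arcexp_le _ _ _ _ _ _ _ (1 - cos t) H ltac:(lra) Hpos) as L. fold k in L.
    assert (4 * c * (t ^ 2 / 4) <= k * (1 - cos t)) by (apply Rmult_le_compat; lra). lra.
  - intros t Ht. destruct (VB t Ht) as (V1 & V2 & V3 & V4 & V5 & V6).
    pose proof (arc_phase p q d y z v w N t H ltac:(lra) ltac:(lra)) as HP. cbv zeta in HP. fold a in HP.
    unfold Rdiv at 1. rewrite Rabs_mult, (Rabs_pos_eq (/ N)) by (left; apply Rinv_0_lt_compat; lra).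
    apply (Rmult_le_reg_r N); [lra|]. rewrite Rmult_assoc, Rinv_l, Rmult_1_r by lra.
    eapply Rle_trans; [exact HP|]. rewrite Rmult_comm. apply Rmult_le_compat_r; [lra|].
    apply Rmult_le_compat_r; [lra|]. unfold M. lra.
  - intros t Ht. destruct (VB T0 ltac:(lra)) as (_ & V2 & _).
    assert (Hcos : cos t <= cos T0) by (apply cos_decr_1; lra).
    pose proof (arc_le _ _ _ _ _ _ _ N (z * N) t H ltac:(lra)) as HA. cbv zeta in HA. fold h k in HA.
    assert (Hh0 : 0 <= h (PI - t)) by apply hmod_ge0.
    unfold f. rewrite !Rabs_mult, (Rabs_pos_eq (/ h PI)), (Rabs_pos_eq (h (PI - t)))
      by (try assumption; left; now apply Rinv_0_lt_compat).
    apply (Rmult_le_reg_l (h PI)); [assumption|].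
    rewrite <- Rmult_assoc, Rinv_r, Rmult_1_l by lra.
    apply Rle_trans with (h (PI - t) * 1).
    { apply Rmult_le_compat_l; [assumption|]. apply Rabs_cos_le. }
    rewrite Rmult_1_r. eapply Rle_trans; [exact HA|].
    apply Rmult_le_compat_l; [lra|]. apply exp_mono.
    assert (4 * c * (T0 ^ 2 / 4) <= k * (1 - cos t)).
    { apply Rmult_le_compat; lra. }
    nra.
Qed.

(** * The cut and the second saddle point *)

(** The value of ln |h(- e^s)| / N beyond the branch point - 1 / q, followed by its
    derivatives in s. *)
Definition segexp (p q y z s : R) : R :=
  y * ln (q * exp s - 1) + (1 - y) * ln (1 + p * exp s) - z * s.
Definition segexp1 (p q y z s : R) : R :=
  y * (q * exp s / (q * exp s - 1)) + (1 - y) * (p * exp s / (1 + p * exp s)) - z.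
Definition segexp2 (p q y s : R) : R :=
  (1 - y) * (p * exp s / (1 + p * exp s) ^ 2) - y * (q * exp s / (q * exp s - 1) ^ 2).
Definition segexp3 (p q y s : R) : R :=
  y * (q * exp s * (q * exp s + 1) / (q * exp s - 1) ^ 3)
  + (1 - y) * (p * exp s * (1 - p * exp s) / (1 + p * exp s) ^ 3).

Lemma segexp_derive p q y z s : 0 < p -> 1 < q * exp s ->
  is_derive (segexp p q y z) s (segexp1 p q y z s) /\
  is_derive (segexp1 p q y z) s (segexp2 p q y s) /\
  is_derive (segexp2 p q y) s (segexp3 p q y s).
Proof.
  intros Hp H. pose proof (exp_pos s).
  assert (0 < p * exp s) by now apply Rmult_lt_0_compat.
  assert (H3 : q * exp s + - (1) <> 0) by lra.
  assert (H4 : 1 + p * exp s <> 0) by lra.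
  split; [|split].
  - unfold segexp, segexp1. auto_derive; [repeat split; lra|]. field. split; lra.
  - unfold segexp1, segexp2. auto_derive; [repeat split; assumption|]. field. split; lra.
  - unfold segexp2, segexp3. auto_derive.
    + repeat split; apply Rgt_not_eq; nra.
    + field. split; lra.
Qed.

Lemma modpow_real x X : 0 < Rabs X -> modpow x X 0 = exp (x * ln (Rabs X)).
Proof.
  intros H. unfold modpow.
  assert (E : X ^ 2 + 0 ^ 2 = Rabs X * Rabs X).
  { rewrite <- Rabs_mult, Rabs_pos_eq by apply Rle_0_sqr. ring. }
  rewrite E. destruct (Req_EM_T _ 0); [nra|]. rewrite ln_mult by assumption. f_equal. field.
Qed.

Lemma hmod_left_cut p q y z N s : 0 < p -> 1 < q * exp s ->
  hmod p q (y * N) ((1 - y) * N) (z * N) s PI = exp (N * segexp p q y z s).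
Proof.
  intros Hp H. pose proof (exp_pos s).
  assert (0 < p * exp s) by now apply Rmult_lt_0_compat.
  unfold hmod. rewrite !Zx_PI, !Zy_PI.
  replace (1 - - p * exp s) with (1 + p * exp s) by ring.
  assert (A1 : Rabs (1 - q * exp s) = q * exp s - 1) by (rewrite Rabs_left; lra).
  assert (A2 : Rabs (1 + p * exp s) = 1 + p * exp s) by (rewrite Rabs_pos_eq; lra).
  rewrite !modpow_real by (rewrite ?A1, ?A2; lra). rewrite A1, A2, <- !exp_plus.
  f_equal. unfold segexp. ring.
Qed.

Lemma hmod_right_cut p q y z N s : 0 < q -> 1 < p * exp s ->
  hmod p q (y * N) ((1 - y) * N) (z * N) s 0
  = exp (N * (y * ln (1 + q * exp s) + (1 - y) * ln (p * exp s - 1) - z * s)).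
Proof.
  intros Hq H. pose proof (exp_pos s).
  assert (0 < q * exp s) by now apply Rmult_lt_0_compat.
  unfold hmod. rewrite !Zx_0, !Zy_0.
  replace (1 + - p * exp s) with (1 - p * exp s) by ring.
  assert (A1 : Rabs (1 - p * exp s) = p * exp s - 1) by (rewrite Rabs_left; lra).
  assert (A2 : Rabs (1 + q * exp s) = 1 + q * exp s) by (rewrite Rabs_pos_eq; lra).
  rewrite !modpow_real by (rewrite ?A1, ?A2; lra). rewrite A1, A2, <- !exp_plus.
  f_equal. ring.
Qed.

(** The sign of the derivative is read off: the critical points are s = - ln w and s = - ln v. *)
Lemma segexp1_factor p q d y z v w s : roots p q d y z v w -> 1 < q * exp s ->
  segexp1 p q y z s
  = z * (1 - v * exp s) * (1 - w * exp s) / ((q * exp s - 1) * (1 + p * exp s)).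
Proof.
  intros ((Hp & Hq & Hpq) & Hd & Hz & Hy & E1 & E2 & _) H. pose proof (exp_pos s).
  assert (0 < p * exp s) by (apply Rmult_lt_0_compat; lra).
  unfold segexp1.
  replace (y * (q * exp s / (q * exp s - 1)) + (1 - y) * (p * exp s / (1 + p * exp s)) - z)
    with (y * q * (exp s / (q * exp s - 1)) + (1 - y) * p * (exp s / (1 + p * exp s)) - z) by (field; lra).
  rewrite E1, E2. replace q with (1 - p) in * by lra. field. lra.
Qed.

(** A bound for the third derivative of [segexp] near the maximum. *)
Definition seg_M (p q d : R) : R := 8 * (/ (p * q * d) * (/ (p * q * d) + 1)) / d ^ 3 + 1.
(** A quarter of the lower bound of the curvature in [curv_bounds_second]. *)
Definition seg_c (p q d : R) : R := p * (p * q * d) * d / 4.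
(** On a window of this length the cubic Taylor error is at most half of the quadratic term, and
    the branch points stay at a distance. *)
Definition seg_T (p q d : R) : R := Rmin (d / 4) (seg_c p q d / seg_M p q d).

Lemma seg_constants p q d : 0 < p -> 0 < q -> 0 < d ->
  0 < seg_M p q d /\ 0 < seg_c p q d /\ 0 < seg_T p q d <= d / 4 /\
  seg_M p q d * seg_T p q d <= seg_c p q d.
Proof.
  intros Hp Hq Hd.
  assert (0 < / (p * q * d)) by (apply Rinv_0_lt_compat; repeat apply Rmult_lt_0_compat; lra).
  assert (HM : 0 < seg_M p q d).
  { unfold seg_M. apply Rplus_lt_0_compat; [|lra].
    apply Rdiv_lt_0_compat; [|apply pow_lt; lra]. repeat apply Rmult_lt_0_compat; lra. }
  assert (Hc : 0 < seg_c p q d) by (unfold seg_c; repeat apply Rmult_lt_0_compat; lra).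
  repeat split; try assumption.
  - unfold seg_T. apply Rmin_glb_lt; [lra|now apply Rdiv_lt_0_compat].
  - apply Rmin_l.
  - apply Rle_trans with (seg_M p q d * (seg_c p q d / seg_M p q d)).
    + apply Rmult_le_compat_l; [lra|apply Rmin_r].
    + right. field. lra.
Qed.

(** The window stays a definite distance beyond the branch point - 1 / q, where the third
    derivative explodes, and before the minimum at s = - ln v. *)
Lemma seg_window p q d y z v w sg t : roots p q d y z v w ->
  sg = 1 \/ sg = -1 -> 0 <= t <= d / 4 ->
  1 + d / 2 <= q * exp (- ln w + sg * t) /\ exp (- ln w + sg * t) <= / v.
Proof.
  intros H Hs Ht. destruct (roots_facts _ _ _ _ _ _ _ H) as (F0 & F1 & F2 & F3 & F4 & F5 & F6 & _).
  destruct H as ((Hp & Hq & Hpq) & Hd & Hz & Hy & E1 & E2 & Hv & Hvw & Hw).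
  rewrite exp_plus, exp_Ropp, exp_ln by assumption.
  assert (L : 1 - d / 4 <= exp (sg * t) <= 1 + d).
  { split.
    - pose proof (exp_lower (sg * t)). destruct Hs as [-> | ->]; lra.
    - apply Rle_trans with (exp t); [apply exp_mono; destruct Hs as [-> | ->]; lra|].
      eapply Rle_trans; [apply exp_small_upper; lra|].
      apply (Rmult_le_reg_r (1 - t)); [lra|]. rewrite Rinv_l by lra. nra. }
  assert (Hiw : 0 < / w) by now apply Rinv_0_lt_compat.
  split.
  - assert (1 + d <= q * / w).
    { apply (Rmult_le_reg_r w); [assumption|]. rewrite Rmult_assoc, Rinv_l by lra. nra. }
    rewrite <- Rmult_assoc. apply Rle_trans with ((1 + d) * (1 - d / 4)); [nra|].
    apply Rmult_le_compat; lra.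
  - apply Rle_trans with (/ w * (1 + d)); [apply Rmult_le_compat_l; lra|].
    apply (Rmult_le_reg_r (w * v)); [now apply Rmult_lt_0_compat|].
    replace (/ w * (1 + d) * (w * v)) with ((1 + d) * v) by (field; lra).
    replace (/ v * (w * v)) with w by (field; lra). nra.
Qed.

Lemma segexp3_bound p q d y E0 : 0 < p < 1 -> 0 < q < 1 -> 0 < d < 1 -> 0 <= y <= 1 ->
  1 + d / 2 <= q * exp E0 -> exp E0 <= / (p * q * d) ->
  Rabs (segexp3 p q y E0) <= seg_M p q d.
Proof.
  intros Hp Hq Hd Hy H1 H2. unfold segexp3, seg_M. pose proof (exp_pos E0) as HE.
  set (u := q * exp E0) in *. set (m := p * exp E0). set (Em := / (p * q * d)) in *.
  assert (Hu : u <= Em) by (unfold u; nra).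
  assert (Hm : 0 < m) by (unfold m; apply Rmult_lt_0_compat; lra).
  assert (Hu3 : (d / 2) ^ 3 <= (u - 1) ^ 3) by (apply pow_incr; lra).
  assert (Hd3 : 0 < (d / 2) ^ 3) by (apply pow_lt; lra).
  assert (B1 : 0 <= u * (u + 1) / (u - 1) ^ 3 <= 8 * (Em * (Em + 1)) / d ^ 3).
  { assert (Hnum : 0 <= u * (u + 1) <= Em * (Em + 1)) by nra.
    assert (0 < (u - 1) ^ 3) by lra.
    split.
    - apply Rmult_le_pos; [lra|]. left; now apply Rinv_0_lt_compat.
    - replace (8 * (Em * (Em + 1)) / d ^ 3) with (Em * (Em + 1) * / (d / 2) ^ 3) by (field; lra).
      unfold Rdiv. apply Rmult_le_compat; [lra|left; now apply Rinv_0_lt_compat|lra|].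
      now apply Rinv_le_contravar. }
  assert (B2 : Rabs (m * (1 - m) / (1 + m) ^ 3) <= 1).
  { assert (0 < (1 + m) ^ 3) by (apply pow_lt; lra).
    rewrite Rabs_div, (Rabs_pos_eq ((1 + m) ^ 3)) by lra.
    apply (proj2 (Rle_div_l _ _ _ H)). rewrite Rabs_mult, (Rabs_pos_eq m) by lra.
    assert (Rabs (1 - m) <= 1 + m) by (apply Rabs_le; lra).
    apply Rle_trans with (m * (1 + m)); [apply Rmult_le_compat_l; lra|]. simpl. nra. }
  set (G1 := u * (u + 1) / (u - 1) ^ 3) in *. set (G2 := m * (1 - m) / (1 + m) ^ 3) in *.
  set (Q := 8 * (Em * (Em + 1)) / d ^ 3) in *.
  apply Rabs_le_between in B2.
  assert (0 <= y * G1 <= Q).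
  { split; [apply Rmult_le_pos; lra|]. apply Rle_trans with (1 * G1); [apply Rmult_le_compat_r; lra|lra]. }
  assert (- 1 <= (1 - y) * G2 <= 1).
  { split.
    - apply Rle_trans with ((1 - y) * - (1)); [lra|apply Rmult_le_compat_l; lra].
    - apply Rle_trans with ((1 - y) * 1); [apply Rmult_le_compat_l; lra|lra]. }
  apply Rabs_le. lra.
Qed.

Lemma seg_taylor p q d y z v w sg t : roots p q d y z v w ->
  sg = 1 \/ sg = -1 -> 0 <= t <= seg_T p q d ->
  Rabs (segexp p q y z (- ln w + sg * t) - segexp p q y z (- ln w) + - curv p q z w v * t ^ 2 / 2)
  <= seg_M p q d * t ^ 3.
Proof.
  intros H Hs Ht. destruct (roots_facts _ _ _ _ _ _ _ H) as (F0 & F1 & F2 & F3 & F4 & F5 & F6 & _ & ES & _ & EK).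
  pose proof H as HR.
  destruct HR as ((Hp & Hq & Hpq) & Hd & Hz & Hy & E1 & E2 & Hv & Hvw & Hw).
  destruct (seg_constants p q d) as (HM & Hc & HT & HMT); try lra.
  assert (Hss : sg * sg = 1) by (destruct Hs as [-> | ->]; ring).
  assert (HE : exp (- ln w) = / w) by (rewrite exp_Ropp, exp_ln by assumption; reflexivity).
  assert (W : forall u, 0 <= u <= seg_T p q d -> 1 < q * exp (- ln w + sg * u)).
  { intros u Hu. destruct (seg_window _ _ _ _ _ _ _ sg u H Hs ltac:(lra)). lra. }
  assert (Dlin : forall u, is_derive (fun u => - ln w + sg * u) u sg) by (intros; auto_derive; [trivial|ring]).
  assert (T := taylor_cubic (fun u => segexp p q y z (- ln w + sg * u))
     (fun u => sg * segexp1 p q y z (- ln w + sg * u))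
     (fun u => sg * (sg * segexp2 p q y (- ln w + sg * u)))
     (fun u => sg * (sg * (sg * segexp3 p q y (- ln w + sg * u)))) (seg_T p q d) (seg_M p q d) t).
  cbv beta in T. rewrite Rmult_0_r, Rplus_0_r in T.
  replace (- curv p q z w v * t ^ 2 / 2) with (- (sg * (sg * segexp2 p q y (- ln w)) * t ^ 2 / 2)).
  - apply T; try assumption.
    + intros u Hu. apply (is_derive_comp (segexp p q y z) (fun u => - ln w + sg * u)); [|apply Dlin].
      apply (segexp_derive p q y z); [lra|now apply W].
    + intros u Hu. apply (is_derive_scal (fun u => segexp1 p q y z (- ln w + sg * u)) u sg).
      apply (is_derive_comp (segexp1 p q y z) (fun u => - ln w + sg * u)); [|apply Dlin].
      apply (segexp_derive p q y z); [lra|now apply W].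
    + intros u Hu. apply (is_derive_scal (fun u => sg * segexp2 p q y (- ln w + sg * u)) u sg).
      apply (is_derive_scal (fun u => segexp2 p q y (- ln w + sg * u)) u sg).
      apply (is_derive_comp (segexp2 p q y) (fun u => - ln w + sg * u)); [|apply Dlin].
      apply (segexp_derive p q y z); [lra|now apply W].
    + intros u Hu. rewrite !Rabs_mult.
      replace (Rabs sg) with 1 by (destruct Hs as [-> | ->]; [now rewrite Rabs_R1|rewrite Rabs_left; lra]).
      rewrite !Rmult_1_l.
      destruct (seg_window _ _ _ _ _ _ _ sg u H Hs ltac:(lra)) as [W1 W2].
      apply segexp3_bound; try lra. eapply Rle_trans; [exact W2|].
      apply Rinv_le_contravar; lra.
    + unfold segexp1. rewrite HE, <- ES.
      replace (y * (q * / w / (q * / w - 1)) + (1 - y) * (p * / w / (1 + p * / w)))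
        with (y * q / (q - w) + (1 - y) * p / (p + w)) by (field; repeat split; lra). ring.
  - rewrite <- (Rmult_assoc sg sg), Hss, EK. unfold segexp2. rewrite HE. field. repeat split; lra.
Qed.

Lemma seg_local_le p q d y z v w sg t : roots p q d y z v w ->
  sg = 1 \/ sg = -1 -> 0 <= t <= seg_T p q d ->
  segexp p q y z (- ln w + sg * t) - segexp p q y z (- ln w) <= - seg_c p q d * t ^ 2.
Proof.
  intros H Hs Ht. pose proof (seg_taylor _ _ _ _ _ _ _ _ _ H Hs Ht) as T.
  pose proof (curv_bounds_second _ _ _ _ _ _ _ H) as K.
  destruct H as ((Hp & Hq & Hpq) & Hd & _).
  destruct (seg_constants p q d) as (HM & Hc & HT & HMT); try lra.
  apply Rabs_le_between in T.
  assert (K4 : 4 * seg_c p q d <= - curv p q z w v) by (unfold seg_c; lra).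
  set (kk := - curv p q z w v) in *. set (c := seg_c p q d) in *. set (M := seg_M p q d) in *.
  assert (0 <= t ^ 2) by apply pow2_ge_0.
  assert (M * t ^ 3 <= c * t ^ 2).
  { replace (M * t ^ 3) with (M * t * t ^ 2) by ring. apply Rmult_le_compat_r; [assumption|].
    apply Rle_trans with (M * seg_T p q d); [apply Rmult_le_compat_l; lra|assumption]. }
  assert (4 * c * t ^ 2 <= kk * t ^ 2) by (apply Rmult_le_compat_r; assumption).
  lra.
Qed.

(** From the maximum s = - ln w up to the minimum s = - ln v for sg = 1, and down to the branch
    point s = - ln q, where h vanishes, for sg = -1. *)
Definition seg_len (q v w sg : R) : R := if Rlt_dec 0 sg then - ln v + ln w else - ln w + ln q.

Lemma seg_len_ge p q d y z v w sg : roots p q d y z v w -> sg = 1 \/ sg = -1 ->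
  seg_T p q d <= seg_len q v w sg <= / (p * q * d).
Proof.
  intros H Hs. destruct (roots_facts _ _ _ _ _ _ _ H) as (F0 & F1 & F2 & F3 & F4 & F5 & F6 & _).
  pose proof H as HR.
  destruct HR as ((Hp & Hq & Hpq) & Hd & Hz & Hy & E1 & E2 & Hv & Hvw & Hw).
  destruct (seg_constants p q d) as (HM & Hc & HT & HMT); try lra.
  destruct (seg_window _ _ _ _ _ _ _ sg (seg_T p q d) H Hs ltac:(lra)) as [W1 W2].
  assert (LB : forall u, 0 < u < 1 -> p * q * d <= u -> 0 < - ln u <= / (p * q * d)).
  { intros u Hu Hu2. split; [pose proof (ln_neg u Hu); lra|].
    rewrite <- ln_Rinv by lra. pose proof (ln_le_sub1 (/ u) ltac:(apply Rinv_0_lt_compat; lra)).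
    pose proof (Rinv_le_contravar _ _ F0 Hu2). lra. }
  pose proof (LB v ltac:(lra) ltac:(lra)). pose proof (LB w ltac:(lra) ltac:(lra)).
  pose proof (ln_neg q Hq). unfold seg_len.
  destruct Hs as [-> | ->]; [destruct (Rlt_dec 0 1); [|lra]|destruct (Rlt_dec 0 (-1)); [lra|]].
  - split; [|lra].
    assert (- ln w + 1 * seg_T p q d <= - ln v); [|lra].
    apply Rnot_lt_le. intros L. apply exp_increasing in L.
    rewrite (exp_Ropp (ln v)), exp_ln in L by assumption. lra.
  - split; [|lra]. pose proof (log_of_mul_exp_gt_1 q (- ln w + -1 * seg_T p q d) ltac:(lra) ltac:(lra)). lra.
Qed.

(** Outside the window |h| is monotone on either side, so it stays below its value at the end
    of the window.  At the end t = [seg_len] with sg = 1 this shows that |h(1 / U^+)| is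
    exponentially smaller than |h(1 / U^-)|. *)
Lemma seg_tail p q d y z v w N sg t : roots p q d y z v w -> 0 < N ->
  sg = 1 \/ sg = -1 -> seg_T p q d <= t <= seg_len q v w sg ->
  hmod p q (y * N) ((1 - y) * N) (z * N) (- ln w + sg * t) PI
  <= hmod p q (y * N) ((1 - y) * N) (z * N) (- ln w) PI * exp (- N * (seg_c p q d * seg_T p q d ^ 2)).
Proof.
  intros H HN Hs Ht. destruct (roots_facts _ _ _ _ _ _ _ H) as (F0 & F1 & F2 & F3 & F4 & F5 & F6 & _).
  pose proof H as HR.
  destruct HR as ((Hp & Hq & Hpq) & Hd & Hz & Hy & E1 & E2 & Hv & Hvw & Hw).
  destruct (seg_constants p q d) as (HM & Hc & HT & HMT); try lra.
  set (T := seg_T p q d) in *.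
  pose proof (seg_local_le _ _ _ _ _ _ _ _ T H Hs ltac:(unfold T in *; lra)) as HL.
  assert (W0 : 1 < q * exp (- ln w)).
  { pose proof (seg_window _ _ _ _ _ _ _ sg 0 H Hs ltac:(lra)) as [W _].
    rewrite Rmult_0_r, Rplus_0_r in W. lra. }
  assert (WT : 1 < q * exp (- ln w + sg * T)).
  { pose proof (seg_window _ _ _ _ _ _ _ sg T H Hs ltac:(lra)) as [W _]. lra. }
  assert (Hev : forall s, s <= - ln v -> v * exp s <= 1).
  { intros s Hss. now apply mul_exp_le_1. }
  assert (Hew : forall s, s <= - ln w -> w * exp s <= 1).
  { intros s Hss. now apply mul_exp_le_1. }
  assert (Hew' : forall s, - ln w <= s -> 1 <= w * exp s).
  { intros s Hss. now apply mul_exp_ge_1. }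
  assert (Hpe : forall s, 0 < p * exp s) by (intros; apply Rmult_lt_0_compat; [lra|apply exp_pos]).
  assert (G : 1 < q * exp (- ln w + sg * t) ->
     segexp p q y z (- ln w + sg * t) <= segexp p q y z (- ln w + sg * T)).
  { intros Wt. unfold seg_len in Ht. destruct Hs as [-> | ->].
    - destruct (Rlt_dec 0 1); [|lra]. apply Ropp_le_cancel.
      apply (incr_of_derive_nonneg (fun s => - segexp p q y z s) (fun s => - segexp1 p q y z s)); [lra| |].
      + intros s Hss. assert (1 < q * exp s).
        { eapply Rlt_le_trans; [exact WT|]. apply Rmult_le_compat_l; [lra|]. apply exp_mono; lra. }
        apply (is_derive_opp (K := R_AbsRing) (V := R_NormedModule)). apply segexp_derive; [lra|assumption].
      + intros s Hss. assert (W : 1 < q * exp s).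
        { eapply Rlt_le_trans; [exact WT|]. apply Rmult_le_compat_l; [lra|]. apply exp_mono; lra. }
        rewrite (segexp1_factor _ _ _ _ _ _ _ _ H W).
        pose proof (Hev s ltac:(lra)). pose proof (Hew' s ltac:(lra)). pose proof (Hpe s).
        assert (0 < (q * exp s - 1) * (1 + p * exp s)) by (apply Rmult_lt_0_compat; lra).
        replace (- (z * (1 - v * exp s) * (1 - w * exp s) / ((q * exp s - 1) * (1 + p * exp s))))
          with (z * (1 - v * exp s) * (w * exp s - 1) / ((q * exp s - 1) * (1 + p * exp s))) by (field; lra).
        apply Rmult_le_pos; [|left; now apply Rinv_0_lt_compat].
        apply Rmult_le_pos; [apply Rmult_le_pos|]; lra.
    - destruct (Rlt_dec 0 (-1)); [lra|].
      apply (incr_of_derive_nonneg (segexp p q y z) (segexp1 p q y z)); [lra| |].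
      + intros s Hss. apply segexp_derive; [lra|].
        eapply Rlt_le_trans; [exact Wt|]. apply Rmult_le_compat_l; [lra|]. apply exp_mono; lra.
      + intros s Hss. assert (W : 1 < q * exp s).
        { eapply Rlt_le_trans; [exact Wt|]. apply Rmult_le_compat_l; [lra|]. apply exp_mono; lra. }
        rewrite (segexp1_factor _ _ _ _ _ _ _ _ H W).
        pose proof (Hew s ltac:(lra)). pose proof (Hpe s).
        assert (v * exp s <= 1).
        { apply Hev. assert (ln v < ln w) by (apply ln_increasing; lra). lra. }
        assert (0 < (q * exp s - 1) * (1 + p * exp s)) by (apply Rmult_lt_0_compat; lra).
        apply Rmult_le_pos; [|left; now apply Rinv_0_lt_compat].
        apply Rmult_le_pos; [apply Rmult_le_pos|]; lra. }
  rewrite (hmod_left_cut p q y z N (- ln w)) by (lra || assumption).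
  assert (W1 : 1 <= q * exp (- ln w + sg * t)).
  { unfold seg_len in Ht. destruct Hs as [-> | ->].
    - apply Rle_trans with (q * exp (- ln w + 1 * T)); [lra|].
      apply Rmult_le_compat_l; [lra|]. apply exp_mono. lra.
    - destruct (Rlt_dec 0 (-1)); [lra|]. apply mul_exp_ge_1; lra. }
  destruct W1 as [W1|W1].
  - specialize (G W1). rewrite hmod_left_cut by (lra || assumption). rewrite <- exp_plus. apply exp_mono.
    replace (N * segexp p q y z (- ln w) + - N * (seg_c p q d * T ^ 2))
      with (N * (segexp p q y z (- ln w) - seg_c p q d * T ^ 2)) by ring.
    apply Rmult_le_compat_l; lra.
  - replace (hmod p q (y * N) ((1 - y) * N) (z * N) (- ln w + sg * t) PI) with 0.
    + apply Rmult_le_pos; left; apply exp_pos.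
    + unfold hmod. rewrite Zx_PI, Zy_PI, <- W1. rewrite (modpow_zero (y * N)) by ring. ring.
Qed.

Lemma seg_half p q d : exists C, forall N y z v w sg, 1 <= N -> roots p q d y z v w ->
  sg = 1 \/ sg = -1 ->
  let h := fun s => hmod p q (y * N) ((1 - y) * N) (z * N) s PI in
  Rabs (RInt (fun t => h (- ln w + sg * t)) 0 (seg_len q v w sg)
        - h (- ln w) * (/ 2 * sqrt (2 * PI / (N * - curv p q z w v)))) <= h (- ln w) * (C / N).
Proof.
  set (c := seg_c p q d). set (T0 := seg_T p q d). set (M := seg_M p q d).
  exists (M / c ^ 2 + / (p * q * d) / (c * T0 ^ 2) + 2 / (sqrt c * c * T0 ^ 2)).
  intros N y z v w sg HN H Hs h.
  pose proof (curv_bounds_second _ _ _ _ _ _ _ H) as HK.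
  destruct (roots_facts _ _ _ _ _ _ _ H) as (F0 & F1 & F2 & F3 & F4 & F5 & F6 & _).
  pose proof (seg_len_ge _ _ _ _ _ _ _ _ H Hs) as HLen.
  pose proof H as HR.
  destruct HR as ((Hp & Hq & Hpq) & Hd & Hz & Hy & E1 & E2 & Hv & Hvw & Hw).
  destruct (seg_constants p q d) as (HM & Hc & HT & HMT); try lra. fold c M T0 in HM, Hc, HT, HMT, HLen.
  set (k := - curv p q z w v) in *.
  assert (Hk4 : 4 * c <= k) by (unfold c, seg_c; lra).
  assert (W : forall u, 0 <= u <= T0 -> 1 < q * exp (- ln w + sg * u)).
  { intros u Hu. destruct (seg_window _ _ _ _ _ _ _ sg u H Hs ltac:(lra)). lra. }
  assert (W0 : 1 < q * exp (- ln w)).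
  { specialize (W 0 ltac:(lra)). now rewrite Rmult_0_r, Rplus_0_r in W. }
  assert (HhP : 0 < h (- ln w)).
  { unfold h. rewrite hmod_left_cut by (lra || assumption). apply exp_pos. }
  assert (Hx : 0 < y * N) by (apply Rmult_lt_0_compat; lra).
  assert (Ha : 0 < (1 - y) * N) by (apply Rmult_lt_0_compat; lra).
  assert (CF : forall t, continuous (fun t => h (- ln w + sg * t)) t).
  { intros t. apply (continuous_comp (fun t => - ln w + sg * t) h).
    - apply cont_of_ex_derive. now auto_derive.
    - unfold h. apply (continuous_2d_fst (hmod p q (y * N) ((1 - y) * N) (z * N))). now apply hmod_cont. }
  set (f := fun t => / h (- ln w) * h (- ln w + sg * t)).
  assert (EI : RInt (fun t => h (- ln w + sg * t)) 0 (seg_len q v w sg)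
     = h (- ln w) * RInt f 0 (seg_len q v w sg)).
  { unfold f. rewrite RInt_mulc; [now rewrite <- Rmult_assoc, Rinv_r, Rmult_1_l by lra|].
    apply ex_RInt_cont; [lra|]. intros; apply CF. }
  rewrite EI, <- Rmult_minus_distr_l, Rabs_mult, (Rabs_pos_eq (h (- ln w))) by lra.
  apply Rmult_le_compat_l; [lra|].
  apply (laplace_half N k M c T0 (seg_len q v w sg) (/ (p * q * d)) f
     (fun t => segexp p q y z (- ln w + sg * t) - segexp p q y z (- ln w)) (fun _ => 0)); try lra.
  - intros t _. apply (continuous_scal_r (K := R_AbsRing) (V := R_NormedModule)
      (/ h (- ln w)) (fun t => h (- ln w + sg * t))), CF.
  - intros t Ht. unfold f, h. rewrite !hmod_left_cut by (try lra; auto).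
    rewrite Rmult_0_r, cos_0, Rmult_1_r, <- exp_Ropp, <- exp_plus. f_equal. ring.
  - intros t Ht. exact (seg_taylor _ _ _ _ _ _ _ _ _ H Hs Ht).
  - intros t Ht. exact (seg_local_le _ _ _ _ _ _ _ _ _ H Hs Ht).
  - intros t Ht. rewrite Rabs_R0. apply Rmult_le_pos; [lra|apply pow_le; lra].
  - intros t Ht. assert (Hh0 : 0 <= h (- ln w + sg * t)) by apply hmod_ge0.
    unfold f. rewrite Rabs_mult, !Rabs_pos_eq by (try assumption; left; now apply Rinv_0_lt_compat).
    apply (Rmult_le_reg_l (h (- ln w))); [assumption|].
    rewrite <- Rmult_assoc, Rinv_r, Rmult_1_l by lra.
    exact (seg_tail _ _ _ _ _ _ _ N sg t H ltac:(lra) Hs Ht).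
Qed.

Lemma RInt_affine (f : R -> R) a sg T :
  (forall s, continuous f s) -> RInt (fun t => sg * f (a + sg * t)) 0 T = RInt f a (a + sg * T).
Proof.
  intros Hf. transitivity (RInt f (a + sg * 0) (a + sg * T)); [|now rewrite Rmult_0_r, Rplus_0_r].
  apply (RInt_comp (V := R_CompleteNormedModule) f (fun t => a + sg * t) (fun _ => sg)).
  - intros; apply Hf.
  - intros t _. split; [auto_derive; [trivial|ring]|apply continuous_const].
Qed.

Lemma seg_asymptotic p q d : exists C, forall N y z v w, 1 <= N -> roots p q d y z v w ->
  let h := fun s => hmod p q (y * N) ((1 - y) * N) (z * N) s PI in
  Rabs (RInt h (- ln q) (- ln v)
        - h (- ln w) * sqrt (2 * PI / (N * - curv p q z w v))) <= h (- ln w) * (C / N).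
Proof.
  destruct (seg_half p q d) as [C HC]. exists (2 * C). intros N y z v w HN H h.
  pose proof (HC N y z v w 1 HN H (or_introl eq_refl)) as A1.
  pose proof (HC N y z v w (-1) HN H (or_intror eq_refl)) as A2.
  cbv zeta in A1, A2. fold h in A1, A2.
  pose proof (seg_len_ge _ _ _ _ _ _ _ 1 H (or_introl eq_refl)) as L1.
  pose proof (seg_len_ge _ _ _ _ _ _ _ (-1) H (or_intror eq_refl)) as L2.
  destruct H as ((Hp & Hq & Hpq) & Hd & Hz & Hy & _).
  destruct (seg_constants p q d) as (_ & _ & HT & _); try lra.
  assert (Hx : 0 < y * N) by (apply Rmult_lt_0_compat; lra).
  assert (Ha : 0 < (1 - y) * N) by (apply Rmult_lt_0_compat; lra).
  assert (CH : forall s, continuous h s).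
  { intros s. unfold h. apply (continuous_2d_fst (hmod p q (y * N) ((1 - y) * N) (z * N))). now apply hmod_cont. }
  pose proof (RInt_affine h (- ln w) 1 (seg_len q v w 1) CH) as R1.
  pose proof (RInt_affine h (- ln w) (-1) (seg_len q v w (-1)) CH) as R2.
  assert (CC : forall sg t, continuous (fun t => h (- ln w + sg * t)) t).
  { intros sg t. apply (continuous_comp (fun t => - ln w + sg * t) h); [|apply CH].
    apply cont_of_ex_derive. now auto_derive. }
  rewrite RInt_mulc in R1 by (apply ex_RInt_cont; [lra|intros; apply CC]).
  rewrite RInt_mulc in R2 by (apply ex_RInt_cont; [lra|intros; apply CC]).
  unfold seg_len in *. destruct (Rlt_dec 0 1); [|lra]. destruct (Rlt_dec 0 (-1)); [lra|].
  replace (- ln w + 1 * (- ln v + ln w)) with (- ln v) in R1 by ring.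
  replace (- ln w + -1 * (- ln w + ln q)) with (- ln q) in R2 by ring.
  assert (SW : - RInt h (- ln w) (- ln q) = RInt h (- ln q) (- ln w)).
  { apply (opp_RInt_swap (V := R_CompleteNormedModule)). apply ex_RInt_swap, ex_RInt_cont; [lra|auto]. }
  assert (SP : RInt h (- ln q) (- ln v) = RInt h (- ln q) (- ln w) + RInt h (- ln w) (- ln v)).
  { apply RInt_split; [lra|]. apply ex_RInt_cont; [lra|auto]. }
  replace (2 * C / N) with (C / N + C / N) by (unfold Rdiv; ring).
  apply Rabs_le_between in A1. apply Rabs_le_between in A2. apply Rabs_le. lra.
Qed.

(** * The asymptotic form of the coefficients *)

(** On the positive axis beyond 1 / p the modulus of h increases, and at the end of the half
    circle of radius 1 / v it is at most the value at the other end. *)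
Lemma hmod_right_cut_le p q d y z v w N s : roots p q d y z v w -> 0 < N ->
  s <= - ln v -> 1 < p * exp s ->
  hmod p q (y * N) ((1 - y) * N) (z * N) s 0
  <= hmod p q (y * N) ((1 - y) * N) (z * N) (- ln v) PI.
Proof.
  intros H HN Hs Hps. pose proof (curv_bounds _ _ _ _ _ _ _ H) as HK.
  pose proof (arc_le _ _ _ _ _ _ _ N (z * N) PI H HN) as HA. cbv zeta in HA.
  destruct (roots_facts _ _ _ _ _ _ _ H) as (F0 & F1 & F2 & _).
  destruct H as ((Hp & Hq & Hpq) & Hd & Hz & Hy & E1 & E2 & Hv & Hvw & Hw).
  rewrite Rminus_diag, cos_PI in HA.
  assert (W : forall u, s <= u -> 1 < p * exp u).
  { intros u Hu. eapply Rlt_le_trans; [exact Hps|]. apply Rmult_le_compat_l; [lra|]. now apply exp_mono. }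
  assert (HS : hmod p q (y * N) ((1 - y) * N) (z * N) s 0
     <= hmod p q (y * N) ((1 - y) * N) (z * N) (- ln v) 0).
  { rewrite !hmod_right_cut by (try lra; apply W; lra). apply exp_mono, Rmult_le_compat_l; [lra|].
    apply (incr_of_derive_nonneg (fun s => y * ln (1 + q * exp s) + (1 - y) * ln (p * exp s - 1) - z * s)
       (fun s => y * q * (exp s / (1 + q * exp s)) + (1 - y) * p * (exp s / (p * exp s - 1)) - z)); [assumption| |].
    - intros u Hu. pose proof (W u ltac:(lra)).
      assert (0 < q * exp u) by (apply Rmult_lt_0_compat; [lra|apply exp_pos]).
      auto_derive; [repeat split; lra|]. field. split; lra.
    - intros u Hu. pose proof (W u ltac:(lra)) as Wu. pose proof (exp_pos u) as Eu.
      assert (0 < q * exp u) by (apply Rmult_lt_0_compat; lra).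
      assert (0 < v * exp u) by (apply Rmult_lt_0_compat; lra).
      assert (0 < w * exp u) by (apply Rmult_lt_0_compat; lra).
      rewrite E1, E2.
      replace (z * (q - v) * (q - w) * (exp u / (1 + q * exp u)) +
        z * (p + v) * (p + w) * (exp u / (p * exp u - 1)) - z)
       with (z * (1 + v * exp u) * (1 + w * exp u) / ((1 + q * exp u) * (p * exp u - 1))).
      + assert (0 < (1 + q * exp u) * (p * exp u - 1)) by (apply Rmult_lt_0_compat; lra).
        apply Rmult_le_pos; [|left; now apply Rinv_0_lt_compat].
        apply Rmult_le_pos; [apply Rmult_le_pos|]; lra.
      + replace q with (1 - p) in * by lra. field. lra. }
  eapply Rle_trans; [exact HS|]. eapply Rle_trans; [exact HA|].
  rewrite <- (Rmult_1_r (hmod _ _ _ _ _ _ PI)) at 2.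
  apply Rmult_le_compat_l; [apply hmod_ge0|]. apply exp_le_1.
  assert (0 < p * (p * q * d) * d) by (repeat apply Rmult_lt_0_compat; lra).
  assert (0 <= N * curv p q z v w) by (apply Rmult_le_pos; lra). lra.
Qed.

(** The Laplace value is of order h / sqrt N, so an absolute error of order h / N is a relative
    error of order 1 / sqrt N. *)
Lemma relative_error X h N k K C : 0 < h -> 1 <= N -> 0 < k <= K -> 0 <= C ->
  Rabs (X - h * sqrt (2 * PI / (N * k))) <= h * (C / N) ->
  exists e, Rabs e <= C * sqrt K / sqrt N /\ X = h * sqrt (2 * PI / (N * k)) * (1 + e).
Proof.
  intros Hh HN Hk HC H. pose proof PI2_1 as HP.
  assert (HNk : 0 < N * k) by (apply Rmult_lt_0_compat; lra).
  assert (Hg : 0 < sqrt (2 * PI / (N * k))) by (apply sqrt_lt_R0, Rdiv_lt_0_compat; lra).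
  set (g := sqrt (2 * PI / (N * k))) in *.
  exists ((X - h * g) / (h * g)). split; [|field; lra].
  assert (Hhg : 0 < h * g) by now apply Rmult_lt_0_compat.
  assert (HsN : 0 < sqrt N) by (apply sqrt_lt_R0; lra).
  assert (HsN2 : sqrt N * sqrt N = N) by (apply sqrt_sqrt; lra).
  assert (G : 1 <= g * (sqrt N * sqrt K)).
  { unfold g. rewrite <- sqrt_mult, <- sqrt_mult by (try lra; try (apply Rlt_le, Rdiv_lt_0_compat; lra); nra).
    rewrite <- sqrt_1 at 1. apply sqrt_le_1_alt.
    apply (Rmult_le_reg_r (N * k)); [assumption|].
    replace (2 * PI / (N * k) * (N * K) * (N * k)) with (2 * PI * (N * K)) by (field; lra).
    assert (N * k <= N * K) by (apply Rmult_le_compat_l; lra). nra. }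
  rewrite Rabs_div, (Rabs_pos_eq (h * g)) by lra.
  apply (proj2 (Rle_div_l _ _ _ Hhg)). eapply Rle_trans; [exact H|].
  replace (C * sqrt K / sqrt N * (h * g)) with (h * (C / N) * (g * (sqrt N * sqrt K))).
  - rewrite <- (Rmult_1_r (h * (C / N))) at 1. apply Rmult_le_compat_l; [|exact G].
    apply Rmult_le_pos; [lra|]. apply Rmult_le_pos; [lra|]. left; apply Rinv_0_lt_compat; lra.
  - replace (C / N) with (C / (sqrt N * sqrt N)) by now rewrite HsN2.
    field. lra.
Qed.

Lemma sqrt_gauss X : 0 < X -> sqrt (2 * PI / X) = 2 * PI * / sqrt (2 * PI * X).
Proof.
  intros HX. pose proof PI_RGT_0.
  rewrite sqrt_div, (sqrt_mult (2 * PI) X) by lra.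
  assert (0 < sqrt (2 * PI)) by (apply sqrt_lt_R0; lra).
  assert (0 < sqrt X) by (now apply sqrt_lt_R0).
  assert (E : sqrt (2 * PI) * sqrt (2 * PI) = 2 * PI) by (apply sqrt_sqrt; lra).
  remember (sqrt (2 * PI)) as g. rewrite <- E. field. lra.
Qed.

(** The saddle point contribution of the critical point - 1 / v with curvature k. *)
Definition amp (p q y z v k N : R) : R :=
  exp (N * segexp p q y z (- ln v)) / sqrt (2 * PI * (N * k)).

(** The errors e1 and e2 multiply the cosine and the sine term separately, which is the
    relation [sim2]. *)
Lemma coef_asymptotic p q d : exists C, forall (N n : nat) y z v w, (1 <= N)%nat ->
  INR n = z * INR N -> roots p q d y z v w ->
  exists e1 e2, Rabs e1 <= C / sqrt (INR N) /\ Rabs e2 <= C / sqrt (INR N) /\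
  coef p q (y * INR N) (INR N - y * INR N) n
  = (-1) ^ n * (cos (PI * (y * INR N)) * (amp p q y z v (curv p q z v w) (INR N) * (1 + e1))
       - sin (PI * (y * INR N)) * (2 * amp p q y z w (- curv p q z w v) (INR N) * (1 + e2))).
Proof.
  destruct (arc_asymptotic p q d) as [C1 HC1]. destruct (seg_asymptotic p q d) as [C2 HC2].
  set (c := seg_c p q d). set (T0 := seg_T p q d).
  set (C3 := (PI + / (p * q * d)) / (c * T0 ^ 2)).
  exists (2 * Rabs C1 * sqrt (/ d) + (Rabs C2 + C3) * sqrt (/ d)).
  intros N n y z v w HN Hn H.
  assert (HN1 : 1 <= INR N) by (apply (le_INR 1); assumption).
  specialize (HC1 (INR N) y z v w HN1 H). specialize (HC2 (INR N) y z v w HN1 H). cbv zeta in HC1, HC2.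
  pose proof (curv_bounds _ _ _ _ _ _ _ H) as HK. pose proof (curv_bounds_second _ _ _ _ _ _ _ H) as HK'.
  pose proof (seg_len_ge _ _ _ _ _ _ _ 1 H (or_introl eq_refl)) as HLen.
  pose proof (seg_tail _ _ _ _ _ _ _ (INR N) 1 (seg_len q v w 1) H ltac:(lra) (or_introl eq_refl) ltac:(lra)) as Tail.
  destruct (roots_facts _ _ _ _ _ _ _ H) as (F0 & F1 & F2 & F3 & F4 & F5 & F6 & _).
  pose proof H as HR.
  destruct HR as ((Hp & Hq & Hpq) & Hd & Hz & Hy & E1 & E2 & Hv & Hvw & Hw).
  destruct (seg_constants p q d) as (HM & Hc & HT & HMT); try lra.
  fold c in Hc, Tail. fold T0 in HT, Tail.
  replace (- ln w + 1 * seg_len q v w 1) with (- ln v) in Tail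
    by (unfold seg_len; destruct (Rlt_dec 0 1); [ring|lra]).
  set (x := y * INR N) in *. replace (INR N - x) with ((1 - y) * INR N) by (unfold x; ring).
  set (a := (1 - y) * INR N) in *.
  assert (Hx : 0 < x) by (apply Rmult_lt_0_compat; lra).
  assert (Ha : 0 < a) by (apply Rmult_lt_0_compat; lra).
  assert (HxN : x + a = INR N) by (unfold x, a; ring).
  set (S := - ln v) in *.
  assert (HE : exp S = / v) by (unfold S; rewrite exp_Ropp, exp_ln by assumption; reflexivity).
  assert (HqS : 1 < q * exp S).
  { rewrite HE. apply (Rmult_lt_reg_r v); [assumption|]. rewrite Rmult_assoc, Rinv_l; lra. }
  assert (HqS' : 1 < q * exp (- ln w)).
  { rewrite exp_Ropp, exp_ln by assumption. apply (Rmult_lt_reg_r w); [assumption|].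
    rewrite Rmult_assoc, Rinv_l; lra. }
  set (hS := hmod p q x a (z * INR N) S PI) in *.
  set (hw := hmod p q x a (z * INR N) (- ln w) PI) in *.
  assert (EhS : hS = exp (INR N * segexp p q y z S)) by (apply hmod_left_cut; lra).
  assert (Ehw : hw = exp (INR N * segexp p q y z (- ln w))) by (apply hmod_left_cut; lra).
  assert (PhS : 0 < hS) by (rewrite EhS; apply exp_pos).
  assert (Phw : 0 < hw) by (rewrite Ehw; apply exp_pos).
  pose proof PI2_1 as HPI.
  destruct (coef_decomposition p q x a n N S hS) as [r [Hr ED]]; try assumption; try lra.
  { intros s Hs Hps. rewrite Hn. apply (hmod_right_cut_le _ _ _ _ _ _ _ _ _ H); [lra|exact Hs|exact Hps]. }
  rewrite Hn in ED.
  set (Ic := RInt (fun t => hmod p q x a (z * INR N) S t *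
     cos (hang p q x a (z * INR N) S t - hang p q x a (z * INR N) S PI)) 0 PI) in *.
  set (Is := RInt (fun t => hmod p q x a (z * INR N) S t *
     sin (hang p q x a (z * INR N) S t - hang p q x a (z * INR N) S PI)) 0 PI) in *.
  set (J := RInt (fun s => hmod p q x a (z * INR N) s PI) (- ln q) S) in *.
  set (k := curv p q z v w) in *. set (k' := - curv p q z w v) in *.
  assert (Hk0 : 0 < p * (p * q * d) * d) by (repeat apply Rmult_lt_0_compat; lra).
  assert (Hd1 : 0 < / d) by (apply Rinv_0_lt_compat; lra).
  assert (HiN : 0 < / INR N) by (apply Rinv_0_lt_compat; lra).
  (* the half circle, doubled to a full Gaussian *)
  assert (X1 : exists e1, Rabs e1 <= 2 * Rabs C1 * sqrt (/ d) / sqrt (INR N) /\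
     2 * Ic = hS * sqrt (2 * PI / (INR N * k)) * (1 + e1)).
  { apply relative_error; try lra; [pose proof (Rabs_pos C1); lra|].
    replace (2 * Ic - hS * sqrt (2 * PI / (INR N * k)))
      with (2 * (Ic - hS * (/ 2 * sqrt (2 * PI / (INR N * k))))) by field.
    rewrite Rabs_mult, (Rabs_pos_eq 2) by lra.
    replace (hS * (2 * Rabs C1 / INR N)) with (2 * (hS * (Rabs C1 / INR N))) by (field; lra).
    apply Rmult_le_compat_l; [lra|]. eapply Rle_trans; [exact HC1|].
    apply Rmult_le_compat_l; [lra|]. apply Rmult_le_compat_r; [lra|apply Rle_abs]. }
  assert (HcT : 0 < c * T0 ^ 2) by (apply Rmult_lt_0_compat; [assumption|apply pow_lt; lra]).
  assert (HhS : hS <= hw * / (INR N * (c * T0 ^ 2))).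
  { eapply Rle_trans; [exact Tail|]. apply Rmult_le_compat_l; [lra|].
    replace (- INR N * (c * T0 ^ 2)) with (- (INR N * (c * T0 ^ 2))) by ring.
    apply exp_neg_bound. apply Rmult_lt_0_compat; lra. }
  assert (HIs : Rabs Is <= PI * hS).
  { replace PI with (PI - 0) at 1 by ring. apply abs_RInt_le_const; [lra| |].
    - set (a0 := hang p q x a (z * INR N) S PI).
      apply ex_RInt_cont; [lra|]. intros t _.
      destruct (h_cont_pos p q x a (z * INR N) S t Hx Ha) as [CR CI].
      apply (continuous_ext (fun t => minus (cos a0 * him p q x a (z * INR N) S t)
         (sin a0 * hre p q x a (z * INR N) S t))).
      + intros u. unfold minus, plus, opp; simpl. rewrite sin_minus. unfold hre, him. ring.
      + apply (continuous_minus (V := R_NormedModule));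
          apply (continuous_scal_r (K := R_AbsRing) (V := R_NormedModule)); apply continuous_2d_snd; assumption.
    - intros t Ht. rewrite Rabs_mult, (Rabs_pos_eq (hmod _ _ _ _ _ _ _)) by apply hmod_ge0.
      apply Rle_trans with (hmod p q x a (z * INR N) S t * 1).
      + apply Rmult_le_compat_l; [apply hmod_ge0|apply Rabs_sin_le].
      + rewrite Rmult_1_r.
        pose proof (arc_le _ _ _ _ _ _ _ (INR N) (z * INR N) (PI - t) H ltac:(lra)) as HA.
        cbv zeta in HA. replace (PI - (PI - t)) with t in HA by ring. fold x a S in HA. fold hS in HA.
        eapply Rle_trans; [exact HA|]. rewrite <- (Rmult_1_r hS) at 2.
        apply Rmult_le_compat_l; [lra|]. apply exp_le_1.
        fold k. pose proof (COS_bound (PI - t)).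
        assert (0 <= INR N * (k * (1 - cos (PI - t)))) by (apply Rmult_le_pos; [lra|apply Rmult_le_pos; lra]).
        lra. }
  assert (HSb : 0 < S <= / (p * q * d)).
  { unfold S. pose proof (ln_neg v ltac:(lra)). split; [lra|].
    rewrite <- ln_Rinv by lra.
    pose proof (ln_le_sub1 (/ v) ltac:(apply Rinv_0_lt_compat; lra)).
    pose proof (Rinv_le_contravar _ _ F0 Hv). lra. }
  assert (HC3 : 0 <= C3).
  { apply Rmult_le_pos; [|left; now apply Rinv_0_lt_compat].
    pose proof (Rinv_0_lt_compat _ F0). lra. }
  (* the left cut, with the terms of size |h(1 / U^+)| absorbed into its relative error *)
  assert (X2 : exists e2, Rabs e2 <= (Rabs C2 + C3) * sqrt (/ d) / sqrt (INR N) /\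
     J + Is + r = hw * sqrt (2 * PI / (INR N * k')) * (1 + e2)).
  { apply relative_error; try lra; [pose proof (Rabs_pos C2); lra|].
    replace (J + Is + r - hw * sqrt (2 * PI / (INR N * k')))
      with ((J - hw * sqrt (2 * PI / (INR N * k'))) + (Is + r)) by ring.
    eapply Rle_trans; [apply Rabs_triang|].
    replace (hw * ((Rabs C2 + C3) / INR N)) with (hw * (Rabs C2 / INR N) + hw * (C3 / INR N)) by (field; lra).
    apply Rplus_le_compat.
    - eapply Rle_trans; [exact HC2|].
      apply Rmult_le_compat_l; [lra|]. apply Rmult_le_compat_r; [lra|apply Rle_abs].
    - eapply Rle_trans; [apply Rabs_triang|].
      apply Rle_trans with ((PI + / (p * q * d)) * hS).
      + rewrite Rmult_plus_distr_r. apply Rplus_le_compat; [assumption|].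
        eapply Rle_trans; [exact Hr|]. apply Rmult_le_compat_r; lra.
      + apply Rle_trans with ((PI + / (p * q * d)) * (hw * / (INR N * (c * T0 ^ 2)))).
        * apply Rmult_le_compat_l; [|assumption]. pose proof (Rinv_0_lt_compat _ F0). lra.
        * right. unfold C3. field. repeat split; try lra. }
  destruct X1 as [e1 [He1 X1]]. destruct X2 as [e2 [He2 X2]].
  assert (Hsd : 0 <= sqrt (/ d)) by apply sqrt_pos.
  assert (HisN : 0 < / sqrt (INR N)) by (apply Rinv_0_lt_compat, sqrt_lt_R0; lra).
  pose proof (Rabs_pos C1). pose proof (Rabs_pos C2).
  assert (Z1 : 0 <= 2 * Rabs C1 * sqrt (/ d) / sqrt (INR N)).
  { apply Rmult_le_pos; [|lra]. apply Rmult_le_pos; lra. }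
  assert (Z2 : 0 <= (Rabs C2 + C3) * sqrt (/ d) / sqrt (INR N)).
  { apply Rmult_le_pos; [|lra]. apply Rmult_le_pos; lra. }
  exists e1, e2.
  replace ((2 * Rabs C1 * sqrt (/ d) + (Rabs C2 + C3) * sqrt (/ d)) / sqrt (INR N))
    with (2 * Rabs C1 * sqrt (/ d) / sqrt (INR N) + (Rabs C2 + C3) * sqrt (/ d) / sqrt (INR N))
    by (unfold Rdiv; ring).
  split; [lra|]. split; [lra|].
  rewrite X2 in ED. rewrite sqrt_gauss in X1, ED by (apply Rmult_lt_0_compat; lra).
  apply (Rmult_eq_reg_l PI); [|lra]. rewrite ED.
  unfold amp. fold S. rewrite <- EhS, <- Ehw.
  replace Ic with (hS * (PI * / sqrt (2 * PI * (INR N * k))) * (1 + e1)) by lra.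
  unfold Rdiv. ring.
Qed.

(** * Branches of the closed formula *)

(** The margin y <= Y^-(z) - d gives U^+ - U^- >= d.  Both roots lie to the right of - q because
    z > p, and the value y q of the quadratic at q keeps them away from it. *)
Lemma roots_U p q d y z : 0 < p < 1 -> 0 < q < 1 -> p + q = 1 -> 0 < d ->
  p + d <= z <= 1 - d -> d <= y <= Y (-1) p q z - d ->
  roots p q d y z (- U 1 p q y z) (- U (-1) p q y z) /\
  U 1 p q y z * U (-1) p q y z = U0 p q z ^ 2.
Proof.
  intros Hp Hq Hpq Hd Hz Hy. unfold Y in Hy. unfold U.
  assert (Eu : U0 p q z ^ 2 = p * q * (1 - z) / z).
  { unfold U0. rewrite pow2_sqrt; [reflexivity|].
    apply Rmult_le_pos; [repeat apply Rmult_le_pos; lra|left; apply Rinv_0_lt_compat; lra]. }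
  assert (Hu : 0 < U0 p q z).
  { unfold U0. apply sqrt_lt_R0, Rdiv_lt_0_compat; [|lra]. repeat apply Rmult_lt_0_compat; lra. }
  set (u := U0 p q z) in *. set (b := (p - y) / z + q - p).
  assert (Ezb : z * b = p - y + (q - p) * z) by (unfold b; field; lra).
  assert (Ezu : z * u ^ 2 = p * q * (1 - z)) by (rewrite Eu; field; lra).
  assert (Hb : 2 * u + d <= b).
  { apply (Rmult_le_reg_l z); [lra|]. rewrite Ezb. nra. }
  assert (Hr2 : d ^ 2 <= b ^ 2 - 4 * u ^ 2) by nra.
  set (r := sqrt (b ^ 2 - 4 * u ^ 2)).
  assert (Er : r * r = b ^ 2 - 4 * u ^ 2) by (apply sqrt_sqrt; pose proof (pow2_ge_0 d); lra).
  assert (Hr : d <= r).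
  { unfold r. rewrite <- (sqrt_pow2 d) by lra. now apply sqrt_le_1_alt. }
  set (v := - (- (1 / 2) * b + 1 * (1 / 2 * r))). set (w := - (- (1 / 2) * b + -1 * (1 / 2 * r))).
  assert (Svw : v + w = b) by (unfold v, w; field).
  assert (Dvw : w - v = r) by (unfold v, w; field).
  assert (Pvw : v * w = u ^ 2).
  { unfold v, w. replace (u ^ 2) with ((b ^ 2 - r * r) / 4) by (rewrite Er; field). field. }
  split.
  2:{ replace (- (1 / 2) * b + 1 * (1 / 2 * r)) with (- v) by (unfold v; ring).
      replace (- (1 / 2) * b + -1 * (1 / 2 * r)) with (- w) by (unfold w; ring). lra. }
  assert (Hu2 : 0 < u ^ 2) by (apply pow_lt; lra).
  assert (Pw : 0 < w) by lra.
  assert (Pv : 0 < v) by nra.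
  assert (Eq1 : y * q = z * (q - v) * (q - w)).
  { replace (z * (q - v) * (q - w)) with (z * q ^ 2 - q * (z * (v + w)) + z * (v * w)) by ring.
    rewrite Svw, Pvw, Ezb, Ezu. replace q with (1 - p) by lra. ring. }
  assert (Eq2 : (1 - y) * p = z * (p + v) * (p + w)).
  { replace (z * (p + v) * (p + w)) with (z * p ^ 2 + p * (z * (v + w)) + z * (v * w)) by ring.
    rewrite Svw, Pvw, Ezb, Ezu. replace q with (1 - p) by lra. ring. }
  assert (Hy1 : 0 < (1 - y) * p) by (rewrite Eq2; repeat apply Rmult_lt_0_compat; lra).
  assert (Hyq : 0 < y * q) by (apply Rmult_lt_0_compat; lra).
  assert (Hs : 0 < (q - v) + (q - w)).
  { apply (Rmult_lt_reg_l z); [lra|]. replace (z * (q - v + (q - w))) with (2 * q * z - z * (v + w)) by ring.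
    rewrite Svw, Ezb. nra. }
  assert (Hqv : 0 < q - v) by lra.
  assert (Hqw : 0 < q - w).
  { apply Rnot_le_lt. intros L. assert (0 <= z * (q - v)) by (apply Rmult_le_pos; lra). nra. }
  assert (Hqwd : d <= q - w).
  { apply (Rmult_le_reg_r q); [lra|]. apply Rle_trans with (y * q); [apply Rmult_le_compat_r; lra|].
    rewrite Eq1, (Rmult_comm _ (q - w)). apply Rmult_le_compat_l; [lra|]. nra. }
  assert (Hvd : p * q * d <= v).
  { apply Rle_trans with (u ^ 2); [|rewrite <- Pvw; apply Rle_trans with (v * 1); [apply Rmult_le_compat_l|]; lra].
    rewrite Eu. assert (0 < p * q) by (apply Rmult_lt_0_compat; lra).
    apply Rle_trans with (p * q * (1 - z)); [apply Rmult_le_compat_l; lra|].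
    apply (Rmult_le_reg_r z); [lra|]. unfold Rdiv. rewrite (Rmult_assoc _ (/ z)), Rinv_l by lra.
    assert (0 <= p * q * (1 - z)) by (apply Rmult_le_pos; lra). nra. }
  repeat split; try lra; try assumption. nra.
Qed.

(** The branches contribute the argument pi (n - x) in total, which the prefactor turns into pi n. *)
Lemma Cexp_phase N y z A n :
  INR n = z * N ->
  (Cexp (RtoC (PI * (y * N)) * Ci) * Cexp (RtoC N * (A, (PI * (z - y))%R)))%C
  = RtoC ((-1) ^ n * exp (N * A)).
Proof.
  intros Hn. unfold Cexp, Cmult, RtoC, Ci, Re, Im; simpl.
  replace (PI * (y * N) * 0 - 0 * 1) with 0 by ring.
  replace (PI * (y * N) * 1 + 0 * 0) with (PI * (y * N)) by ring.
  replace (N * A - 0 * (PI * (z - y))) with (N * A) by ring.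
  replace (N * (PI * (z - y)) + 0 * A) with (INR n * PI - PI * (y * N)) by (rewrite Hn; ring).
  rewrite exp_0, cos_minus, sin_minus, sin_INR_PI, cos_INR_PI.
  set (th := PI * (y * N)). pose proof (sin2_cos2 th) as Hsc. unfold Rsqr in Hsc.
  apply injective_projections; simpl.
  - replace (1 * cos th * (exp (N * A) * ((-1) ^ n * cos th + 0 * sin th)) -
       1 * sin th * (exp (N * A) * (0 * cos th - (-1) ^ n * sin th)))
      with ((-1) ^ n * exp (N * A) * (sin th * sin th + cos th * cos th)) by ring.
    rewrite Hsc. ring.
  - ring.
Qed.

(** Both saddle points lie in (- q, 0), where U and U - p are negative and U + q is positive. *)
Lemma psi_eq s p q y z v : 0 < p -> 0 < v < q -> U s p q y z = - v ->
  psi s p q y z = (segexp p q y z (- ln v), PI * (z - y)).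
Proof.
  intros Hp Hv E. unfold psi. rewrite E.
  unfold lnC.
  destruct (Rlt_dec (- v) 0); [|lra]. destruct (Rlt_dec (- v - p) 0); [|lra].
  destruct (Rlt_dec (- v + q) 0); [lra|].
  rewrite Rabs_Ropp, (Rabs_pos_eq v), (Rabs_left (- v - p)), (Rabs_pos_eq (- v + q)) by lra.
  unfold segexp. rewrite exp_Ropp, exp_ln by lra.
  replace (q * / v - 1) with ((- v + q) * / v) by (field; lra).
  replace (1 + p * / v) with (- (- v - p) * / v) by (field; lra).
  assert (0 < / v) by (apply Rinv_0_lt_compat; lra).
  rewrite !ln_mult, !ln_Rinv by lra.
  unfold Cmult, Cplus, RtoC; apply injective_projections; simpl; ring.
Qed.

Lemma L_plus p q d y z v w : roots p q d y z v w ->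
  U 1 p q y z = - v -> U 1 p q y z * U (-1) p q y z = U0 p q z ^ 2 -> U (-1) p q y z = - w ->
  L 1 p q y z = RtoC (/ sqrt (curv p q z v w)).
Proof.
  intros H E1 EP E2. pose proof (curv_bounds _ _ _ _ _ _ _ H) as HK.
  destruct (roots_facts _ _ _ _ _ _ _ H) as (F0 & F1 & F2 & F3 & F4 & F5 & F6 & _).
  destruct H as ((Hp & Hq & Hpq) & Hd & Hz & Hy & _ & _ & Hv & Hvw & Hw).
  assert (HK0 : 0 < curv p q z v w).
  { eapply Rlt_le_trans; [|apply HK]. repeat apply Rmult_lt_0_compat; lra. }
  unfold L. rewrite <- EP, E1, E2.
  replace ((- v - p) * (- v + q) / (z * ((- v) ^ 2 - - v * - w))) with (/ curv p q z v w)
    by (unfold curv; field; repeat split; nra).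
  pose proof (Rinv_0_lt_compat _ HK0).
  unfold sqrtC. destruct (Rlt_dec _ 0); [lra|]. now rewrite sqrt_inv.
Qed.

(** At the maximum the radicand is negative; its root i turns the factor 2 i of the second term
    into - 2. *)
Lemma L_minus p q d y z v w : roots p q d y z v w ->
  U 1 p q y z = - v -> U 1 p q y z * U (-1) p q y z = U0 p q z ^ 2 -> U (-1) p q y z = - w ->
  L (-1) p q y z = (Ci * RtoC (/ sqrt (- curv p q z w v)))%C.
Proof.
  intros H E1 EP E2. pose proof (curv_bounds_second _ _ _ _ _ _ _ H) as HK.
  destruct (roots_facts _ _ _ _ _ _ _ H) as (F0 & F1 & F2 & F3 & F4 & F5 & F6 & _).
  destruct H as ((Hp & Hq & Hpq) & Hd & Hz & Hy & _ & _ & Hv & Hvw & Hw).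
  assert (HK0 : 0 < - curv p q z w v).
  { eapply Rlt_le_trans; [|apply HK]. repeat apply Rmult_lt_0_compat; lra. }
  unfold L. rewrite <- EP, E1, E2.
  replace ((- w - p) * (- w + q) / (z * ((- w) ^ 2 - - v * - w))) with (- / - curv p q z w v)
    by (unfold curv; field; repeat split; nra).
  pose proof (Rinv_0_lt_compat _ HK0).
  unfold sqrtC. destruct (Rlt_dec _ 0); [|lra].
  rewrite Rabs_Ropp, Rabs_pos_eq, sqrt_inv by lra.
  unfold Ci, Cmult, RtoC; apply injective_projections; simpl; ring.
Qed.

Lemma gaussian_prefactor N k X : 0 < N -> 0 < k ->
  sqrt (1 / N) / sqrt (2 * PI) * X * / sqrt k = X / sqrt (2 * PI * (N * k)).
Proof.
  intros HN Hk. pose proof PI_RGT_0.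
  assert (0 < sqrt (2 * PI)) by (apply sqrt_lt_R0; lra).
  assert (0 < sqrt N) by (now apply sqrt_lt_R0). assert (0 < sqrt k) by (now apply sqrt_lt_R0).
  rewrite sqrt_div, sqrt_1, !sqrt_mult by (try lra; nra).
  assert (0 < sqrt 2) by (apply sqrt_lt_R0; lra). assert (0 < sqrt PI) by (apply sqrt_lt_R0; lra).
  field. repeat split; lra.
Qed.

Lemma Cmod_real_sub e : Cmod (RtoC (1 + e) - 1)%C = Rabs e.
Proof.
  replace (RtoC (1 + e) - 1)%C with (RtoC e); [apply Cmod_R|].
  unfold Cminus, Cplus, Copp, RtoC; apply injective_projections; simpl; ring.
Qed.

(* The error is uniform on each set p + delta <= z <= 1 - delta,
   delta <= y <= Y^-(z) - delta; these sets exhaust the region p < z < 1,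
   0 < y < Y^-(z), and N0 depends only on p, q, delta and eta. *)
Theorem mainTheorem7 :
  forall p q : R, 0 < p < 1 -> 0 < q < 1 -> p + q = 1 ->
  forall delta : R, 0 < delta ->
  forall eta : R, 0 < eta ->
  exists N0 : nat, forall (N n : nat) (x y z eps : R),
    (N0 <= N)%nat -> (0 < N)%nat ->
    eps = 1 / INR N -> x = y * INR N -> INR n = z * INR N ->
    p + delta <= z <= 1 - delta ->
    delta <= y <= Y (-1) p q z - delta ->
    sim2 eta
      (RtoC (krawtchouk p q N n x))
      (Cexp (RtoC (PI * y / eps) * Ci)
       * (RtoC (cos (PI * y / eps)) * K 1 p q eps y z))%C
      (Cexp (RtoC (PI * y / eps) * Ci)
       * (2 * Ci * RtoC (sin (PI * y / eps)) * K (-1) p q eps y z))%C.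
Proof.
  intros p q Hp Hq Hpq d Hd eta Heta.
  destruct (coef_asymptotic p q d) as [C HC].
  (* C / sqrt N < eta for N > (C / eta)^2 *)
  destruct (INR_unbounded ((Rabs C / eta) ^ 2)) as [N0 HN0].
  exists N0. intros N n x y z eps HN HNp Heps Hx Hn Hz Hy.
  destruct (roots_U p q d y z Hp Hq Hpq Hd Hz Hy) as [HR EP].
  set (v := - U 1 p q y z) in *. set (w := - U (-1) p q y z) in *.
  assert (Uv : U 1 p q y z = - v) by (unfold v; ring).
  assert (Uw : U (-1) p q y z = - w) by (unfold w; ring).
  destruct (HC N n y z v w HNp Hn HR) as (e1 & e2 & He1 & He2 & ED).
  assert (HN1 : 1 <= INR N) by (apply (le_INR 1); assumption).
  assert (HCN : C / sqrt (INR N) < eta).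
  { assert (HsN : 0 < sqrt (INR N)) by (apply sqrt_lt_R0; lra).
    apply Rle_lt_trans with (Rabs C / sqrt (INR N)).
    { apply Rmult_le_compat_r; [left; now apply Rinv_0_lt_compat|apply Rle_abs]. }
    apply (Rmult_lt_reg_r (sqrt (INR N))); [assumption|].
    replace (Rabs C / sqrt (INR N) * sqrt (INR N)) with (Rabs C / eta * eta) by (field; lra).
    rewrite Rmult_comm. apply Rmult_lt_compat_l; [assumption|].
    rewrite <- (sqrt_pow2 (Rabs C / eta)).
    - apply sqrt_lt_1_alt. split; [apply pow2_ge_0|].
      apply le_INR in HN. lra.
    - apply Rmult_le_pos; [apply Rabs_pos|left; now apply Rinv_0_lt_compat]. }
  exists (RtoC (1 + e1)), (RtoC (1 + e2)). rewrite !Cmod_real_sub.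
  split; [lra|]. split; [lra|].
  change (krawtchouk p q N n x) with (coef p q x (INR N - x) n). subst x. rewrite ED.
  pose proof (curv_bounds _ _ _ _ _ _ _ HR) as HK. pose proof (curv_bounds_second _ _ _ _ _ _ _ HR) as HK'.
  destruct (roots_facts _ _ _ _ _ _ _ HR) as (F0 & F1 & F2 & F3 & F4 & F5 & F6 & _).
  assert (Hk0 : 0 < p * (p * q * d) * d) by (repeat apply Rmult_lt_0_compat; lra).
  assert (Hie : / eps = INR N) by (subst eps; field; lra).
  replace (PI * y / eps) with (PI * (y * INR N)) by (unfold Rdiv; rewrite Hie; ring).
  unfold K. rewrite Hie, (psi_eq 1 p q y z v), (psi_eq (-1) p q y z w) by (try assumption; lra).
  rewrite (L_plus _ _ _ _ _ _ _ HR Uv EP Uw), (L_minus _ _ _ _ _ _ _ HR Uv EP Uw).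
  set (cs := cos (PI * (y * INR N))). set (sn := sin (PI * (y * INR N))).
  set (ph := Cexp (RtoC (PI * (y * INR N)) * Ci)).
  set (Ev := Cexp (RtoC (INR N) * (segexp p q y z (- ln v), PI * (z - y))%R)).
  set (Ew := Cexp (RtoC (INR N) * (segexp p q y z (- ln w), PI * (z - y))%R)).
  assert (Pv : (ph * Ev)%C = RtoC ((-1) ^ n * exp (INR N * segexp p q y z (- ln v))))
    by now apply Cexp_phase.
  assert (Pw : (ph * Ew)%C = RtoC ((-1) ^ n * exp (INR N * segexp p q y z (- ln w))))
    by now apply Cexp_phase.
  set (kv := curv p q z v w) in *. set (kw := - curv p q z w v) in *.
  assert (CiCi : (Ci * Ci)%C = RtoC (-1)).
  { unfold Ci, Cmult, RtoC; apply injective_projections; simpl; ring. }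
  replace (ph * (RtoC cs * (RtoC (sqrt eps / sqrt (2 * PI)) * Ev * RtoC (/ sqrt kv))))%C
    with (RtoC cs * (RtoC (sqrt eps / sqrt (2 * PI)) * (ph * Ev) * RtoC (/ sqrt kv)))%C by ring.
  replace (ph * (2 * Ci * RtoC sn * (RtoC (sqrt eps / sqrt (2 * PI)) * Ew * (Ci * RtoC (/ sqrt kw)))))%C
    with (2 * (Ci * Ci) * RtoC sn * (RtoC (sqrt eps / sqrt (2 * PI)) * (ph * Ew) * RtoC (/ sqrt kw)))%C by ring.
  rewrite Pv, Pw, CiCi, Heps, <- !RtoC_mult, !gaussian_prefactor by lra.
  rewrite <- RtoC_plus. f_equal. unfold amp, Rdiv. ring.
Qed.
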